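(* Fix constants $0<\hat\beta_{\min}\le\hat\beta_{\max}<\frac14\bar\beta<1$, independent of $N$, and write $L=\log N$ (with $N\ge3$). There exist constants $c_0,C>0$, depending only on $\hat\beta_{\min}$ and $\hat\beta_{\max}$, such that whenever $$h\le\sqrt{\frac{c_0L}{\log L}},$$ the following assertions hold uniformly over all $\hat{\boldsymbol\beta}=(\hat\beta_e)_{e\in\Pi_h}$ with $\hat\beta_{\min}\le\hat\beta_e\le\hat\beta_{\max}$ for all $e\in\Pi_h$. (i) There exists $r_{N,h}\ge0$ such that $$\mathcal M^h_{N,\hat{\boldsymbol\beta}}\ge\Big(\prod_{e\in\Pi_h}\frac1{1-\hat\beta_e}\Big)e^{-r_{N,h}},\qquad r_{N,h}\le C\,\frac{h^2\log L}{L}.$$ Consequently, if $h=h_N$ satisfies $h^2\log L/L\to0$ as $N\to\infty$, then $$\liminf_{N\to\infty}\Big(\mathcal M^h_{N,\hat{\boldsymbol\beta}}\prod_{e\in\Pi_h}(1-\hat\beta_e)\Big)\ge1 .$$ (ii) For any $C'>0$ there exists $\delta_{C'}>0$ such that, if in addition $h=h_N=o\big(\sqrt{L/\log L}\big)$ and $h\ge C'L^{1/3}$, then, for all sufficiently large $N$, $$\mathcal M^h_{N,\hat{\boldsymbol\beta}}\ge e^{\delta_{C'}}\prod_{e\in\Pi_h}\frac1{1-\hat\beta_e}.$$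
   Context: $\Pi_h$ is the set of all unordered pairs $e=\{i,j\}$ with $1\le i<j\le h$. Let $S^1,\dots,S^h$ be independent simple symmetric random walks on $\mathbb Z^2$, all started from the origin, with joint expectation $\mathsf E^{\otimes h}$. For $e=\{i,j\}\in\Pi_h$ let $\mathsf L^{e}_N=\sum_{n=1}^N\mathbf 1_{\{S^i_n=S^j_n\}}$, and define $$\mathcal M^h_{N,\hat{\boldsymbol\beta}}:=\mathsf E^{\otimes h}\Big[\exp\Big(\sum_{e\in\Pi_h}\frac{\pi\hat\beta_e}{\log N}\,\mathsf L^{e}_N\Big)\Big].$$ The number $\bar\beta\in(0,1/72)$ is the fixed constant from the following known theorem of Cosco and Zeitouni: in the homogeneous case $\hat\beta_e\equiv\hat\beta\in(0,\bar\beta)$ and for $h=h_N\le C\sqrt{\log N}$ with some $C>0$, one has $\mathcal M^h_{N,\hat{\boldsymbol\beta}}=\big(\tfrac1{1-\hat\beta}\big)^{\binom h2(1+o(1))}$ as $N\to\infty$. *)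

(* Defs.v *)
From HB Require Import structures.
From mathcomp Require Import all_boot all_order all_algebra.
From mathcomp Require Import all_classical all_reals all_analysis.

Set Implicit Arguments.
Unset Strict Implicit.
Unset Printing Implicit Defensive.

Import Order.TTheory GRing.Theory Num.Theory.
Import numFieldNormedType.Exports.

Local Open Scope classical_set_scope.
Local Open Scope ring_scope.

Definition step (d : bool * bool) : int * int :=
  let: (vertical, negative) := d in
  if vertical then (0, (-1) ^+ negative) else ((-1) ^+ negative, 0).

(* The walk of N steps is given by its increments; under the uniform
   probability on this finite type the increments are i.i.d. and uniform on
   the four unit vectors of Z^2. *)
Definition walk (N : nat) := {ffun 'I_N -> bool * bool}.

(* Site at time n (for n <= N), starting from the origin at time 0. *)
Definition site (N : nat) (w : walk N) (n : nat) : int * int :=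
  \sum_(k < N | (k < n)%N) step (w k).

Definition walks (h N : nat) := {ffun 'I_h -> walk N}.

(* Joint expectation: the uniform probability on walks h N is the h-fold product
   of the uniform probability on walk N, i.e. the joint law, up to time N, of h
   independent simple symmetric random walks. *)
Definition expect (R : realType) (h N : nat) (f : walks h N -> R) : R :=
  (\sum_(S : walks h N) f S) / #|{: walks h N}|%:R.

(* The unordered pair {i, j} is represented by (i, j) with i < j; a family
   indexed by Pairs h is a function on 'I_h * 'I_h whose values outside Pairs h
   are never used. *)
Definition Pairs (h : nat) : {set 'I_h * 'I_h} :=
  [set e : 'I_h * 'I_h | (e.1 < e.2)%N].

Definition local_time (h N : nat) (S : walks h N) (e : 'I_h * 'I_h) : nat :=
  (\sum_(1 <= n < N.+1) (site (S e.1) n == site (S e.2) n))%N.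

Definition logN (R : realType) (N : nat) : R := ln (N%:R : R).

Definition moment (R : realType) (N h : nat) (beta : 'I_h * 'I_h -> R) : R :=
  expect (fun S : walks h N =>
    expR (\sum_(e in Pairs h)
            (pi * beta e / logN R N) * (local_time S e)%:R)).

Definition in_box (R : realType) (bmin bmax : R) (h : nat)
    (beta : 'I_h * 'I_h -> R) : Prop :=
  forall e, e \in Pairs h -> bmin <= beta e <= bmax.

(* The defining property of the Cosco-Zeitouni constant.  C may depend on b;
   this is the weakest reading of "for h <= C sqrt(log N) with some C > 0". *)
Definition cosco_zeitouni (R : realType) (bbar : R) : Prop :=
  forall b : R, 0 < b < bbar ->
  exists2 C : R, 0 < C &
  forall h : nat -> nat,
    (\forall N \near \oo, (h N)%:R <= C * Num.sqrt (logN R N)) ->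
    exists2 eps : nat -> R, eps @ \oo --> (0 : R) &
    \forall N \near \oo,
      moment N (fun _ : 'I_(h N) * 'I_(h N) => b)
      = (1 / (1 - b)) `^ ('C(h N, 2)%:R * (1 + eps N)).

(* Main.v *)
Require Import Defs.
From HB Require Import structures.
From mathcomp Require Import all_boot all_order all_algebra.
From mathcomp Require Import all_classical all_reals all_analysis.
From mathcomp Require Import ring lra zify complex.

(** The exponential moment is bounded below by keeping, for each pair of walks,
    only some of its meeting times, and by showing that the corresponding
    meeting events are almost positively correlated.

    Expansion.  Since exp (lam L^e) is at least the product over n <= N of
    1 + lam 1(the pair e meets at time n), the moment dominates a sum over
    families of visits: for each pair e, a list of gaps between the meetings
    that are kept ([moment_ge_families]).  With l close to log N, a list has at
    most l gaps, all between l^10 and N / l, and a family is used only if the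
    visit times of two different pairs are always l^6 apart.

    Correlation.  The two diagonal coordinates of a planar walk are independent
    walks on the line, so the probability of all the visits of a family is at
    least the square of a one-dimensional probability
    ([collisions_of_constraints]).  Fourier inversion over finitely many angles
    writes the latter as an average of a product of cosines, one for each cell,
    that is, for each walk and step ([fourier_inversion]).  Because visit times
    are well separated, a phase that occurs at all is repeated at least l^6
    times; hence the product of cosines is bounded below, up to an error
    negligible with respect to the probability itself, by exp (- g sum sin^2)
    with g = (1 + l^-2) / 2 ([prod_cos_ge_damp], [paths_ge_avgs_damp]).  For
    this damped integrand positive correlation is exact: it follows from the
    inequality of the means and from
    sin^2 (s + t) + sin^2 (s - t) <= 2 (sin^2 s + sin^2 t)
    ([avgs_damp_parallelogram], [avgs_damp_cons]).  Each gap thus contributes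
    its own return probability, which Wallis' inequality estimates sharply
    ([wallis_return_prob]).

    Summation.  The weights of the gaps of one pair sum to beta_e up to a
    relative error of order loglog N / log N, caused by the cutoffs l^10 and
    N / l, and the lists of gaps build a truncated geometric series for
    1 / (1 - beta_e) ([geometric_ge]).  Families that are not separated carry a
    fraction of order 1 / l of the total weight ([fweight_not_separated]).
    Multiplying over the pairs gives the first assertion ([moment_ge_prod]).

    Gain.  For the second assertion call cherry two pairs that share a walk and
    meet once each, at comparable times.  The steps common to both links
    produce a hyperbolic cosine in the damped integrand, hence a fixed factor
    1 + 1/1024 ([avg_damp_cherry]).  Under the product weights a given pair has
    a single visit at a given dyadic scale with probability of order
    1 / log N; there are about log N scales and about h^3 candidate cherries,
    so that when h^3 >= C'^3 log N a cherry is present with probability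
    bounded below ([cherry_weight]).  The resulting gain is a constant factor,
    whereas the loss factor of the first part tends to one when
    h^2 loglog N / log N tends to zero ([moment_ge_prod_cherry]). *)

Set Implicit Arguments.
Unset Strict Implicit.
Unset Printing Implicit Defensive.

Import Order.TTheory GRing.Theory Num.Theory.
Import numFieldNormedType.Exports.

Local Open Scope ring_scope.

(** * Random signs and finite Fourier inversion *)

Definition cexp (R : realType) (t : R) : complex.complex R :=
  complex.Complex (cos t) (sin t).

Lemma cexpD (R : realType) (s t : R) : cexp (s + t) = cexp s * cexp t.
Proof.
by apply/eqP; rewrite complex.eq_complex /= cosD sinD eqxx /= addrC.
Qed.

(** The cosine of a sum is the real part of a product of complex units, and for
    such products the sum over all sign configurations factorizes. *)
Lemma sum_cos_signs (R : realType) (X : finType) (b : X -> R) :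
  \sum_(u : {ffun X -> bool}) cos (\sum_x b x * (-1) ^+ u x)
  = 2 ^+ #|X| * \prod_x cos (b x).
Proof.
have ReD : {morph (@complex.Re R) : x y / x + y >-> x + y} by case=> ? ? [].
pose e := @cexp R.
have es (u : {ffun X -> bool}) :
    e (\sum_x b x * (-1) ^+ u x) = \prod_x e (b x * (-1) ^+ u x).
  apply: (big_morph e (@cexpD R)).
  by apply/eqP; rewrite complex.eq_complex /= cos0 sin0 !eqxx.
have -> : \sum_(u : {ffun X -> bool}) cos (\sum_x b x * (-1) ^+ u x)
    = complex.Re (\sum_(u : {ffun X -> bool}) e (\sum_x b x * (-1) ^+ u x)).
  by rewrite (big_morph (@complex.Re R) ReD (erefl _)).
rewrite (eq_bigr _ (fun u _ => es u)).
rewrite -(bigA_distr_bigA (fun x (s : bool) => e (b x * (-1) ^+ s))) /=.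
have -> : \prod_x \sum_(s : bool) e (b x * (-1) ^+ s)
   = \prod_x (complex.real_complex R (2 * cos (b x))).
  apply: eq_bigr => x _; rewrite big_bool /= expr0 expr1 mulr1 mulrN1.
  apply/eqP; rewrite complex.eq_complex /= cosN sinN; apply/andP; split.
    by apply/eqP; ring.
  by apply/eqP; ring.
rewrite -rmorph_prod /= big_split /= prodr_const.
by [].
Qed.
(** The angles fill half a period only, since the linear forms of interest take
    even values. *)
Definition angle (R : realType) (n : nat) (k : nat) : R :=
  pi * (k%:R - n%:R) / n.*2.+1%:R.

Definition avg (R : realType) (n : nat) (F : R -> R) : R :=
  (\sum_(k < n.*2.+1) F (angle R n k)) / n.*2.+1%:R.

Lemma avg_const (R : realType) n (c : R) : avg n (fun=> c) = c.
Proof. by rewrite /avg sumr_const card_ord -[X in X / _]mulr_natr mulfK. Qed.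

Lemma eq_avg (R : realType) n (F G : R -> R) : F =1 G -> avg n F = avg n G.
Proof. by move=> FG; rewrite /avg; under eq_bigr do rewrite FG. Qed.

Lemma le_avg (R : realType) n (F G : R -> R) :
  (forall t, F t <= G t) -> avg n F <= avg n G.
Proof. by move=> FG; rewrite ler_wpM2r ?invr_ge0// ler_sum. Qed.

Lemma avgD (R : realType) n (F G : R -> R) :
  avg n (fun t => F t + G t) = avg n F + avg n G.
Proof. by rewrite /avg big_split mulrDl. Qed.

Lemma avgZ (R : realType) n (c : R) (F : R -> R) :
  avg n (fun t => c * F t) = c * avg n F.
Proof. by rewrite /avg -mulr_sumr mulrA. Qed.

Lemma avgZr (R : realType) n (c : R) (F : R -> R) :
  avg n (fun t => F t * c) = avg n F * c.
Proof. by rewrite /avg -mulr_suml mulrAC. Qed.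

Lemma avg_sum (R : realType) n (T : finType) (F : T -> R -> R) :
  avg n (fun t => \sum_i F i t) = \sum_i avg n (F i).
Proof. by rewrite /avg exchange_big /= mulr_suml. Qed.

Lemma avg_exchange (R : realType) n (F : R -> R -> R) :
  avg n (fun s => avg n (F s)) = avg n (fun t => avg n (F ^~ t)).
Proof.
rewrite /avg -!mulr_suml; congr (_ / _ / _).
exact: exchange_big.
Qed.

Lemma avgN (R : realType) n (F : R -> R) : avg n (fun t => F (- t)) = avg n F.
Proof.
rewrite /avg (reindex_inj rev_ord_inj); congr (_ / _).
apply: eq_bigr => k _; congr (F _).
have kn : (k <= n.*2)%N by rewrite -ltnS.
have nn : n.*2%:R = n%:R + n%:R :> R by rewrite -addnn natrD.
rewrite /angle /= subSS natrB// nn.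
have -> : n%:R + n%:R - k%:R - n%:R = - (k%:R - n%:R) :> R by ring.
by rewrite mulrN mulNr opprK.
Qed.

Lemma sin_pin (R : realType) (n : nat) : sin (pi * n%:R : R) = 0.
Proof.
elim: n => [|n IH]; first by rewrite mulr0 sin0.
by rewrite -natr1 mulrDr mulr1 sinD IH sinpi mul0r mulr0 addr0.
Qed.

Lemma sin_piz (R : realType) (z : int) : sin (pi * z%:~R : R) = 0.
Proof.
case: z => n; first exact: sin_pin.
by rewrite NegzE rmorphN /= mulrN sinN sin_pin oppr0.
Qed.

(** Telescoping after multiplication by the sine of half the step, the
    finite counterpart of the orthogonality of characters. *)
Lemma avg_cos (R : realType) n (z : int) (y : R) : (`|z| < n.*2.+1)%N ->
  avg n (fun t => cos (t * (2 * z%:~R) + y)) = (z == 0)%:R * cos y.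
Proof.
move=> zn; have [->|z0] := eqVneq z 0.
  by rewrite mul1r mulr0; under eq_avg do rewrite mulr0 add0r; rewrite avg_const.
rewrite mul0r; set M : R := n.*2.+1%:R.
have M0 : M != 0 by rewrite /M.
pose a : R := pi * z%:~R / M.
have sa : sin a != 0.
  have absa : `|a| = pi * `|z|%N%:R / M.
    by rewrite !normrM normfV (ger0_norm (pi_ge0 R)) (ger0_norm (ler0n R _)) natr_absz intr_norm.
  have : 0 < sin `|a|.
    apply: sin_gt0_pi; rewrite absa; apply/andP; split.
      by rewrite !mulr_gt0 ?pi_gt0 ?invr_gt0 ?ltr0n// absz_gt0.
    by rewrite -mulrA gtr_pMr ?pi_gt0// ltr_pdivrMr ?ltr0n// mul1r ltr_nat.
  case: (ger0P a) => _; first by move/lt0r_neq0.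
  by rewrite sinN oppr_gt0 => /ltr0_neq0.
apply/(mulfI sa)/eqP; rewrite mulr0 /avg mulrA mulf_eq0; apply/orP; left.
pose f (j : nat) := sin (a * (2 * (j%:R - n%:R) - 1) + y).
have -> : sin a * \sum_(k < n.*2.+1) cos (angle R n k * (2 * z%:~R) + y)
   = 2^-1 * \sum_(0 <= k < n.*2.+1) (f k.+1 - f k).
  rewrite !mulr_sumr big_mkord; apply: eq_bigr => k _.
  have -> : angle R n k * (2 * z%:~R) = a * (2 * (k%:R - n%:R)).
    by rewrite /angle /a; field.
  set A := a * (2 * _).
  have -> : f k.+1 = sin ((A + y) + a) by rewrite /f /A -natr1; congr sin; ring.
  have -> : f k = sin ((A + y) - a) by rewrite /f /A; congr sin; ring.
  by rewrite sinD sinB; field.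
rewrite telescope_sumr// mulf_eq0; apply/orP; right.
have aM : a * M = pi * z%:~R by rewrite /a divfK.
have ME : M = n%:R + n%:R + 1 by rewrite /M -natrD addnn natr1.
have -> : f n.*2.+1 = sin (y + pi * z%:~R).
  by rewrite /f -/M -aM ME; congr sin; ring.
have -> : f 0%N = sin (y - pi * z%:~R).
  by rewrite /f -aM ME; congr sin; ring.
by rewrite sinD sinB sin_piz !mulr0 addr0 subr0 subrr.
Qed.

Section Averages.
Context (R : realType) (X : finType) (I : eqType) (form : I -> X -> R).
Implicit Types (cs : seq I) (b : X -> R) (u : {ffun X -> bool}).

Definition lin (c : X -> R) (u : {ffun X -> bool}) : R :=
  \sum_x c x * (-1) ^+ u x.

Lemma linDZ b (c : X -> R) t u :
  lin (fun x => b x + t * c x) u = t * lin c u + lin b u.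
Proof.
rewrite /lin mulr_sumr -big_split /=; apply: eq_bigr => x _.
by rewrite mulrDl addrC mulrA.
Qed.

(** One average for each constraint; [b] accumulates the phases of the constraints
    already met. *)
Fixpoint avgs n (F : (X -> R) -> R) cs b : R :=
  if cs is c :: cs' then
    avg n (fun t => avgs n F cs' (fun x => b x + t * form c x))
  else F b.

Lemma avgs_cat n F s1 s2 b : avgs n F (s1 ++ s2) b = avgs n (avgs n F s2) s1 b.
Proof. by elim: s1 b => //= c s1 IH b; apply: eq_avg => t; rewrite IH. Qed.

Lemma avgs_swap n F c s b : avgs n F (c :: s) b
  = avgs n (fun b => avg n (fun t => F (fun x => b x + t * form c x))) s b.
Proof.
elim: s b => [//|d s IH] b /=.
rewrite avg_exchange; apply: eq_avg => t; rewrite -IH /=.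
apply: eq_avg => r; congr avgs; apply/funext => x; ring.
Qed.

(** Lets the two links of a cherry be brought to the front. *)
Lemma avgs_perm n F s1 s2 : perm_eq s1 s2 -> avgs n F s1 =1 avgs n F s2.
Proof.
have catC s t G : avgs n G (s ++ t) =1 avgs n G (t ++ s).
  move=> b; elim: s G b => [|c s IH] G b; first by rewrite cats0.
  rewrite /= (eq_avg _ (fun t => IH _ _)) -[LHS]/(avgs n G (c :: t ++ s) b).
  by rewrite -cat_cons !avgs_cat avgs_swap.
move=> s12; move: (perm_sym s1 s2); rewrite s12 => /esym s21.
apply: (catCA_perm_ind _ s21 (P := fun s => avgs n F s =1 avgs n F s2)) => //.
move=> t1 t2 t3 H b; rewrite -H !catA !(avgs_cat _ _ _ t3); exact: catC.
Qed.

(** Each average detects, by [avg_cos], the vanishing of the form of one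
    constraint; the remaining sum over signs is [sum_cos_signs]. *)
Lemma fourier_inversion n cs b :
    {in cs, forall c u,
      exists2 z : int, (`|z| < n.*2.+1)%N & lin (form c) u = 2 * z%:~R} ->
  \sum_u (\prod_(c <- cs) (lin (form c) u == 0)%:R) * cos (lin b u)
  = 2 ^+ #|X| * avgs n (fun b => \prod_x cos (b x)) cs b.
Proof.
elim: cs b => [|c cs IH] b evencs.
  by rewrite /= -sum_cos_signs; apply: eq_bigr => u _; rewrite big_nil mul1r.
have evencs' : {in cs, forall c u,
      exists2 z : int, (`|z| < n.*2.+1)%N & lin (form c) u = 2 * z%:~R}.
  by move=> d dcs; apply: evencs; rewrite inE dcs orbT.
rewrite /= -avgZ -(eq_avg _ (fun t => IH _ evencs')) avg_sum.
apply: eq_bigr => u _; rewrite big_cons.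
have [z zn cz] := evencs c (mem_head _ _) u.
under eq_avg do rewrite linDZ cz.
rewrite avgZ avg_cos// cz mulf_eq0 pnatr_eq0 /= intr_eq0.
by ring.
Qed.

End Averages.

(** * Damping factors and positive correlation *)

Section Damping.
Context (R : realType) (X : finType) (I : eqType) (form : I -> X -> R).
Implicit Types (cs : seq I) (a b : X -> R) (g : R).

(** Stands in for the product of cosines.  Unlike that product it is positive
    everywhere and satisfies a parallelogram inequality. *)
Definition damp g b : R := expR (- (g * \sum_x sin (b x) ^+ 2)).

Lemma damp_prod g b : damp g b = \prod_x expR (- (g * sin (b x) ^+ 2)).
Proof. by rewrite /damp -expR_sum sumrN mulr_sumr. Qed.

Lemma sin_sum_diff_sqr (s t : R) :
  sin (s + t) ^+ 2 + sin (s - t) ^+ 2 <= 2 * (sin s ^+ 2 + sin t ^+ 2).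
Proof.
have -> : sin (s + t) ^+ 2 + sin (s - t) ^+ 2
  = 2 * (sin s ^+ 2 + sin t ^+ 2) - 4 * (sin s ^+ 2 * sin t ^+ 2).
  rewrite sinD sinB.
  transitivity (2 * (sin s ^+ 2 * cos t ^+ 2 + cos s ^+ 2 * sin t ^+ 2)).
    by ring.
  by rewrite !cos2sin2; ring.
by rewrite lerBlDr lerDl mulr_ge0// mulr_ge0// sqr_ge0.
Qed.

Lemma expR_mean (s t : R) : expR ((s + t) / 2) <= (expR s + expR t) / 2.
Proof.
have -> : s = s / 2 + s / 2 by field.
have -> : t = t / 2 + t / 2 by field.
set x := s / 2; set y := t / 2.
have -> : (x + x + (y + y)) / 2 = x + y by field.
rewrite !expRD ler_pdivlMr// -subr_ge0.
have -> : expR x * expR x + expR y * expR y - expR x * expR y * 2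
  = (expR x - expR y) ^+ 2 by ring.
exact: sqr_ge0.
Qed.

(** Inequality of the arithmetic and geometric means, applied to the exponents
    that [sin_sum_diff_sqr] compares. *)
Lemma damp_parallelogram g a b : 0 <= g ->
  damp g a * damp g b
  <= (damp g (fun x => a x + b x) + damp g (fun x => a x - b x)) / 2.
Proof.
move=> g0; apply: le_trans (expR_mean _ _).
rewrite /damp -expRD ler_expR -!opprD -!mulrDr mulNr lerN2 -mulrA.
rewrite ler_wpM2l// ler_pdivrMr// -!big_split /= mulr_suml.
apply: ler_sum => x _; rewrite [leRHS]mulrC; exact: sin_sum_diff_sqr.
Qed.

Lemma avgs_damp_parallelogram n g cs a b : 0 <= g ->
  damp g a * avgs form n (damp g) cs b
  <= (avgs form n (damp g) cs (fun x => a x + b x)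
      + avgs form n (damp g) cs (fun x => a x - b x)) / 2.
Proof.
move=> g0; elim: cs b => [|c cs IH] b /=; first exact: damp_parallelogram.
rewrite -[X in _ <= (_ + X) / 2]avgN -avgD -avgZr -avgZ.
apply: le_avg => t; apply: le_trans (IH _) _; rewrite le_eqVlt; apply/orP; left.
apply/eqP; cbv beta; congr (_ / _); congr (_ + _); congr avgs.
  by apply/funext => x; rewrite addrA.
by apply/funext => x; rewrite opprD addrA mulNr.
Qed.

(** The parallelogram inequality at [b = 0], where both terms on its right agree
    by symmetry of the averages. *)
Lemma avgs_damp_shift n g cs a : 0 <= g ->
  damp g a * avgs form n (damp g) cs (fun=> 0) <= avgs form n (damp g) cs a.
Proof.
move=> g0; apply: le_trans (avgs_damp_parallelogram _ _ _ _ g0) _.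
have -> : (fun x => a x + 0) = a by apply/funext => x; rewrite addr0.
have -> : (fun x => a x - 0) = a by apply/funext => x; rewrite subr0.
by rewrite ler_pdivrMr// mulr_natr mulr2n.
Qed.

(** Positive correlation: one constraint and the others together are at least as
    likely as if they were independent. *)
Lemma avgs_damp_cons n g c cs : 0 <= g ->
  avg n (fun t => damp g (fun x => t * form c x))
    * avgs form n (damp g) cs (fun=> 0)
  <= avgs form n (damp g) (c :: cs) (fun=> 0).
Proof.
move=> g0; rewrite /= -avgZr; apply: le_avg => t.
apply: le_trans (avgs_damp_shift _ _ _ g0) _.
rewrite le_eqVlt; apply/orP; left; apply/eqP; congr avgs.
by apply/funext => x; rewrite add0r.
Qed.

(** The same decoupling for a pair of constraints kept together, so that the gain
    of a cherry survives. *)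
Lemma avgs_damp_cons2 n g c d cs : 0 <= g ->
  avg n (fun s => avg n (fun t => damp g (fun x => s * form c x + t * form d x)))
    * avgs form n (damp g) cs (fun=> 0)
  <= avgs form n (damp g) (c :: d :: cs) (fun=> 0).
Proof.
move=> g0; rewrite /= -avgZr; apply: le_avg => s.
rewrite -avgZr; apply: le_avg => t.
apply: le_trans (avgs_damp_shift _ _ _ g0) _.
rewrite le_eqVlt; apply/orP; left; apply/eqP; congr avgs.
by apply/funext => x; rewrite add0r.
Qed.

End Damping.

Lemma cos_sum_prod (R : realType) (s : seq R) :
  `|cos (\sum_(a <- s) a) - \prod_(a <- s) cos a| <= \sum_(a <- s) `|sin a|.
Proof.
elim: s => [|a s IH]; first by rewrite !big_nil cos0 subrr normr0.
rewrite !big_cons cosD; set S := \sum_(j <- s) j; set P := \prod_(j <- s) _.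
have -> : cos a * cos S - sin a * sin S - cos a * P
  = cos a * (cos S - P) - sin a * sin S by ring.
apply: le_trans (ler_normB _ _) _; rewrite addrC !normrM.
by apply: lerD; [rewrite ler_piMr// sin_max
                |rewrite (le_trans _ IH)// ler_piMl// cos_max].
Qed.

(** The cosine of the sum is 1, and the product of the cosines is within the sum of
    the absolute sines of it. *)
Lemma prod_cos_gt0 (R : realType) (T : finType) (a : T -> R) :
  \sum_i a i = 0 -> \sum_i `|sin (a i)| < 1 -> 0 < \prod_i cos (a i).
Proof.
move=> a0 sa; have := cos_sum_prod [seq a i | i <- index_enum T].
rewrite !big_map a0 cos0 => h; have := le_lt_trans h sa.
by rewrite ltr_norml => /andP[_]; rewrite ltrBlDr ltrDl.
Qed.

Lemma cos_sqr_damp_le (R : realType) (T : finType) (b : T -> R) (d : R) :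
  d <= \sum_x sin (b x) ^+ 2 -> `|\prod_x cos (b x)| <= expR (- (d / 2)).
Proof.
move=> db; rewrite -(@ler_pXn2r _ 2) ?nnegrE ?expR_ge0//.
rewrite -expRM_natl -normrX ger0_norm ?sqr_ge0// -prodrXl.
have -> : 2 * - (d / 2) = - d by field.
apply: (@le_trans _ _ (\prod_x expR (- sin (b x) ^+ 2))).
  apply: ler_prod => x _; rewrite sqr_ge0 cos2sin2 /=.
  exact: le_trans (expR_ge1Dx _).
by rewrite -expR_sum ler_expR sumrN lerN2.
Qed.

(** If all the sines are small, the product of cosines is positive, because the
    phases of a column sum to zero, and a comparison of each factor with its
    damping suffices.  If some sine is large, its phase occurs [T] times, so that
    both the product and the damping are bounded by the error term. *)
Lemma prod_cos_ge_damp (R : realType) (h N T : nat) (b : 'I_h * 'I_N -> R) (s0 : R) :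
  0 < s0 -> s0 <= 1 -> h%:R * s0 < 1 ->
  (forall k, \sum_i b (i, k) = 0) ->
  (forall x, b x != 0 -> exists2 S : {set 'I_N}, (T <= #|S|)%N &
     forall k, k \in S -> b (x.1, k) = b x) ->
  damp ((1 + s0 ^+ 2) / 2) b - 2 * expR (- (s0 ^+ 2 * T%:R / 4))
    <= \prod_x cos (b x).
Proof.
move=> s00 s01 hs0 bsum bconst; set e := s0 ^+ 2.
have e0 : 0 < e by rewrite exprn_gt0.
have e1 : e <= 1 by rewrite exprn_ile1// ltW.
have [/forallP small|] := boolP [forall x, sin (b x) ^+ 2 <= e / 2].
  rewrite lerBlDr ler_wpDr ?mulr_ge0 ?expR_ge0//.
  have P0 : 0 <= \prod_x cos (b x).
    have -> : \prod_x cos (b x) = \prod_k \prod_i cos (b (i, k)).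
      by rewrite exchange_big pair_bigA /=; apply: eq_bigr => -[].
    apply: prodr_ge0 => k _; apply/ltW/prod_cos_gt0; first exact: bsum.
    apply: le_lt_trans hs0; rewrite mulr_natl -[X in _ *+ X]card_ord -sumr_const.
    apply: ler_sum => i _; rewrite -(@ler_pXn2r _ 2) ?nnegrE ?(ltW s00)//.
    rewrite -normrX ger0_norm ?sqr_ge0//; apply: le_trans (small _) _.
    by rewrite -/e; lra.
  rewrite -(@ler_pXn2r _ 2) ?nnegrE ?expR_ge0//.
  rewrite damp_prod -!prodrXl; apply: ler_prod => x _.
  rewrite sqr_ge0 /= -expRM_natl cos2sin2.
  set s := sin (b x) ^+ 2.
  have s_ge0 : 0 <= s by exact: sqr_ge0.
  have sle : s <= e / 2 by exact: small.
  have -> : 2 * - ((1 + e) / 2 * s) = - ((1 + e) * s) by field.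
  rewrite expRN invf_ple ?posrE ?expR_gt0//; last by nra.
  apply: le_trans (expR_ge1Dx _); rewrite -[_^-1]mul1r ler_pdivrMr; nra.
rewrite negb_forall => /existsP[x]; rewrite -ltNge => big.
have bx0 : b x != 0.
  by apply: contraTneq big => ->; rewrite sin0 expr0n /= -leNgt divr_ge0 ?ltW.
have [S ST bS] := bconst x bx0.
have Tsum : T%:R * (e / 2) <= \sum_y sin (b y) ^+ 2.
  have -> : \sum_y sin (b y) ^+ 2 = \sum_i \sum_k sin (b (i, k)) ^+ 2.
    by rewrite pair_bigA /=; apply: eq_bigr => -[].
  rewrite (bigD1 x.1)//= ler_wpDr ?sumr_ge0// => [i _|].
    by apply: sumr_ge0 => k _; exact: sqr_ge0.
  rewrite (bigID (mem S))//= ler_wpDr ?sumr_ge0// => [k _|].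
    exact: sqr_ge0.
  apply: (@le_trans _ _ (#|S|%:R * (e / 2))).
    by rewrite ler_wpM2r ?divr_ge0 ?(ltW e0)// ler_nat.
  rewrite mulr_natl -sumr_const; apply: ler_sum => k kS.
  by rewrite bS// ltW.
have := cos_sqr_damp_le Tsum.
have -> : T%:R * (e / 2) / 2 = e * T%:R / 4 by field.
rewrite ler_norml => /andP[+ _]; apply: le_trans.
rewrite lerBlDr mulr_natl mulr2n addrA addNr add0r ler_expR lerN2.
apply: (@le_trans _ _ ((1 + e) / 2 * (T%:R * (e / 2)))).
  rewrite -subr_ge0.
  have -> : (1 + e) / 2 * (T%:R * (e / 2)) - e * T%:R / 4 = e ^+ 2 * T%:R / 4.
    by field.
  by rewrite divr_ge0// mulr_ge0// sqr_ge0.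
by rewrite ler_wpM2l// divr_ge0// addr_ge0 ?ltW.
Qed.

(** * Return probabilities and Wallis' inequality *)

Definition return_prob (R : realType) (m : nat) : R := 'C(m.*2, m)%:R / 4 ^+ m.

Lemma return_prob_gt0 (R : realType) m : 0 < return_prob R m.
Proof. by rewrite divr_gt0 ?exprn_gt0// ltr0n bin_gt0 -addnn leq_addr. Qed.

Lemma return_probS (R : realType) m :
  return_prob R m.+1 = return_prob R m * ((2 * m%:R + 1) / (2 * m%:R + 2)).
Proof.
have e : ((m.+1 * 'C(m.+1.*2, m.+1)) = 2 * (m.*2.+1 * 'C(m.*2, m)))%N.
  rewrite -mul_bin_diag doubleS.
  have := mul_bin_down m.*2.+1 m.
  have -> : (m.*2.+1 - m = m.+1)%N by rewrite -addnn -addnS addKn.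
  by move=> /= ->; rewrite mulnA mul2n doubleS.
have := congr1 (fun k : nat => k%:R : R) e; rewrite !natrM -!natr1.
have -> : m.*2%:R = 2 * m%:R :> R by rewrite -mul2n natrM.
rewrite /return_prob exprS => eR.
have m0 : (m%:R + 1 : R) != 0 by rewrite natr1.
have m1 : (2 * m%:R + 2 : R) != 0.
  by rewrite -[X in _ + X]mulr1 -mulrDr mulf_neq0// natr1.
have -> : 'C(m.+1.*2, m.+1)%:R = 2 * ((2 * m%:R + 1) * 'C(m.*2, m)%:R) / (m%:R + 1) :> R.
  by apply: (mulfI m0); rewrite eR; field.
by field; rewrite expf_neq0 ?m0 ?m1.
Qed.

(** The number of paths returning to the origin, read off the inversion
    formula for one constraint. *)
Lemma avg_cos_even (R : realType) n m : (m < n.*2.+1)%N ->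
  avg n (fun t : R => cos t ^+ m.*2) = return_prob R m.
Proof.
move=> mn; pose X := 'I_(m.*2).
pose form (_ : unit) (_ : X) : R := 1.
have linE (u : {ffun X -> bool}) :
    lin (form tt) u = 2 * ((m%:Z - #|[set x | u x]|%:Z)%:~R).
  rewrite /lin rmorphB /= !pmulrn.
  transitivity (\sum_(x : X) (1 - 2 * (u x)%:R : R)).
    apply: eq_bigr => x _; rewrite mul1r; case: (u x) => /=; rewrite ?expr1 ?expr0; ring.
  rewrite sumrB sumr_const card_ord -mulr_sumr mulrBr -!pmulrn.
  congr (_ - _); first by rewrite -mul2n natrM.
  congr (_ * _). rewrite -sum1dep_card natr_sum [RHS]big_mkcond /=.
  by apply: eq_bigr => x _; case: (u x).
have even1 : {in [:: tt], forall c u,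
    exists2 z : int, (`|z| < n.*2.+1)%N & lin (form c) u = 2 * z%:~R}.
  move=> [] _ u; exists (m%:Z - #|[set x | u x]|%:Z) => //.
  have := max_card [set x | u x]; rewrite card_ord => h.
  by apply: leq_ltn_trans mn; lia.
have := fourier_inversion (fun=> 0) even1; rewrite /= => fi.
have {fi}: 2 ^+ m.*2 * avg n (fun t : R => cos t ^+ m.*2) = 'C(m.*2, m)%:R.
  transitivity (2 ^+ #|X| * avg n (fun t : R => \prod_(x : X) cos (0 + t * form tt x))).
    rewrite card_ord; congr (_ * _); apply: eq_avg => t.
    rewrite (eq_bigr (fun=> cos t)) => [|x _]; last by rewrite /form mulr1 add0r.
    by rewrite prodr_const card_ord.
  rewrite -fi.
  have <- : #|[set A : {set X} | #|A| == m]| = 'C(m.*2, m).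
    by rewrite card_draws card_ord.
  rewrite -sum1dep_card natr_sum [RHS]big_mkcond /=.
  rewrite (reindex (fun A : {set X} => [ffun x => x \in A])) /=; last first.
    exists (fun u : {ffun X -> bool} => [set x | u x]) => [A _|u _].
      by apply/setP => x; rewrite inE ffunE.
    by apply/ffunP => x; rewrite ffunE inE.
  apply: eq_bigr => A _; rewrite big_seq1 linE.
  have -> : [set x | [ffun x => x \in A] x] = A.
    by apply/setP => x; rewrite inE ffunE.
  have -> : lin (fun=> 0) [ffun x => x \in A] = 0 :> R.
    by rewrite /lin big1// => x _; rewrite mul0r.
  rewrite cos0 mulr1 mulf_eq0 pnatr_eq0 /= intr_eq0 subr_eq0 eqz_nat eq_sym.
  by case: (_ == _).
move=> h; rewrite /return_prob -h -mul2n exprM mulrAC -exprVn -exprMn.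
by rewrite (_ : 2 ^+ 2 / 4 = 1 :> R) ?expr1n ?mul1r//; field.
Qed.

(** Primitives of the powers of cosine: Wallis' inequality follows from
    monotonicity in the exponent. *)
Fixpoint cos_primitive (R : realType) (n : nat) (x : R) : R :=
  match n with
  | 0 => x
  | 1 => sin x
  | (m.+1 as k).+1 => (cos x ^+ k * sin x + k%:R * cos_primitive m x) / k.+1%:R
  end.

Lemma is_derive_cos_primitive (R : realType) n (x : R) :
  is_derive x 1 (cos_primitive n : R -> R) (cos x ^+ n).
Proof.
suff : is_derive x 1 (cos_primitive n : R -> R) (cos x ^+ n) /\
       is_derive x 1 (cos_primitive n.+1 : R -> R) (cos x ^+ n.+1) by case.
elim: n => [|n [IH0 IH1]].
  split; first by rewrite expr0; exact: is_derive_id.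
  by rewrite expr1; exact: is_derive_sin.
split => //.
have -> : (cos_primitive n.+2 : R -> R) =
   (fun y => n.+2%:R^-1 * (((@cos R) ^+ n.+1) y * sin y + n.+1%:R * cos_primitive n y)).
  by apply/funext => y; rewrite /= mulrC; congr (_ * (_ * _ + _)); rewrite fctE.
apply: is_derive_eq.
rewrite /GRing.scale /= exprfctE -[n.+2%:R]natr1 -[n.+1%:R]natr1 /=.
have n1 : n%:R + 1 + 1 != 0 :> R by rewrite !natr1.
apply: (mulfI n1); rewrite mulVKf// !exprS.
transitivity (cos x ^+ 2 * cos x ^+ n + (n%:R + 1) * cos x ^+ n * (1 - sin x ^+ 2)).
  by ring.
by rewrite -cos2sin2; ring.
Qed.

Lemma cos_primitive0 (R : realType) n : cos_primitive n (0 : R) = 0.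
Proof.
suff : cos_primitive n (0 : R) = 0 /\ cos_primitive n.+1 (0 : R) = 0 by case.
elim: n => [|n [IH0 IH1]]; first by rewrite /= sin0.
by split=> //; rewrite /= sin0 IH0 !mulr0 addr0 mul0r.
Qed.

Lemma le_cos_primitive (R : realType) n :
  cos_primitive n.+1 (pi / 2 : R) <= cos_primitive n (pi / 2).
Proof.
pose f : R -> R := fun x => cos_primitive n x - cos_primitive n.+1 x.
have df (x : R) : is_derive x 1 f (cos x ^+ n - cos x ^+ n.+1).
  by apply: is_deriveB; exact: is_derive_cos_primitive.
have pi20 : (0 : R) <= pi / 2 by rewrite divr_ge0// pi_ge0.
have [|c] := MVT_segment pi20 (fun x _ => df x).
  apply: continuous_subspaceT => x; apply: differentiable_continuous.
  exact/derivable1_diffP/(@ex_derive _ _ _ _ _ _ _ (df x)).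
rewrite in_itv /= => /andP[c0 c1].
rewrite /f !cos_primitive0 subrr !subr0 => e.
rewrite -subr_ge0 e mulr_ge0// subr_ge0 exprSr ler_piMr ?cos_le1// exprn_ge0//.
by apply: cos_ge0_pihalf; rewrite c1 andbT (le_trans _ c0)// oppr_le0.
Qed.

Lemma cos_primitive_pihalfSS (R : realType) n :
  cos_primitive n.+2 (pi / 2 : R)
  = n.+1%:R / n.+2%:R * cos_primitive n (pi / 2).
Proof. by rewrite /= cos_pihalf expr0n /= mul0r add0r mulrAC. Qed.

Lemma cos_primitive_even (R : realType) m :
  cos_primitive m.*2 (pi / 2 : R) = return_prob R m * (pi / 2).
Proof.
elim: m => [|m IH]; first by rewrite /return_prob bin0 divr1 mul1r.
rewrite doubleS cos_primitive_pihalfSS IH return_probS -[m.*2.+2%:R]natr1 -[m.*2.+1%:R]natr1.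
rewrite -mul2n natrM; have m0 : (0 : R) <= m%:R by [].
by field; rewrite !lt0r_neq0; lra.
Qed.

Lemma cos_primitive_odd (R : realType) m :
  cos_primitive m.*2.+1 (pi / 2 : R) = ((2 * m%:R + 1) * return_prob R m)^-1.
Proof.
elim: m => [|m IH].
  by rewrite /= sin_pihalf /return_prob bin0 divr1 mulr0 add0r mul1r invr1.
rewrite doubleS cos_primitive_pihalfSS IH return_probS -[m.*2.+3%:R]natr1.
rewrite -[m.*2.+2%:R]natr1 -[m.*2.+1%:R]natr1 -[m.+1%:R]natr1 -mul2n natrM.
have m0 : (0 : R) <= m%:R by [].
field.
by rewrite !lt0r_neq0 ?return_prob_gt0; lra.
Qed.

(** The integrals of consecutive powers of cosine decrease; the even ones are
    multiples of return probabilities, the odd ones of their inverses. *)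
Lemma wallis_return_prob (R : realType) m :
  2 / (pi * (2 * m%:R + 1)) <= return_prob R m ^+ 2.
Proof.
have := le_cos_primitive R m.*2.
rewrite cos_primitive_even cos_primitive_odd => h.
have q0 := return_prob_gt0 R m; have p0 := pi_gt0 R.
have m0 : 0 < 2 * m%:R + 1 :> R by rewrite ltr_wpDl// mulr_ge0.
move: h; rewrite -[_^-1]mul1r !ler_pdivrMr ?(mulr_gt0 m0 q0) ?(mulr_gt0 p0 m0)//.
set Z := leRHS => h.
have -> : return_prob R m ^+ 2 * (pi * (2 * m%:R + 1)) = 2 * Z by rewrite /Z; field.
by rewrite ler_peMr.
Qed.

(** * Links between two walks *)

(** A link ((i, j), (p, q)) is the constraint that the walks [i] and [j] have the
    same increment from time [p] to time [q]. *)
Definition link (h : nat) := (('I_h * 'I_h) * (nat * nat))%type.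

Definition link_form (R : realType) (h N : nat) (c : link h) (x : 'I_h * 'I_N) : R :=
  ((x.1 == c.1.1)%:R - (x.1 == c.1.2)%:R) * (c.2.1 <= x.2 < c.2.2)%N%:R.

Lemma card_ord_range (N p q : nat) : (q <= N)%N ->
  #|[pred k : 'I_N | (p <= k < q)%N]| = (q - p)%N.
Proof.
move=> qN; rewrite -sum1_card big_mkcond /=.
rewrite -(big_mkord xpredT (fun k => if (p <= k < q)%N then 1 else 0)%N).
have [qp|pq] := leqP q p.
  rewrite big1 => [|k _]; first by apply/esym/eqP.
  by case: ifP => //; lia.
rewrite (big_cat_nat (n := p)) //=; last by lia.
rewrite (big_cat_nat (n := q) (m := p)) //=; last by lia.
rewrite big1_seq ?add0n => [|k]; last first.
  by rewrite mem_index_iota => /= kp; case: ifP => //; lia.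
rewrite [X in (_ + X)%N]big1_seq ?addn0 => [|k]; last first.
  by rewrite mem_index_iota => /= kp; case: ifP => //; lia.
rewrite (eq_big_nat _ _ (F2 := fun=> 1%N)) => [|k ->//].
by rewrite sum_nat_const_nat muln1.
Qed.

Section Constraints.
Context (R : realType) (h N : nat).
Implicit Types (c d : link h) (cs : seq (link h)) (u : {ffun 'I_h * 'I_N -> bool}).
Local Notation link_form := (@link_form R h N).

Lemma sum_cells (a : 'I_h) (p q : nat) (r : R) : (q <= N)%N ->
  \sum_(x : 'I_h * 'I_N) ((x.1 == a) && (p <= x.2 < q)%N)%:R * r = (q - p)%:R * r.
Proof.
move=> qN; rewrite -mulr_suml; congr (_ * _).
rewrite -(pair_bigA _ (fun i (k : 'I_N) => ((i == a) && (p <= k < q)%N)%:R)) /=.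
rewrite (bigD1 a)//= [X in _ + X]big1 ?addr0 => [|i /negPf ia]; last first.
  by rewrite ia /= big1.
rewrite eqxx /= -natr_sum -(card_ord_range p qN) -sum1_card [in RHS]big_mkcond /=.
by congr (_%:R); apply: eq_bigr => k _; rewrite inE; case: ifP.
Qed.

Lemma link_form_column c (k : 'I_N) : \sum_i link_form c (i, k) = 0.
Proof.
rewrite /link_form /= -mulr_suml sumrB.
have s1 (j : 'I_h) : \sum_i (i == j)%:R = 1 :> R.
  by rewrite (bigD1 j)//= eqxx big1 ?addr0// => i /negPf ->.
by rewrite !s1 subrr mul0r.
Qed.

Lemma lin_link_formE c u : lin (link_form c) u =
  \sum_(k : 'I_N) (c.2.1 <= k < c.2.2)%N%:R
    * ((-1) ^+ u (c.1.1, k) - (-1) ^+ u (c.1.2, k)).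
Proof.
have -> : lin (link_form c) u = \sum_i \sum_k link_form c (i, k) * (-1) ^+ u (i, k).
  by rewrite pair_bigA; apply: eq_bigr => -[].
rewrite exchange_big; apply: eq_bigr => k _.
have s1 (j : 'I_h) : \sum_i (i == j)%:R * (-1) ^+ u (i, k) = (-1) ^+ u (j, k) :> R.
  rewrite (bigD1 j)//= eqxx mul1r big1 ?addr0// => i /negPf ->.
  by rewrite mul0r.
rewrite -!s1 -sumrB mulr_sumr; apply: eq_bigr => i _; rewrite /link_form /=; ring.
Qed.

Lemma lin_link_form_even c u :
  exists2 z : int, (`|z| <= N)%N & lin (link_form c) u = 2 * z%:~R.
Proof.
pose inc (k : 'I_N) : int :=
  ((c.2.1 <= k < c.2.2)%N%:R * ((u (c.1.2, k))%:R - (u (c.1.1, k))%:R)).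
exists (\sum_k inc k).
  rewrite -(ler_nat int) natz abszE; apply: le_trans (ler_norm_sum _ _ _) _.
  apply: (@le_trans _ _ (\sum_(k : 'I_N) 1)).
    apply: ler_sum => k _; rewrite /inc.
    by case: (_ <= _ < _)%N; case: (u _); case: (u _).
  by rewrite sumr_const card_ord.
rewrite lin_link_formE rmorph_sum mulr_sumr; apply: eq_bigr => k _.
rewrite /inc rmorphM rmorphB /= !rmorph_nat.
by case: (u _); case: (u _); rewrite ?expr0 ?expr1 /=; ring.
Qed.

Lemma sum_sin_link_form c (t : R) : c.1.1 != c.1.2 -> (c.2.2 <= N)%N ->
  \sum_x sin (t * link_form c x) ^+ 2 = 2 * (c.2.2 - c.2.1)%:R * sin t ^+ 2.
Proof.
case: c => -[i j] [p q] /= ij qN.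
transitivity (\sum_(x : 'I_h * 'I_N)
   (((x.1 == i) && (p <= x.2 < q)%N)%:R * sin t ^+ 2
    + ((x.1 == j) && (p <= x.2 < q)%N)%:R * sin t ^+ 2)).
  apply: eq_bigr => -[a k] _; rewrite /link_form /=.
  case: (p <= k < q)%N; rewrite ?andbT ?andbF ?mulr1 ?mulr0 ?sin0 ?expr0n/= ?mul0r ?addr0//.
  have [ai|ai] := eqVneq a i; last have [aj|aj] := eqVneq a j.
  - by rewrite ai (negPf ij) subr0 mulr1 mul1r mul0r addr0.
  - by rewrite sub0r mulrN1 sinN sqrrN mul0r add0r mul1r.
  - by rewrite subrr mulr0 sin0 expr0n /= !mul0r addr0.
by rewrite big_split /= !sum_cells//; set r := (_ - _)%:R; ring.
Qed.

Lemma sum_sin_cherry (i j k : 'I_h) (m n : nat) (s t : R) :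
  i != j -> i != k -> j != k -> (m <= n <= N)%N ->
  \sum_x sin (s * link_form ((i, j), (0, m)) x + t * link_form ((i, k), (0, n)) x) ^+ 2
  = m%:R * sin (s + t) ^+ 2 + m%:R * sin s ^+ 2
    + (2 * n%:R - m%:R) * sin t ^+ 2.
Proof.
move=> ij ik jk /andP[mn nN].
transitivity (\sum_(x : 'I_h * 'I_N)
   (((x.1 == i) && (0 <= x.2 < m)%N)%:R * sin (s + t) ^+ 2
    + ((x.1 == i) && (m <= x.2 < n)%N)%:R * sin t ^+ 2
    + ((x.1 == j) && (0 <= x.2 < m)%N)%:R * sin s ^+ 2
    + ((x.1 == k) && (0 <= x.2 < n)%N)%:R * sin t ^+ 2)).
  apply: eq_bigr => -[a l] _; rewrite /link_form /=.
  have [lm|ml] := ltnP l m; first rewrite (leq_trans lm mn) /=.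
    have [ai|ai] := eqVneq a i.
      rewrite ai (negPf ij) (negPf ik) /=.
      by rewrite [X in sin X](_ : _ = s + t); ring.
    have [aj|aj] := eqVneq a j.
      rewrite aj (negPf jk) /= [X in sin X](_ : _ = - s); last by ring.
      by rewrite sinN; ring.
    have [ak|ak] := eqVneq a k.
      rewrite /= [X in sin X](_ : _ = - t); last by ring.
      by rewrite sinN; ring.
    by rewrite [X in sin X](_ : _ = 0) /= ?sin0; ring.
  have [ln|nl] := ltnP l n; last first.
    by rewrite !andbF [X in sin X](_ : _ = 0) /= ?sin0; ring.
  rewrite !andbT !andbF.
  have [ai|ai] := eqVneq a i.
    by rewrite ai (negPf ik) [X in sin X](_ : _ = t) /=; ring.
  have [ak|ak] := eqVneq a k.
    rewrite [X in sin X](_ : _ = - t) /=; last by ring.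
    by rewrite sinN; ring.
  by rewrite [X in sin X](_ : _ = 0) /= ?sin0; ring.
have mN := leq_trans mn nN.
rewrite !big_split; cbv beta; rewrite !sum_cells// !subn0 natrB//.
rewrite /=; ring.
Qed.

(** Since exp (- sin^2 t) >= cos^2 t, the damped average of one link dominates an
    average of a power of cosine, that is, a return probability. *)
Lemma avg_damp_link_form n g c (v : nat) : c.1.1 != c.1.2 -> (c.2.2 <= N)%N ->
  g * (2 * (c.2.2 - c.2.1)%:R) <= v%:R -> (v < n.*2.+1)%N ->
  return_prob R v <= avg n (fun t => damp g (fun x => t * link_form c x)).
Proof.
move=> c12 cN gv vn; rewrite -(avg_cos_even _ vn); apply: le_avg => t.
rewrite /damp sum_sin_link_form// -mul2n exprM.
apply: (@le_trans _ _ (expR (- sin t ^+ 2) ^+ v)).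
  rewrite lerXn2r ?nnegrE ?sqr_ge0 ?expR_ge0// cos2sin2.
  exact: expR_ge1Dx.
rewrite -expRM_natl ler_expR mulrN lerN2 mulrA ler_wpM2r ?sqr_ge0//.
Qed.

(** Writing the left side minus 2 as the square of a difference of exponentials
    avoids any power series. *)
Lemma cosh_ge (y : R) : 2 + y ^+ 2 / 4 <= expR y + expR (- y).
Proof.
wlog y0 : y / 0 <= y.
  move=> H; have [/H//|yn] := leP 0 y.
  have /H : 0 <= - y by lra.
  by rewrite sqrrN opprK [leRHS]addrC.
pose z := y / 2; have z0 : 0 <= z by rewrite divr_ge0.
have -> : y = z + z by rewrite /z; field.
rewrite opprD !expRD.
have -> : expR z * expR z + expR (- z) * expR (- z)
   = (expR z - expR (- z)) ^+ 2 + 2.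
  have := expRxMexpNx_1 z; set a := expR z; set b := expR (- z) => ab.
  by rewrite sqrrB ab; ring.
have -> : 2 + (z + z) ^+ 2 / 4 = z ^+ 2 + 2 by field.
rewrite lerD2r lerXn2r ?nnegrE//.
  by rewrite subr_ge0 ler_expR; lra.
rewrite lerBrDr; apply: le_trans (expR_ge1Dx z).
by rewrite addrC lerD2r expR_le1 oppr_le0.
Qed.

(** A factor sin^2 t is worth about 1 / v against cos^(2v) t: this is the size of
    the angles that matter. *)
Lemma avg_cos_sin_even n (v : nat) : (3 <= v)%N -> (v.+2 < n.*2.+1)%N ->
  return_prob R v / (4 * v%:R) <= avg n (fun t => cos t ^+ v.*2 * (sin t ^+ 2 * cos t ^+ 2)).
Proof.
move=> v3 vn.
have -> : avg n (fun t => cos t ^+ v.*2 * (sin t ^+ 2 * cos t ^+ 2))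
   = avg n (fun t : R => cos t ^+ v.+1.*2 + -1 * cos t ^+ v.+2.*2).
  by apply: eq_avg => t; rewrite sin2cos2 !doubleS !exprS; ring.
rewrite avgD avgZ !avg_cos_even//; last by rewrite ltnW.
rewrite !return_probS -[v.+1%:R]natr1.
have v0 : 3 <= v%:R :> R by rewrite (ler_nat _ 3).
have -> : return_prob R v * ((2 * v%:R + 1) / (2 * v%:R + 2)) +
  -1 * (return_prob R v * ((2 * v%:R + 1) / (2 * v%:R + 2)) *
        ((2 * (v%:R + 1) + 1) / (2 * (v%:R + 1) + 2)))
  = return_prob R v * ((2 * v%:R + 1) / ((2 * v%:R + 2) * (2 * v%:R + 4))).
  by field; rewrite !lt0r_neq0; lra.
rewrite ler_wpM2l ?(ltW (return_prob_gt0 _ _))//.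
rewrite -[_^-1]mul1r ler_pdivrMr; last by lra.
rewrite mulrAC ler_pdivlMr; last by nra.
by nra.
Qed.

(** Two constraints sharing a walk and of comparable lengths: the hyperbolic
    cosine coming from their common cells gives a fixed relative gain. *)
Lemma avg_damp_cherry nn g (i j k : 'I_h) (m n v w : nat) :
  i != j -> i != k -> j != k -> (m <= n <= N)%N -> (n <= m.*2)%N ->
  1 / 2 <= g ->
  g * (2 * m%:R) <= v%:R -> g * (2 * n%:R) <= w%:R ->
  (3 <= v <= m.*2)%N -> (3 <= w <= n.*2)%N -> (v.+2 < nn.*2.+1)%N -> (w.+2 < nn.*2.+1)%N ->
  (1 + 1 / 1024) * (return_prob R v * return_prob R w) <=
  avg nn (fun s => avg nn (fun t =>
    damp g (fun x => s * link_form ((i, j), (0, m)) x + t * link_form ((i, k), (0, n)) x))).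
Proof.
move=> ij ik jk mnN n2m g2 gv gw /andP[v3 vm] /andP[w3 wn] vnn wnn.
have [mn nN] := andP mnN.
have g0 : 0 <= g by lra.
pose sg (t : R) := sin t ^+ 2 * cos t ^+ 2.
(* The terms at t and - t differ by the sign of the cross term y, and add up
   to a hyperbolic cosine. *)
have key (s t : R) :
   2 * (cos s ^+ v.*2 * cos t ^+ w.*2 * (1 + m%:R ^+ 2 / 8 * (sg s * sg t)))
  <= damp g (fun x => s * link_form ((i, j), (0, m)) x + t * link_form ((i, k), (0, n)) x)
   + damp g (fun x => s * link_form ((i, j), (0, m)) x + - t * link_form ((i, k), (0, n)) x).
  rewrite /damp !sum_sin_cherry// sinN sqrrN.
  pose A := sin s ^+ 2 * cos t ^+ 2 + cos s ^+ 2 * sin t ^+ 2.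
  pose B := 2 * (sin s * cos t) * (cos s * sin t).
  have -> : sin (s + t) ^+ 2 = A + B by rewrite sinD /A /B; ring.
  have -> : sin (s - t) ^+ 2 = A - B by rewrite sinB /A /B; ring.
  have As : A <= sin s ^+ 2 + sin t ^+ 2.
    by apply: lerD; [rewrite ler_piMr|rewrite ler_piMl]; rewrite ?sqr_ge0// cos2sin2 gerBl sqr_ge0.
  set y := g * m%:R * B.
  set D := g * (m%:R * A + m%:R * sin s ^+ 2 + (2 * n%:R - m%:R) * sin t ^+ 2).
  have -> : - (g * (m%:R * (A + B) + m%:R * sin s ^+ 2 + (2 * n%:R - m%:R) * sin t ^+ 2))
     = - D + - y by rewrite /D /y; ring.
  have -> : - (g * (m%:R * (A - B) + m%:R * sin s ^+ 2 + (2 * n%:R - m%:R) * sin t ^+ 2))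
     = - D + y by rewrite /D /y; ring.
  rewrite !expRD -mulrDr.
  have cosE : cos s ^+ v.*2 * cos t ^+ w.*2 <= expR (- D).
    have ce (r : R) (l : nat) : cos r ^+ l.*2 <= expR (- (l%:R * sin r ^+ 2)).
      rewrite -mulrN expRM_natl -mul2n exprM lerXn2r ?nnegrE ?sqr_ge0 ?expR_ge0//.
      by rewrite cos2sin2; exact: expR_ge1Dx.
    apply: le_trans (ler_pM _ _ (ce s v) (ce t w)) _;
      rewrite ?exprn_even_ge0 ?odd_double// -expRD ler_expR -opprD lerN2.
    apply: (@le_trans _ _ (g * (2 * m%:R) * sin s ^+ 2 + g * (2 * n%:R) * sin t ^+ 2)).
      rewrite /D -subr_ge0.
      have -> : g * (2 * m%:R) * sin s ^+ 2 + g * (2 * n%:R) * sin t ^+ 2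
         - g * (m%:R * A + m%:R * sin s ^+ 2 + (2 * n%:R - m%:R) * sin t ^+ 2)
         = g * (m%:R * (sin s ^+ 2 + sin t ^+ 2 - A)) by ring.
      by rewrite !mulr_ge0// subr_ge0.
    by apply: lerD; rewrite ler_wpM2r ?sqr_ge0.
  have c0 : 0 <= cos s ^+ v.*2 * cos t ^+ w.*2.
    by rewrite mulr_ge0// exprn_even_ge0 ?odd_double.
  have sg0 : 0 <= sg s * sg t by apply: mulr_ge0; apply: mulr_ge0; exact: sqr_ge0.
  have mm : 0 <= m%:R ^+ 2 :> R by exact: sqr_ge0.
  rewrite mulrCA; apply: ler_pM => //.
    by rewrite mulr_ge0// addr_ge0// mulr_ge0// divr_ge0.
  apply: (@le_trans _ _ (2 + y ^+ 2 / 4)); last by rewrite [leRHS]addrC; exact: cosh_ge.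
  rewrite mulrDr mulr1 lerD2l.
  have -> : y ^+ 2 / 4 = g ^+ 2 * m%:R ^+ 2 * (sg s * sg t) by rewrite /y /B /sg; field.
  have -> : 2 * (m%:R ^+ 2 / 8 * (sg s * sg t)) = (1 / 2) ^+ 2 * m%:R ^+ 2 * (sg s * sg t) by field.
  rewrite !ler_wpM2r// lerXn2r ?nnegrE//.
set LHS := leLHS.
pose E (s t : R) := damp g (fun x : 'I_h * 'I_N =>
  s * link_form ((i, j), (0, m)) x + t * link_form ((i, k), (0, n)) x).
rewrite -[leRHS]/(avg nn (fun s => avg nn (E s))).
have -> : avg nn (fun s => avg nn (E s))
   = avg nn (fun s => avg nn (fun t => 2^-1 * (E s t + E s (- t)))).
  by apply: eq_avg => s; rewrite avgZ avgD avgN; field.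
apply: (@le_trans _ _ (avg nn (fun s => avg nn (fun t =>
   cos s ^+ v.*2 * cos t ^+ w.*2
   + m%:R ^+ 2 / 8 * ((cos s ^+ v.*2 * sg s) * (cos t ^+ w.*2 * sg t)))))); last first.
  apply: le_avg => s; apply: le_avg => t.
  rewrite [leRHS]mulrC ler_pdivlMr//; apply: le_trans (key s t); rewrite le_eqVlt; apply/orP; left.
  by apply/eqP; ring.
rewrite (eq_avg _ (fun s => avgD _ _ _)) avgD.
rewrite (eq_avg _ (fun s => avgZ _ _ _)) avgZr !avg_cos_even//; try by do 2 apply: ltnW.
rewrite (eq_avg _ (fun s => avgZ _ _ _)) avgZ (eq_avg _ (fun s => avgZ _ _ _)) avgZr.
rewrite /LHS mulrDl mul1r lerD2l.
have a1 := avg_cos_sin_even v3 vnn; have a2 := avg_cos_sin_even w3 wnn.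
have v0 : 0 < v%:R :> R by rewrite ltr0n; apply: leq_trans v3.
have w0 : 0 < w%:R :> R by rewrite ltr0n; apply: leq_trans w3.
have m0 : 0 < m%:R :> R.
  by rewrite ltr0n -double_gt0 (leq_trans _ (leq_trans v3 vm)).
apply: (@le_trans _ _ (m%:R ^+ 2 / 8 * (return_prob R v / (4 * v%:R) * (return_prob R w / (4 * w%:R))))); last first.
  rewrite ler_wpM2l ?divr_ge0 ?sqr_ge0//; apply: ler_pM => //;
    by rewrite divr_ge0 ?mulr_ge0// ltW// return_prob_gt0.
have -> : m%:R ^+ 2 / 8 * (return_prob R v / (4 * v%:R) * (return_prob R w / (4 * w%:R)))
   = (m%:R ^+ 2 / (128 * (v%:R * w%:R))) * (return_prob R v * return_prob R w).
  by field; rewrite !lt0r_neq0.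
rewrite ler_wpM2r ?mulr_ge0 ?(ltW (return_prob_gt0 _ _))//.
rewrite ler_pdivlMr; last by rewrite !mulr_gt0.
have vm' : v%:R <= 2 * m%:R :> R by rewrite -natrM mul2n ler_nat.
have wm' : w%:R <= 4 * m%:R :> R by rewrite -natrM ler_nat; move: wn n2m; clear; lia.
by nra.
Qed.

End Constraints.

(** * From the walk to the damped integrand *)

Lemma le_avgs_on (R : realType) (X : finType) (I : eqType) (form : I -> X -> R)
    (P : (X -> R) -> Prop) (F G : (X -> R) -> R) n (cs : seq I) b :
  {in cs, forall c b t, P b -> P (fun x => b x + t * form c x)} ->
  (forall b, P b -> F b <= G b) -> P b ->
  avgs form n F cs b <= avgs form n G cs b.
Proof.
move=> + FG; elim: cs b => [|c cs IH] b Pc Pb /=; first exact: FG.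
apply: le_avg => t; apply: IH => [d dcs|]; first by apply: Pc; rewrite inE dcs orbT.
by apply: Pc => //; rewrite mem_head.
Qed.

Lemma avgsB_const (R : realType) (X : finType) (I : eqType) (form : I -> X -> R)
    (F : (X -> R) -> R) n (cs : seq I) (r : R) b :
  avgs form n (fun b => F b - r) cs b = avgs form n F cs b - r.
Proof.
elim: cs b => [//|c cs IH] b /=.
by rewrite (eq_avg _ (fun t => IH _)) avgD avg_const.
Qed.

(** Ensures that the cells of one walk between two consecutive ends of links are
    covered by the same links, and that there are at least [T] of them. *)
Definition spaced (h N T : nat) (cs : seq (link h)) : Prop :=
  {in cs, forall c, [/\ c.1.1 != c.1.2, (c.2.1 < c.2.2 <= N)%N, (T <= c.2.2)%N &
     c.2.1 = 0%N \/ exists2 d, d \in cs & c.2.1 = d.2.2]} /\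
  {in cs &, forall c d : link h,
     [\/ c.2.2 = d.2.2, (c.2.2 + T <= d.2.2)%N | (d.2.2 + T <= c.2.2)%N]}.

Section SpacedConstraints.
Context (R : realType) (h N T : nat) (cs : seq (link h)).
Hypothesis spaced_cs : spaced N T cs.
Implicit Types (b : 'I_h * 'I_N -> R) (k : 'I_N).

Let in_gap (c : link h) (k : nat) := (c.2.1 <= k < c.2.2)%N.

(** What all the phases of the Fourier formula have in common, in a form that is
    stable under adding a multiple of the form of a link: the induction over the
    averages only needs this stability. *)
Let phase b :=
  [/\ forall k, \sum_i b (i, k) = 0,
      forall i k k', {in cs, forall c, in_gap c k = in_gap c k'} -> b (i, k) = b (i, k')
    & forall i k, {in cs, forall c, ~~ in_gap c k} -> b (i, k) = 0].

Let phase0 : phase (fun=> 0).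
Proof. by split=> // k; rewrite big1. Qed.

Let phaseD : {in cs, forall c b (t : R), phase b ->
  phase (fun x => b x + t * link_form R c x)}.
Proof.
move=> c ccs b t [bsum bgap b0]; split=> [k|i k k' kk'|i k kcs].
- by rewrite big_split /= bsum add0r -mulr_sumr link_form_column mulr0.
- rewrite (bgap i k k' kk'); congr (_ + _ * (_ * _%:R)).
  by have := kk' c ccs; rewrite /in_gap /= => ->.
- rewrite b0// add0r /link_form /=; have := kcs c ccs; rewrite /in_gap /= => /negPf ->.
  by rewrite !mulr0.
Qed.

(** Let [t] be the first end of a link after the cell.  Any other end is either
    beyond [t] or, being at most [t - T], not after the cell; hence the steps from
    [t - T] to [t] are covered by the same links as the cell. *)
Let phase_repeats b : phase b -> forall x, b x != 0 ->
  exists2 S : {set 'I_N}, (T <= #|S|)%N & forall k, k \in S -> b (x.1, k) = b x.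
Proof.
case=> _ bgap b0 [i k] bx0; have [incs spac] := spaced_cs.
have [c ccs kc] : exists2 c, c \in cs & in_gap c k.
  apply/hasP; apply: contraNT bx0 => /hasPn kcs; apply/eqP/b0 => c ccs; exact: kcs.
pose later (t : nat) := (k < t)%N && has (fun d : link h => d.2.2 == t) cs.
have exl : exists t, later t.
  exists c.2.2; rewrite /later; case/andP: kc => _ ->; apply/hasP.
  by exists c.
case: (ex_minnP exl) => t /andP[kt /hasP[d dcs /eqP dt]] tmin.
have [_ /andP[_ dN] dT _] := incs d dcs.
rewrite dt in dN dT.
exists [set l : 'I_N | (t - T <= l < t)%N]%SET.
  by rewrite cardsE card_ord_range// subKn.
move=> l; rewrite inE => /andP[tl lt].
apply: bgap => e ecs /=; have [_ _ _ e0] := incs e ecs.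
have endsP (s : nat) : has (fun d : link h => d.2.2 == s) cs ->
    (k < s)%N = (t <= s)%N /\ (l < s)%N = (t <= s)%N.
  move=> hs; have ks : (k < s)%N = (t <= s)%N.
    apply/idP/idP => [ks|]; last exact: leq_trans.
    by apply: tmin; rewrite /later ks.
  split=> //; apply/idP/idP => [ls|]; last exact: leq_trans.
  have /hasP[f fcs /eqP fs] := hs.
  by have := spac f d fcs dcs; rewrite fs dt => -[]; lia.
have /endsP[ke le] : has (fun d : link h => d.2.2 == e.2.2) cs by apply/hasP; exists e.
rewrite /in_gap ke le; congr (_ && _).
case: e0 => [->//|[f fcs ->]].
have /endsP[kf lf] : has (fun d : link h => d.2.2 == f.2.2) cs by apply/hasP; exists f.
by rewrite leqNgt [RHS]leqNgt kf lf.
Qed.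

(** Fourier inversion for all the links at once, followed by the comparison of the
    product of cosines with its damping under the averages. *)
Lemma paths_ge_avgs_damp n (s0 : R) : (N < n.*2.+1)%N ->
  0 < s0 -> s0 <= 1 -> h%:R * s0 < 1 ->
  2 ^+ (h * N) *
    (avgs (@link_form R h N) n (damp ((1 + s0 ^+ 2) / 2)) cs (fun=> 0)
     - 2 * expR (- (s0 ^+ 2 * T%:R / 4)))
  <= \sum_(u : {ffun 'I_h * 'I_N -> bool})
       \prod_(c <- cs) (lin (link_form R c) u == 0)%:R.
Proof.
move=> Nn s00 s01 hs0; rewrite -avgsB_const.
have even_cs : {in cs, forall c (u : {ffun 'I_h * 'I_N -> bool}),
    exists2 z : int, (`|z| < n.*2.+1)%N & lin (link_form R c) u = 2 * z%:~R}.
  move=> c _ u; have [z zN ->] := lin_link_form_even R c u.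
  by exists z => //; exact: leq_ltn_trans Nn.
have -> : \sum_(u : {ffun 'I_h * 'I_N -> bool})
       \prod_(c <- cs) (lin (link_form R c) u == 0)%:R
   = 2 ^+ (h * N) * avgs (@link_form R h N) n (fun b => \prod_x cos (b x)) cs (fun=> 0).
  have := fourier_inversion (fun=> 0) even_cs.
  rewrite card_prod !card_ord => <-; apply: eq_bigr => u _.
  by rewrite [lin (fun=> 0) u]big1 ?cos0 ?mulr1// => x _; rewrite mul0r.
rewrite ler_wpM2l ?exprn_ge0//.
apply: (@le_avgs_on _ _ _ (@link_form R h N) phase) phaseD _ phase0 => b phb.
by apply: prod_cos_ge_damp => //; [case: phb|exact: phase_repeats].
Qed.

End SpacedConstraints.

Definition gap_len (h : nat) (c : link h) : nat := (c.2.2 - c.2.1)%N.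

Lemma avgs_damp_ge_prod (R : realType) (h N n : nat) (g : R) (v : nat -> nat)
    (cs : seq (link h)) : 0 <= g ->
  {in cs, forall c : link h, [/\ c.1.1 != c.1.2, (c.2.2 <= N)%N,
     g * (2 * (gap_len c)%:R) <= (v (gap_len c))%:R
   & (v (gap_len c) < n.*2.+1)%N]} ->
  \prod_(c <- cs) return_prob R (v (gap_len c))
  <= avgs (@link_form R h N) n (damp g) cs (fun=> 0).
Proof.
move=> g0; elim: cs => [_|c cs IH hcs].
  by rewrite big_nil /= /damp big1 ?mulr0 ?oppr0 ?expR0// => x _; rewrite sin0 expr0n.
have [c12 cN gv vn] := hcs c (mem_head _ _).
apply: le_trans (avgs_damp_cons _ _ _ _ g0); rewrite big_cons; apply: ler_pM.
- exact/ltW/return_prob_gt0.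
- by apply: prodr_ge0 => d _; exact/ltW/return_prob_gt0.
- exact: avg_damp_link_form.
- by apply: IH => d dcs; apply: hcs; rewrite inE dcs orbT.
Qed.

(** * Planar walks and expansion into families of visits *)

Section TwoDimensions.
Context (R : realType) (h N : nat).
Implicit Types (S : walks h N) (u v : {ffun 'I_h * 'I_N -> bool}) (i j : 'I_h).

(** The coordinates of a planar walk along the two diagonals are independent
    walks on the line. *)
Definition diag_signs S : {ffun 'I_h * 'I_N -> bool} :=
  [ffun x => (S x.1 x.2).2].
Definition antidiag_signs S : {ffun 'I_h * 'I_N -> bool} :=
  [ffun x => (S x.1 x.2).1 (+) (S x.1 x.2).2].

Definition sign_walk u i (n : nat) : R :=
  \sum_(k < N | (k < n)%N) (-1) ^+ u (i, k).

Lemma site_diag S i n :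
  ((site (S i) n).1 + (site (S i) n).2)%:~R = sign_walk (diag_signs S) i n.
Proof.
rewrite /site !(big_morph fst (fun x y => erefl) erefl) (big_morph snd (fun x y => erefl) erefl).
rewrite -big_split rmorph_sum; apply: eq_bigr => k _; rewrite ffunE /=.
by case: (S i k) => -[] [] /=; rewrite ?expr0 ?expr1 ?addr0 ?add0r.
Qed.

Lemma site_antidiag S i n :
  ((site (S i) n).1 - (site (S i) n).2)%:~R = sign_walk (antidiag_signs S) i n.
Proof.
rewrite /site !(big_morph fst (fun x y => erefl) erefl) (big_morph snd (fun x y => erefl) erefl).
rewrite -sumrB rmorph_sum; apply: eq_bigr => k _; rewrite ffunE /=.
by case: (S i k) => -[] [] /=; rewrite ?expr0 ?expr1 ?subr0 ?sub0r ?opprK.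
Qed.

Lemma eq_site S i j n :
  sign_walk (diag_signs S) i n = sign_walk (diag_signs S) j n ->
  sign_walk (antidiag_signs S) i n = sign_walk (antidiag_signs S) j n ->
  site (S i) n = site (S j) n.
Proof.
rewrite -!site_diag -!site_antidiag => /intr_inj + /intr_inj.
case: (site (S i) n) => a b; case: (site (S j) n) => c d /= e1 e2.
by congr (_, _); lia.
Qed.

(** A configuration of planar walks is a pair of independent configurations of
    signs, one for each diagonal coordinate. *)
Lemma expect_ge_sqr (A : {ffun 'I_h * 'I_N -> bool} -> R) (F : walks h N -> R) :
  (forall S, A (diag_signs S) * A (antidiag_signs S) <= F S) ->
  ((\sum_u A u) / 2 ^+ (h * N)) ^+ 2 <= expect F.
Proof.
move=> AF.
have -> : expect F = (\sum_S F S) / (2 ^+ (h * N)) ^+ 2.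
  rewrite /expect; congr (_ / _).
  rewrite /walks /walk !card_ffun !card_ord card_prod card_bool !natrX.
  by rewrite natrM -expr2 -!exprM; congr (_ ^+ _); lia.
rewrite exprMn exprVn ler_wpM2r ?invr_ge0 ?sqr_ge0//.
apply: le_trans (ler_sum _ (fun S _ => AF S)).
rewrite le_eqVlt; apply/orP; left; apply/eqP.
pose of_signs (p : {ffun 'I_h * 'I_N -> bool} * {ffun 'I_h * 'I_N -> bool}) : walks h N :=
  [ffun i => [ffun k => (p.1 (i, k) (+) p.2 (i, k), p.1 (i, k))]].
rewrite (reindex of_signs) /=; last first.
  exists (fun S => (diag_signs S, antidiag_signs S)) => [[u v] _|S _].
    congr (_, _); apply/ffunP => -[i k]; rewrite !ffunE //=.
    by rewrite addbAC addbb.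
  apply/ffunP => i; apply/ffunP => k; rewrite !ffunE /=.
  by case: (S i k) => a b /=; rewrite addbCA addbb addbF.
rewrite expr2 big_distrlr /= pair_bigA /=; apply: eq_bigr => -[u v] _ /=.
congr (A _ * A _); apply/ffunP => -[i k]; rewrite !ffunE //=.
by rewrite addbAC addbb.
Qed.

Lemma sign_walk_link u (e : 'I_h * 'I_h) (p q : nat) : (p <= q)%N ->
  lin (link_form R (e, (p, q))) u = 0 ->
  sign_walk u e.1 p = sign_walk u e.2 p -> sign_walk u e.1 q = sign_walk u e.2 q.
Proof.
have swE i n : sign_walk u i n = \sum_(k < N) (k < n)%N%:R * (-1) ^+ u (i, k).
  rewrite /sign_walk big_mkcond; apply: eq_bigr => k _.
  by case: (k < n)%N; rewrite ?mul1r ?mul0r.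
move=> pq l0 ep; apply/eqP; rewrite -subr_eq0; apply/eqP.
transitivity (lin (link_form R (e, (p, q))) u + (sign_walk u e.1 p - sign_walk u e.2 p)).
  rewrite lin_link_formE !swE -!sumrB -big_split /=; apply: eq_bigr => k _.
  move: ((-1) ^+ u (e.1, k)) ((-1) ^+ u (e.2, k)) => A B.
  have [kp|pk] := ltnP k p; first by rewrite (leq_trans kp pq) /=; ring.
  by case: (k < q)%N => /=; ring.
by rewrite l0 ep subrr addr0.
Qed.

End TwoDimensions.

Fixpoint visit_times (s : nat) (g : seq nat) : seq nat :=
  if g is m :: g' then (s + m)%N :: visit_times (s + m) g' else [::].

Fixpoint links (h : nat) (e : 'I_h * 'I_h) (s : nat) (g : seq nat) : seq (link h) :=
  if g is m :: g' then (e, (s, s + m)%N) :: links e (s + m) g' else [::].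

(** The kept meetings of a pair are given by the gaps between them, because
    weights and probabilities are products over gaps. *)
Definition visits (h : nat) := seq (('I_h * 'I_h) * seq nat).

Definition constraints (h : nat) (f : visits h) : seq (link h) :=
  flatten [seq links x.1 0 x.2 | x <- f].

(** The probability of all the constraints for one diagonal coordinate. *)
Definition coord_prob (R : realType) (h N : nat) (cs : seq (link h)) : R :=
  (\sum_(u : {ffun 'I_h * 'I_N -> bool})
     \prod_(c <- cs) (lin (link_form R c) u == 0)%:R) / 2 ^+ (h * N).

Lemma prod_bool (R : realType) (T : Type) (P : pred T) (s : seq T) :
  \prod_(x <- s) (P x)%:R = (all P s)%:R :> R.
Proof.
elim: s => [|x s IH]; first by rewrite big_nil.
by rewrite big_cons IH /=; case: (P x); rewrite ?mul1r ?mul0r.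
Qed.

(** Two walks that agree at time 0 and along every link of their list meet at all
    the times of that list. *)
Lemma collisions_of_constraints (R : realType) (h N : nat) (f : visits h) :
  coord_prob R N (constraints f) ^+ 2 <=
  expect (fun S : walks h N => \prod_(x <- f) \prod_(t <- visit_times 0 x.2)
     (site (S x.1.1) t == site (S x.1.2) t)%:R : R).
Proof.
apply: expect_ge_sqr => S; rewrite /constraints !big_flatten !big_map.
rewrite -big_split /= big_seq [leRHS]big_seq; apply: ler_prod => -[e g] _ /=.
rewrite !prod_bool -natrM ler_nat; apply/andP; split=> //.
case: allP => [au|_]; last by rewrite mul0n.
case: allP => [av|_]; last by rewrite muln0.
rewrite muln1 lt0b; apply/allP.
have : sign_walk R (diag_signs S) e.1 0 = sign_walk R (diag_signs S) e.2 0.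
  by rewrite /sign_walk !big_pred0.
have : sign_walk R (antidiag_signs S) e.1 0 = sign_walk R (antidiag_signs S) e.2 0.
  by rewrite /sign_walk !big_pred0.
elim: g 0%N au av => [//|m g IH] s au av es eu t /=.
have {}eu : sign_walk R (diag_signs S) e.1 (s + m) = sign_walk R (diag_signs S) e.2 (s + m).
  apply: sign_walk_link eu; first exact: leq_addr.
  by apply/eqP/au; rewrite /= mem_head.
have {}es : sign_walk R (antidiag_signs S) e.1 (s + m) = sign_walk R (antidiag_signs S) e.2 (s + m).
  apply: sign_walk_link es; first exact: leq_addr.
  by apply/eqP/av; rewrite /= mem_head.
rewrite inE => /orP[/eqP ->|]; first by apply/eqP/(@eq_site R).
apply: IH => //.
  by move=> c cg; apply: au; rewrite /= inE cg orbT.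
by move=> c cg; apply: av; rewrite /= inE cg orbT.
Qed.

Fixpoint gap_lists (a b k : nat) : seq (seq nat) :=
  if k is k'.+1 then
    [::] :: [seq m :: g | m <- index_iota a b, g <- gap_lists a b k']
  else [:: [::]].

Lemma big_gap_lists (R : realType) (a b k : nat) (F : seq nat -> R) :
  \sum_(g <- gap_lists a b k.+1) F g
  = F [::] + \sum_(a <= m < b) \sum_(g <- gap_lists a b k) F (m :: g).
Proof. by rewrite /= big_cons big_allpairs_dep. Qed.

(** Sorting the terms of the expanded product by their first index yields the
    recursion that also generates the lists of gaps. *)
Lemma prod_first_factor (R : realType) (y : nat -> R) (s N : nat) : (s <= N)%N ->
  \prod_(s.+1 <= n < N.+1) (1 + y n)
  = 1 + \sum_(s.+1 <= n < N.+1) y n * \prod_(n.+1 <= l < N.+1) (1 + y l).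
Proof.
elim: {s}(N - s)%N {-2}s (erefl (N - s)%N) => [|d IH] s ds sN.
  have -> : s = N by lia.
  by rewrite !big_geq// addr0.
have lt1 : (s.+1 < N.+1)%N by lia.
rewrite big_ltn// [in RHS]big_ltn// mulrDl mul1r {1}IH; [|lia|lia].
by rewrite -addrA; congr (1 + _); rewrite addrC.
Qed.

(** The expansion of the product over meeting times, restricted to at most [k]
    meetings with gaps from [a] to [b - 1]; such lists fit before time [N]. *)
Lemma prod_ge_gap_lists (R : realType) (x : nat -> R) (lam : R) (a b k s N : nat) :
  (forall n, 0 <= x n) -> 0 <= lam -> (0 < a)%N -> (s + k * b.-1 <= N)%N ->
  \sum_(g <- gap_lists a b k) lam ^+ size g * \prod_(t <- visit_times s g) x t
  <= \prod_(s.+1 <= n < N.+1) (1 + lam * x n).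
Proof.
move=> x0 lam0 a0; elim: k s => [|k IH] s sN.
  rewrite /= big_seq1 /= big_nil mulr1 expr0.
  apply: (big_ind (fun y => 1 <= y)) => // [y z|n _]; first exact: mulr_ege1.
  by rewrite lerDl mulr_ge0.
rewrite mulSn in sN; have sN' : (s <= N)%N by apply: leq_trans sN; exact: leq_addr.
rewrite big_gap_lists /= big_nil mulr1 expr0 (prod_first_factor _ sN').
rewrite lerD2l.
have P0 n : 0 <= lam * x n * \prod_(n.+1 <= l < N.+1) (1 + lam * x l).
  by rewrite !mulr_ge0// prodr_ge0// => i _; rewrite addr_ge0// mulr_ge0.
have [ba|ab] := leqP b a.
  by rewrite big_geq// sumr_ge0.
apply: (@le_trans _ _ (\sum_(a + s <= n < b + s)
    lam * x n * \prod_(n.+1 <= l < N.+1) (1 + lam * x l))).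
  rewrite big_addn addnK.
  apply: ler_sum_nat => m mab.
  apply: (@le_trans _ _ (lam * x (m + s)%N *
     \sum_(g <- gap_lists a b k) lam ^+ size g * \prod_(t <- visit_times (m + s) g) x t)).
    rewrite mulr_sumr le_eqVlt; apply/orP; left; apply/eqP; apply: eq_bigr => g _.
    by rewrite big_cons exprS [(s + m)%N]addnC; ring.
  rewrite ler_wpM2l ?mulr_ge0//; apply: IH; lia.
rewrite [leRHS](big_cat_nat (n := (a + s)%N)) /=; [|lia|lia].
rewrite [X in _ <= _ + X](big_cat_nat (n := (b + s)%N)) /=; [|lia|lia].
by rewrite addrCA ler_wpDr// addr_ge0// sumr_ge0.
Qed.

Fixpoint families (E : Type) (G : seq (seq nat)) (es : seq E) :
    seq (seq (E * seq nat)) :=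
  if es is e :: es' then [seq (e, g) :: f | g <- G, f <- families G es']
  else [:: [::]].

Lemma big_families (R : realType) (E : Type) (G : seq (seq nat)) (e : E) es
    (F : seq (E * seq nat) -> R) :
  \sum_(f <- families G (e :: es)) F f
  = \sum_(g <- G) \sum_(f <- families G es) F ((e, g) :: f).
Proof. by rewrite /= big_allpairs_dep. Qed.

Lemma prod_sum_families (R : realType) (E : Type) (G : seq (seq nat))
    (es : seq E) (F : E -> seq nat -> R) :
  \prod_(e <- es) \sum_(g <- G) F e g
  = \sum_(f <- families G es) \prod_(x <- f) F x.1 x.2.
Proof.
elim: es => [|e es IH]; first by rewrite /= big_seq1 !big_nil.
rewrite big_cons big_families IH mulr_suml; apply: eq_bigr => g _.
by rewrite mulr_sumr; apply: eq_bigr => f _; rewrite big_cons.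
Qed.

(** As exp x >= 1 + x, the local time of each pair is replaced by a product over
    the times, then expanded into lists of gaps. *)
Lemma moment_ge_families (R : realType) (h N a b k : nat)
    (beta : 'I_h * 'I_h -> R) (es : seq ('I_h * 'I_h)) :
  perm_eq es (enum (Pairs h)) -> (forall e, e \in Pairs h -> 0 <= beta e) ->
  (1 <= N)%N -> (0 < a)%N -> (k * b.-1 <= N)%N ->
  \sum_(f <- families (gap_lists a b k) es)
    (\prod_(x <- f) (pi * beta x.1 / logN R N) ^+ size x.2)
      * coord_prob R N (constraints f) ^+ 2
  <= moment N beta.
Proof.
move=> pes beta0 N1 a0 kN.
have lam0 e : e \in Pairs h -> 0 <= pi * beta e / logN R N.
  by move=> /beta0 be; rewrite divr_ge0 ?mulr_ge0 ?pi_ge0// ln_ge0// ler1n.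
pose x (S : walks h N) (e : 'I_h * 'I_h) t : R := (site (S e.1) t == site (S e.2) t)%:R.
have fam_pairs f : f \in families (gap_lists a b k) es -> {in f, forall y, y.1 \in Pairs h}.
  have : {subset es <= Pairs h} by move=> e; rewrite (perm_mem pes) mem_enum.
  elim: es f {pes} => [|e es IH] f sub /=.
    by rewrite inE => /eqP -> y.
  move=> /allpairsP[[g f'] [_ /= f'es ->]] y; rewrite inE => /orP[/eqP ->/=|].
    by apply: sub; rewrite mem_head.
  by apply: IH => // e' e'es; apply: sub; rewrite inE e'es orbT.
apply: (@le_trans _ _ (\sum_(f <- families (gap_lists a b k) es)
    (\prod_(y <- f) (pi * beta y.1 / logN R N) ^+ size y.2) *
    expect (fun S : walks h N => \prod_(y <- f) \prod_(t <- visit_times 0 y.2) x S y.1 t))).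
  rewrite big_seq [leRHS]big_seq; apply: ler_sum => f ff.
  rewrite ler_wpM2l//; last exact: collisions_of_constraints.
  rewrite big_seq; apply: prodr_ge0 => y yf; rewrite exprn_ge0// lam0//.
  exact: fam_pairs yf.
rewrite /moment /expect.
under eq_bigr => f _ do rewrite mulrA.
rewrite -mulr_suml ler_wpM2r ?invr_ge0//.
under eq_bigr => f _ do rewrite mulr_sumr.
rewrite exchange_big /=; apply: ler_sum => S _.
rewrite expR_sum -big_enum -(perm_big _ pes) /=.
apply: (@le_trans _ _ (\prod_(e <- es) \sum_(g <- gap_lists a b k)
   (pi * beta e / logN R N) ^+ size g * \prod_(t <- visit_times 0 g) x S e t)).
  rewrite prod_sum_families le_eqVlt; apply/orP; left; apply/eqP.
  by apply: eq_bigr => f _; rewrite -big_split.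
rewrite big_seq [leRHS]big_seq; apply: ler_prod => e ees.
have eP : e \in Pairs h by rewrite -mem_enum -(perm_mem pes).
apply/andP; split.
  apply: sumr_ge0 => g _; rewrite mulr_ge0 ?exprn_ge0 ?lam0//.
  by apply: prodr_ge0.
apply: le_trans (prod_ge_gap_lists (N := N) _ (lam0 e eP) a0 _) _ => //.
rewrite /local_time natr_sum mulr_sumr expR_sum; apply: ler_prod => n _.
rewrite expR_ge1Dx andbT addr_ge0// mulr_ge0//; exact: lam0.
Qed.

(** * Weights of families of visits *)

Definition times_far (T : nat) (g g' : seq nat) : bool :=
  all (fun t => all (fun t' => (t + T <= t') || (t' + T <= t))%N (visit_times 0 g')) (visit_times 0 g).

Definition time_separated (E : Type) (T : nat) (f : seq (E * seq nat)) : bool :=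
  pairwise (fun x y => times_far T x.2 y.2) f.

Lemma size_visit_times s g : size (visit_times s g) = size g.
Proof. by elim: g s => //= m g IH s; rewrite IH. Qed.

Lemma size_gap_lists a b k g : g \in gap_lists a b k -> (size g <= k)%N.
Proof.
elim: k g => [|k IH] g /=; first by rewrite inE => /eqP ->.
rewrite inE => /orP[/eqP ->//|/allpairsP[[m g'] [_ /= /IH ? ->]]].
by rewrite /= ltnS.
Qed.

Lemma gap_lists_bounds a b k g : g \in gap_lists a b k -> all (fun m => a <= m < b)%N g.
Proof.
elim: k g => [|k IH] g /=; first by rewrite inE => /eqP ->.
rewrite inE => /orP[/eqP ->//|/allpairsP[[m g'] [+ /= /IH ? ->]]].
by rewrite /= mem_index_iota => ->.
Qed.

Lemma families_mem (E : eqType) (G : seq (seq nat)) (es : seq E) f :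
  f \in families G es ->
  [/\ [seq x.1 | x <- f] = es & {in f, forall x, x.2 \in G}].
Proof.
elim: es f => [|e es IH] f /=; first by rewrite inE => /eqP ->.
move=> /allpairsP[[g f'] [/= gG /IH[<- f'G] ->]]; split=> // x.
by rewrite inE => /orP[/eqP ->//|/f'G].
Qed.

Lemma ler_term_sum (R : realType) (I : eqType) (s : seq I) (F : I -> R) x :
  (forall y, 0 <= F y) -> x \in s -> F x <= \sum_(y <- s) F y.
Proof. by move=> F0 xs; rewrite (big_rem x xs) /= lerDl sumr_ge0. Qed.

Section Weights.
Context (R : realType) (E : eqType) (w : E -> nat -> R) (a b k : nat).
Hypothesis w_ge0 : forall e m, 0 <= w e m.

Definition weight e (g : seq nat) : R := \prod_(m <- g) w e m.
Definition fweight (f : seq (E * seq nat)) : R := \prod_(x <- f) weight x.1 x.2.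
Definition gap_sum e : R := \sum_(a <= m < b) w e m.
Definition pair_partition e : R := \sum_(g <- gap_lists a b k) weight e g.

Lemma weight_ge0 e g : 0 <= weight e g.
Proof. exact: prodr_ge0. Qed.

Lemma fweight_ge0 f : 0 <= fweight f.
Proof. by apply: prodr_ge0 => x _; exact: weight_ge0. Qed.

Lemma gap_sum_ge0 e : 0 <= gap_sum e.
Proof. exact: sumr_ge0. Qed.

Lemma sum_fweight es :
  \sum_(f <- families (gap_lists a b k) es) fweight f = \prod_(e <- es) pair_partition e.
Proof. by rewrite prod_sum_families. Qed.

(** The weight of a list is a product over its gaps, which are chosen
    independently. *)
Lemma sum_weight_geometric e j :
  \sum_(g <- gap_lists a b j) weight e g = \sum_(i < j.+1) gap_sum e ^+ i.
Proof.
elim: j => [|j IH]; first by rewrite /= big_seq1 big_ord1 expr0 /weight big_nil.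
rewrite big_gap_lists [weight e [::]]big_nil big_ord_recl expr0; congr (1 + _).
under eq_bigr => m _ do (under eq_bigr => g _ do rewrite /weight big_cons).
under eq_bigr => m _ do rewrite -mulr_sumr IH.
rewrite -mulr_suml -/(gap_sum e) mulr_sumr.
by apply: eq_bigr => i _; rewrite -exprS.
Qed.

Lemma pair_partition_ge1 e : 1 <= pair_partition e.
Proof.
rewrite /pair_partition sum_weight_geometric big_ord_recl expr0 lerDl.
by apply: sumr_ge0 => i _; rewrite exprn_ge0// gap_sum_ge0.
Qed.

Lemma pair_partition_ge0 e : 0 <= pair_partition e.
Proof. exact: le_trans (pair_partition_ge1 e). Qed.

Lemma prod_pair_partition_ge0 es : 0 <= \prod_(e <- es) pair_partition e.
Proof. by apply: prodr_ge0 => e _; exact: pair_partition_ge0. Qed.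

Lemma sum_weight_le2 e j : gap_sum e <= 1 / 2 ->
  \sum_(g <- gap_lists a b j) weight e g <= 2.
Proof.
move=> s12; elim: j => [|j IH].
  by rewrite /= big_seq1 /weight big_nil; lra.
rewrite sum_weight_geometric big_ord_recl expr0.
under eq_bigr => i _ do rewrite exprS.
rewrite -mulr_sumr -sum_weight_geometric.
have := gap_sum_ge0 e; nra.
Qed.

(** The last gap before the given time already costs its own weight, and the sums
    over the other gaps are bounded. *)
Lemma weight_hit e d t : 0 <= d -> gap_sum e <= 1 / 2 ->
  (forall m, (a <= m < b)%N -> w e m <= d) -> forall s,
  \sum_(g <- gap_lists a b k) weight e g * (t \in visit_times s g)%:R <= 4 * d.
Proof.
move=> d0 s12 wd; elim: {1}k => [|j IH] s.
  by rewrite /= big_seq1 mulr0 mulr_ge0.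
rewrite big_gap_lists /= mulr0 add0r.
apply: (@le_trans _ _ (\sum_(a <= m < b) w e m * ((t == s + m)%N%:R * 2 + 4 * d))).
  apply: ler_sum => m _.
  apply: (@le_trans _ _ (w e m * (\sum_(g <- gap_lists a b j)
     ((t == s + m)%N%:R * weight e g + weight e g * (t \in visit_times (s + m) g)%:R)))).
    rewrite mulr_sumr; apply: ler_sum => g _; rewrite /weight big_cons -mulrA.
    rewrite ler_wpM2l// inE -/(weight e g).
    have := weight_ge0 e g; case: (t == _); case: (t \in _); rewrite /=; lra.
  rewrite ler_wpM2l// big_split /=; apply: lerD => //.
  by rewrite -mulr_sumr ler_wpM2l// sum_weight_le2.
under eq_bigr => m _ do rewrite mulrDr.
rewrite big_split /= -mulr_suml -/(gap_sum e).
have h1 : gap_sum e * (4 * d) <= 2 * d by nra.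
suff h2 : \sum_(a <= m < b) w e m * ((t == s + m)%N%:R * 2) <= d * 2 by lra.
have [/andP[sat tsb]|nt] := boolP ((a <= t - s) && (t - s < b) && (s <= t))%N; last first.
  rewrite big_nat big1 ?mulr_ge0// => m mab.
  case: eqP => [ts|_]; last by rewrite mul0r mulr0.
  by move: nt; rewrite ts addKn mab leq_addr.
rewrite (bigD1_seq (t - s)%N) ?mem_index_iota ?iota_uniq//=.
rewrite subnKC// eqxx mul1r big1 ?addr0 => [|m mts].
  by rewrite ler_wpM2r// wd.
case: eqP => [ts|_]; last by rewrite mul0r mulr0.
by move: mts; rewrite ts addKn eqxx.
Qed.

Lemma weight_not_far T e d g' : 0 <= d -> gap_sum e <= 1 / 2 ->
  (forall m, (a <= m < b)%N -> w e m <= d) ->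
  \sum_(g <- gap_lists a b k) weight e g * (~~ times_far T g g')%:R
  <= (size g' * T)%:R * (8 * d).
Proof.
move=> d0 s12 wd.
apply: (@le_trans _ _ (\sum_(g <- gap_lists a b k) \sum_(t' <- visit_times 0 g')
   \sum_(t' - T <= t < t' + T) weight e g * (t \in visit_times 0 g)%:R)).
  apply: ler_sum => g _.
  have S0 t' : 0 <= \sum_(t' - T <= t < t' + T) weight e g * (t \in visit_times 0 g)%:R.
    by apply: sumr_ge0 => t _; rewrite mulr_ge0 ?weight_ge0.
  have [_|/allPn[t tg /allPn[t' tg']]] := boolP (times_far T g g').
    by rewrite mulr0 sumr_ge0.
  rewrite negb_or -!ltnNge => /andP[tt1 tt2]; rewrite mulr1.
  pose F t := weight e g * (t \in visit_times 0 g)%:R.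
  have Ft : F t = weight e g by rewrite /F tg mulr1.
  rewrite -[leLHS]Ft; apply: (@le_trans _ _ (\sum_(t' - T <= t < t' + T) F t)); last first.
    exact: (@ler_term_sum _ _ _ (fun t' => \sum_(t' - T <= t < t' + T) F t) t' S0 tg').
  apply: ler_term_sum => [y|]; first by rewrite mulr_ge0 ?weight_ge0.
  by rewrite mem_index_iota; lia.
rewrite exchange_big /=.
apply: (@le_trans _ _ (\sum_(t' <- visit_times 0 g') \sum_(t' - T <= t < t' + T) 4 * d)).
  apply: ler_sum => t' _; rewrite exchange_big /=; apply: ler_sum => t _.
  exact: weight_hit.
apply: (@le_trans _ _ (\sum_(t' <- visit_times 0 g') T%:R * (8 * d))).
  apply: ler_sum => t' _; rewrite sumr_const_nat -[leLHS]mulr_natl.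
  have -> : T%:R * (8 * d) = (2 * T)%:R * (4 * d) by rewrite natrM; ring.
  rewrite ler_wpM2r ?mulr_ge0// ler_nat; lia.
rewrite big_const_seq count_predT size_visit_times iter_addr_0 -[leLHS]mulr_natl.
by rewrite natrM mulrA.
Qed.

(** Union bound over the pairs of entries of the family. *)
Lemma fweight_not_separated T es (z : R) :
  0 <= z -> {in es, forall e g', (size g' <= k)%N ->
    \sum_(g <- gap_lists a b k) weight e g * (~~ times_far T g g')%:R <= z} ->
  \sum_(f <- families (gap_lists a b k) es) fweight f * (~~ time_separated T f)%:R
  <= (size es ^ 2)%:R * z * \prod_(e <- es) pair_partition e.
Proof.
move=> z0; elim: es => [_|e es IH hz].
  by rewrite /= big_seq1 mulr0 mul0r mul0r.
have {}IH : \sum_(f <- families (gap_lists a b k) es) fweight f * (~~ time_separated T f)%:R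
    <= (size es ^ 2)%:R * z * \prod_(e <- es) pair_partition e.
  by apply: IH => e' e'es; apply: hz; rewrite inE e'es orbT.
rewrite big_families big_cons.
pose fs := families (gap_lists a b k) es.
apply: (@le_trans _ _ (\sum_(g <- gap_lists a b k) \sum_(f <- fs)
   (fweight f * \sum_(y <- f) weight e g * (~~ times_far T g y.2)%:R
    + weight e g * (fweight f * (~~ time_separated T f)%:R)))).
  apply: ler_sum => g _; apply: ler_sum => f _.
  have -> : fweight ((e, g) :: f) = weight e g * fweight f by rewrite /fweight big_cons.
  have w0 := weight_ge0 e g; have f0 := fweight_ge0 f.
  rewrite /time_separated /=; set p := pairwise _ f.
  have t0 : 0 <= fweight f * \sum_(y <- f) weight e g * (~~ times_far T g y.2)%:R.
    by rewrite mulr_ge0// sumr_ge0// => y _; rewrite mulr_ge0.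
  have [/= _|/allPn[y yf /= nf]] := boolP (all _ f).
    by rewrite mulrA lerDr.
  rewrite mulr1 mulrC ler_wpDr//; first by rewrite !mulr_ge0.
  rewrite ler_wpM2l//; apply: le_trans (ler_term_sum (F := fun y : E * seq nat =>
    weight e g * (~~ times_far T g y.2)%:R) _ yf) => [|y']; first by rewrite nf mulr1.
  by rewrite mulr_ge0.
rewrite (eq_bigr _ (fun g _ => big_split _ _ _ _ _)) big_split /=.
have -> : \sum_(g <- gap_lists a b k) \sum_(f <- fs)
    weight e g * (fweight f * (~~ time_separated T f)%:R)
  = pair_partition e * \sum_(f <- fs) fweight f * (~~ time_separated T f)%:R.
  by rewrite /pair_partition mulr_suml; apply: eq_bigr => g _; rewrite -mulr_sumr.
have h1 : \sum_(g <- gap_lists a b k) \sum_(f <- fs)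
     fweight f * \sum_(y <- f) weight e g * (~~ times_far T g y.2)%:R
   <= (size es)%:R * z * \prod_(e' <- es) pair_partition e'.
  rewrite exchange_big /= -sum_fweight mulr_sumr big_seq [leRHS]big_seq.
  apply: ler_sum => f ff; rewrite -mulr_sumr mulrC ler_wpM2r ?fweight_ge0//.
  have [fes fG] := families_mem ff.
  rewrite exchange_big /= -fes size_map.
  apply: (@le_trans _ _ (\sum_(y <- f) z)); last first.
    by rewrite big_const_seq count_predT iter_addr_0 mulr_natl.
  rewrite big_seq [leRHS]big_seq; apply: ler_sum => y yf.
  by apply: hz; rewrite ?mem_head// (size_gap_lists (fG y yf)).
have Pe := pair_partition_ge1 e.
have P0 := prod_pair_partition_ge0 es.
set P := \prod_(e' <- es) _ in P0 h1 IH *.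
set x := pair_partition e in Pe *; set n := (size es)%:R in h1 *.
have n0 : 0 <= n by [].
set B := \sum_(f <- fs) _ in IH *.
have h2 : x * B <= x * (n ^+ 2 * z * P) by rewrite ler_wpM2l ?(le_trans ler01)// -natrX.
have h3 : n * z * P <= x * (n * z * P) by rewrite ler_peMl// !mulr_ge0.
have -> : (size (e :: es) ^ 2)%:R = n ^+ 2 + (2 * n + 1) :> R.
  by rewrite natrX /= -natr1 -/n; ring.
have h4 : 0 <= x * ((n + 1) * z * P).
  by rewrite !mulr_ge0// ?addr_ge0// (le_trans ler01).
apply: le_trans (lerD h1 h2) _; lra.
Qed.

End Weights.

(** * Families containing a cherry *)

(** The scale of the visit of a pair that is visited once; pairs with no visit or
    several visits have no scale. *)
Definition dyadic_bin (g : seq nat) : option nat :=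
  if g is [:: m] then Some (trunc_log 2 m) else None.

Definition comparable (g g' : seq nat) : bool :=
  match g, g' with
  | [:: m], [:: n] => (m <= n.*2)%N && (n <= m.*2)%N
  | _, _ => false
  end.

Lemma comparableC g g' : comparable g g' = comparable g' g.
Proof.
by case: g => [|m [|? ?]]; case: g' => [|n [|? ?]] //=; rewrite andbC.
Qed.

(** Both pairs are visited once, so their links start at time 0 and overlap along
    the whole shorter one. *)
Definition cherry (h : nat) (f : visits h) : bool :=
  has (fun x => has (fun y =>
    [&& x.1.1 == y.1.1, x.1.2 != y.1.2 & comparable x.2 y.2]) f) f.

Lemma dyadic_bin_close g g' c : all (leq 1) g -> all (leq 1) g' ->
  dyadic_bin g = Some c -> dyadic_bin g' = Some c -> comparable g g'.
Proof.
case: g => [//|m [|//]]; case: g' => [//|n [|//]] /=.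
rewrite !andbT => m0 n0 [mc] [nc].
have /andP[m1 m2] := trunc_log_bounds (isT : 1 < 2)%N m0.
have /andP[n1 n2] := trunc_log_bounds (isT : 1 < 2)%N n0.
by rewrite mc expnS in m1 m2; rewrite nc expnS in n1 n2; lia.
Qed.

Lemma cherry_cat (h : nat) (f1 f2 : visits h) :
  cherry f1 || cherry f2 -> cherry (f1 ++ f2).
Proof.
by case/orP => /hasP[x xf /hasP[y yf xy]]; apply/hasP; exists x;
  rewrite ?mem_cat ?xf ?orbT//; apply/hasP; exists y; rewrite ?mem_cat ?yf ?orbT.
Qed.

Lemma expr_1B_le (R : realType) (x : R) m :
  0 <= x -> m%:R * x <= 1 -> (1 - x) ^+ m <= 1 - m%:R * x / 2.
Proof.
move=> x0; elim: m => [|m IH] mx; first by rewrite expr0 !mul0r subr0.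
have mx' : m%:R * x <= 1 by apply: le_trans mx; rewrite ler_wpM2r// ler_nat.
have m0 : 0 <= m%:R :> R by [].
rewrite exprSr -natr1 in mx *.
have x1 : x <= 1 by nra.
have := IH mx'; set y := (1 - x) ^+ m => hy.
have h1 : y * (1 - x) <= (1 - m%:R * x / 2) * (1 - x) by rewrite ler_wpM2r// subr_ge0.
apply: le_trans h1 _; nra.
Qed.

Section CherryWeight.
Context (R : realType) (h : nat) (w : 'I_h * 'I_h -> nat -> R) (a b k : nat).
Hypothesis w_ge0 : forall e m, 0 <= w e m.
Hypothesis a_gt0 : (0 < a)%N.

Let G := gap_lists a b k.
Let part e := pair_partition w a b k e.

Definition bin_weight (e : 'I_h * 'I_h) (c : nat) : R :=
  \sum_(g <- gap_lists a b k) weight w e g * (dyadic_bin g == Some c)%:R.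

Lemma sum_families_cat (E : Type) (es1 es2 : seq E) (F : seq (E * seq nat) -> R) :
  \sum_(f <- families G (es1 ++ es2)) F f
  = \sum_(f1 <- families G es1) \sum_(f2 <- families G es2) F (f1 ++ f2).
Proof.
elim: es1 F => [|e es1 IH] F; first by rewrite /= big_seq1.
by rewrite cat_cons !big_families; apply: eq_bigr => g _; rewrite IH.
Qed.

Lemma fweight_cat (f1 f2 : visits h) :
  fweight w (f1 ++ f2) = fweight w f1 * fweight w f2.
Proof. by rewrite /fweight big_cat. Qed.

Let avoid (U : seq nat) (f : visits h) : R :=
  \prod_(y <- f) (~~ has (fun c => dyadic_bin y.2 == Some c) U)%:R.

(** The entries of a family are independent under the product weights, and each
    one has its visit at a scale of [U] with relative weight at least
    [size U * al]. *)
Lemma sum_fweight_avoid (U : seq nat) (es : seq ('I_h * 'I_h)) (al : R) :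
  uniq U -> 0 <= al ->
  {in es, forall e, {in U, forall c, al * part e <= bin_weight e c}} ->
  (size es)%:R * ((size U)%:R * al) <= 1 ->
  \sum_(f <- families G es) fweight w f * avoid U f
  <= (1 - (size es)%:R * ((size U)%:R * al) / 2) * \prod_(e <- es) part e.
Proof.
move=> uU al0 hal sal; set x := (size U)%:R * al in sal *.
have x0 : 0 <= x by rewrite mulr_ge0.
apply: (@le_trans _ _ ((1 - x) ^+ size es * \prod_(e <- es) part e)); last first.
  rewrite ler_wpM2r ?expr_1B_le//; exact: prod_pair_partition_ge0.
have -> : \sum_(f <- families G es) fweight w f * avoid U f
  = \prod_(e <- es) \sum_(g <- G)
      weight w e g * (~~ has (fun c => dyadic_bin g == Some c) U)%:R.
  by rewrite prod_sum_families; apply: eq_bigr => f _; rewrite -big_split.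
have -> : (1 - x) ^+ size es * \prod_(e <- es) part e
   = \prod_(e <- es) ((1 - x) * part e).
  by rewrite big_split /= big_const_seq count_predT -Monoid.iteropE.
rewrite big_seq [leRHS]big_seq; apply: ler_prod => e ees; apply/andP; split.
  by apply: sumr_ge0 => g _; rewrite mulr_ge0 ?weight_ge0.
have -> : \sum_(g <- G) weight w e g * (~~ has (fun c => dyadic_bin g == Some c) U)%:R
   = part e - \sum_(c <- U) bin_weight e c.
  rewrite exchange_big /= -sumrB; apply: eq_bigr => g _.
  rewrite -mulr_sumr -[X in X - _]mulr1 -mulrBr; congr (_ * _).
  elim: (U) uU => [_|c s IH /= /andP[cs us]]; first by rewrite /= big_nil subr0.
  rewrite big_cons /=; case: eqP => [bc|_] /=; last by rewrite IH// add0r.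
  rewrite big1_seq ?addr0 ?subrr// => d /andP[_ ds]; rewrite bc.
  by case: eqP => // -[cd]; move: cs; rewrite cd ds.
rewrite mulrBl mul1r lerD2l lerN2 /x -mulrA.
apply: (@le_trans _ _ (\sum_(c <- U) al * part e)).
  by rewrite big_const_seq count_predT iter_addr_0 mulr_natl.
by rewrite big_seq [leRHS]big_seq; apply: ler_sum => c cU; exact: hal.
Qed.

Let used (B : seq nat) (f : visits h) : seq nat :=
  [seq c <- B | has (fun x => dyadic_bin x.2 == Some c) f].

(** The complement of [sum_fweight_avoid] for a single scale, summed over the
    scales of [B]. *)
Lemma sum_fweight_used (B : seq nat) (es : seq ('I_h * 'I_h)) (al : R) :
  uniq B -> 0 <= al ->
  {in es, forall e, {in B, forall c, al * part e <= bin_weight e c}} ->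
  (size es)%:R * al <= 1 ->
  (size B)%:R * ((size es)%:R * al / 2) * \prod_(e <- es) part e
  <= \sum_(f <- families G es) fweight w f * (size (used B f))%:R.
Proof.
move=> uB al0 hal sal; set P := \prod_(e <- es) part e.
have -> : \sum_(f <- families G es) fweight w f * (size (used B f))%:R
   = \sum_(c <- B) (P - \sum_(f <- families G es) fweight w f * avoid [:: c] f).
  have -> : \sum_(c <- B) (P - \sum_(f <- families G es) fweight w f * avoid [:: c] f)
    = \sum_(c <- B) \sum_(f <- families G es)
        fweight w f * (has (fun x => dyadic_bin x.2 == Some c) f)%:R.
    apply: eq_bigr => c _; rewrite /P -sum_fweight -sumrB; apply: eq_bigr => f _.
    rewrite -[X in X - _]mulr1 -mulrBr; congr (_ * _).
    rewrite /avoid prod_bool.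
    rewrite (eq_all (a2 := predC (fun x => dyadic_bin x.2 == Some c))); last first.
      by move=> x /=; rewrite orbF.
    by rewrite all_predC; case: has; rewrite /= ?subr0 ?subrr.
  rewrite exchange_big /=; apply: eq_bigr => f _; rewrite -mulr_sumr; congr (_ * _).
  by rewrite /used size_filter -sum1_count natr_sum [LHS]big_mkcond /=;
    apply: eq_bigr => c _; case: has.
apply: (@le_trans _ _ (\sum_(c <- B) ((size es)%:R * al / 2 * P))).
  by rewrite big_const_seq count_predT iter_addr_0 -[leRHS]mulr_natl !mulrA.
rewrite big_seq [leRHS]big_seq; apply: ler_sum => c cB.
have := @sum_fweight_avoid [:: c] es al isT al0.
rewrite /= mul1r -/P => /(_ _ sal) H.
have {}H : \sum_(f <- families G es) fweight w f * avoid [:: c] f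
   <= (1 - (size es)%:R * al / 2) * P.
  by apply: H => e ees d; rewrite inE => /eqP ->; exact: hal.
by rewrite lerBrDr -lerBrDl; apply: le_trans H _; rewrite mulrBl mul1r.
Qed.

Lemma size_used B f : uniq B -> (size (used B f) <= size f)%N.
Proof.
move=> uB; rewrite -(size_map Some) -(size_map (fun x => dyadic_bin x.2) f).
apply: uniq_leq_size; first by rewrite (map_inj_uniq (@Some_inj _)) filter_uniq.
move=> _ /mapP[c + ->]; rewrite mem_filter => /andP[/hasP[x xf /eqP <-] _].
by apply/mapP; exists x.
Qed.

Definition star (i : 'I_h) (J : seq 'I_h) : seq ('I_h * 'I_h) := [seq (i, j) | j <- J].

Let visit_ge1 (es : seq ('I_h * 'I_h)) f : f \in families G es -> {in f, forall x, all (leq 1) x.2}.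
Proof.
move=> /families_mem[_ fG] x xf; have := gap_lists_bounds (fG x xf).
by apply: sub_all => m /andP[am _]; exact: leq_trans am.
Qed.

Lemma no_cherry_avoid (i : 'I_h) (J1 J2 : seq 'I_h) (B : seq nat) f1 f2 :
  {in J1, forall j, j \notin J2} ->
  f1 \in families G (star i J1) -> f2 \in families G (star i J2) ->
  (~~ cherry (f1 ++ f2))%:R <= avoid (used B f1) f2.
Proof.
move=> J12 ff1 ff2; rewrite /avoid prod_bool ler_nat.
have [//|nch] := boolP (cherry _); rewrite lt0b; apply/allP => y yf.
apply/hasPn => c; rewrite mem_filter => /andP[/hasP[x xf /eqP xc] _].
apply: contra nch => /eqP yc; apply/hasP; exists x; first by rewrite mem_cat xf.
apply/hasP; exists y; first by rewrite mem_cat yf orbT.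
have [E1 _] := families_mem ff1; have [E2 _] := families_mem ff2.
have /mapP[j1 j1J e1] : x.1 \in star i J1 by rewrite -E1 map_f.
have /mapP[j2 j2J e2] : y.1 \in star i J2 by rewrite -E2 map_f.
rewrite e1 e2 eqxx /= (dyadic_bin_close (visit_ge1 ff1 xf) (visit_ge1 ff2 yf) xc yc) andbT.
by apply: contraNneq (J12 _ j1J) => ->.
Qed.

(** The leaves in [J1] occupy on average at least [size B * size J1 * al / 2]
    scales, and each leaf in [J2] then has a chance [al] per occupied scale to
    complete a cherry. *)
Lemma star_cherry_weight (i : 'I_h) (J1 J2 : seq 'I_h) (B : seq nat) (al : R) :
  {in J1, forall j, j \notin J2} -> uniq B -> 0 <= al ->
  {in star i (J1 ++ J2), forall e, {in B, forall c, al * part e <= bin_weight e c}} ->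
  (size J1)%:R * al <= 1 -> (size J2)%:R * ((size J1)%:R * al) <= 1 ->
  \sum_(f <- families G (star i (J1 ++ J2))) fweight w f * (~~ cherry f)%:R
  <= (1 - (size J1)%:R * (size J2)%:R * (size B)%:R * al ^+ 2 / 4)
     * \prod_(e <- star i (J1 ++ J2)) part e.
Proof.
move=> J12 uB al0 hal s1 s2.
have hal1 : {in star i J1, forall e, {in B, forall c, al * part e <= bin_weight e c}}.
  by move=> e eJ; apply: hal; rewrite /star map_cat mem_cat eJ.
have hal2 : {in star i J2, forall e, {in B, forall c, al * part e <= bin_weight e c}}.
  by move=> e eJ; apply: hal; rewrite /star map_cat mem_cat eJ orbT.
have -> : star i (J1 ++ J2) = star i J1 ++ star i J2 by exact: map_cat.
rewrite sum_families_cat big_cat /=.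
set P1 := \prod_(e <- star i J1) part e; set P2 := \prod_(e <- star i J2) part e.
have P20 : 0 <= P2 by exact: prod_pair_partition_ge0.
apply: (@le_trans _ _ (\sum_(f1 <- families G (star i J1))
   fweight w f1 * ((1 - (size J2)%:R * ((size (used B f1))%:R * al) / 2) * P2))).
  rewrite big_seq [leRHS]big_seq; apply: ler_sum => f1 ff1.
  apply: (@le_trans _ _ (fweight w f1 *
     \sum_(f2 <- families G (star i J2)) fweight w f2 * avoid (used B f1) f2)).
    rewrite mulr_sumr big_seq [leRHS]big_seq; apply: ler_sum => f2 ff2.
    rewrite fweight_cat -mulrA ler_wpM2l ?fweight_ge0// ler_wpM2l ?fweight_ge0//.
    exact: no_cherry_avoid ff1 ff2.
  rewrite ler_wpM2l ?fweight_ge0// -[size J2](size_map (pair i)) -/(star i J2).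
  apply: sum_fweight_avoid => //.
  - by rewrite filter_uniq.
  - by move=> e eJ c; rewrite mem_filter => /andP[_]; exact: hal2.
  rewrite size_map; apply: le_trans s2; rewrite ler_wpM2l// ler_wpM2r// ler_nat.
  apply: leq_trans (size_used _ uB) _.
  by have [E1 _] := families_mem ff1; rewrite -(size_map fst) E1 size_map.
have used_ge : (size B)%:R * ((size J1)%:R * al / 2) * P1 <=
   \sum_(f <- families G (star i J1)) fweight w f * (size (used B f))%:R.
  rewrite -[size J1](size_map (pair i)) -/(star i J1).
  by apply: sum_fweight_used => //; rewrite size_map.
have -> : \sum_(f1 <- families G (star i J1))
   fweight w f1 * ((1 - (size J2)%:R * ((size (used B f1))%:R * al) / 2) * P2)
  = (P1 - (size J2)%:R * al / 2 *
      \sum_(f <- families G (star i J1)) fweight w f * (size (used B f))%:R) * P2.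
  rewrite /P1 -sum_fweight mulr_sumr -sumrB mulr_suml; apply: eq_bigr => f _; ring.
have -> : (1 - (size J1)%:R * (size J2)%:R * (size B)%:R * al ^+ 2 / 4) * (P1 * P2)
  = (P1 - (size J2)%:R * al / 2 * ((size B)%:R * ((size J1)%:R * al / 2) * P1)) * P2.
  by field.
by rewrite ler_wpM2r// lerD2l lerN2 ler_wpM2l// divr_ge0// mulr_ge0.
Qed.

(** Stars with different centres are independent, so that the weights of the
    families without cherry multiply. *)
Lemma cherry_weight (I J1 J2 : seq 'I_h) (rest : seq ('I_h * 'I_h)) (B : seq nat) (al : R) :
  {in J1, forall j, j \notin J2} -> uniq B -> 0 <= al ->
  {in flatten [seq star i (J1 ++ J2) | i <- I], forall e,
     {in B, forall c, al * part e <= bin_weight e c}} ->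
  (size J1)%:R * al <= 1 -> (size J2)%:R * ((size J1)%:R * al) <= 1 ->
  let es := flatten [seq star i (J1 ++ J2) | i <- I] ++ rest in
  \sum_(f <- families G es) fweight w f * (~~ cherry f)%:R
  <= (1 - (size J1)%:R * (size J2)%:R * (size B)%:R * al ^+ 2 / 4) ^+ size I
     * \prod_(e <- es) part e.
Proof.
move=> J12 uB al0 hal s1 s2 /=; set p := (1 - _).
elim: I hal => [|i I IH] hal /=.
  rewrite expr0 mul1r -sum_fweight; apply: ler_sum => f _.
  by rewrite ler_piMr ?fweight_ge0//; case: cherry.
rewrite -catA sum_families_cat big_cat exprS mulrACA.
set S := flatten _ ++ rest in IH *.
apply: (@le_trans _ _ ((\sum_(f1 <- families G (star i (J1 ++ J2))) fweight w f1 * (~~ cherry f1)%:R)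
  * (\sum_(f2 <- families G S) fweight w f2 * (~~ cherry f2)%:R))).
  rewrite mulr_suml; apply: ler_sum => f1 _; rewrite mulr_sumr; apply: ler_sum => f2 _.
  rewrite fweight_cat mulrACA ler_wpM2l ?mulr_ge0 ?fweight_ge0// -natrM ler_nat.
  have := @cherry_cat _ f1 f2.
  case: (cherry f1) => /= [/(_ isT) -> //|].
  by case: (cherry f2) => /= [/(_ isT) -> //|_]; case: cherry.
apply: ler_pM.
- by apply: sumr_ge0 => f _; rewrite mulr_ge0 ?fweight_ge0.
- by apply: sumr_ge0 => f _; rewrite mulr_ge0 ?fweight_ge0.
- by apply: star_cherry_weight => // e eJ; apply: hal; rewrite /= mem_cat eJ.
- by apply: IH => e eJ; apply: hal; rewrite /= mem_cat eJ orbT.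
Qed.

End CherryWeight.

(** * Coincidence probabilities of separated families *)

(** A number of factors cos^2 that the damping of a link of length [m] dominates:
    slightly more than [m], because the damping constant is (1 + l^-2) / 2
    instead of 1 / 2. *)
Definition stretch (l m : nat) : nat := (m + m %/ l ^ 2 + 1)%N.

Lemma stretch_ge (R : realType) (l m : nat) : (0 < l)%N ->
  (1 + (l%:R^-1) ^+ 2) / 2 * (2 * m%:R) <= (stretch l m)%:R :> R.
Proof.
move=> l0; have L0 : 0 < l%:R ^+ 2 :> R by rewrite exprn_gt0// ltr0n.
have -> : (1 + (l%:R^-1) ^+ 2) / 2 * (2 * m%:R) = m%:R + m%:R / l%:R ^+ 2 :> R.
  by field; rewrite pnatr_eq0 -lt0n.
rewrite /stretch -addnA natrD lerD2l ler_pdivrMr// -natrX -natrM ler_nat.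
have l20 : (0 < l ^ 2)%N by rewrite expn_gt0 l0.
by rewrite addn1 ltnW// ltn_ceil.
Qed.

Lemma stretch_le l m : (4 <= l)%N -> (l <= m)%N -> (m < stretch l m <= m.*2)%N.
Proof.
move=> l4 lm; rewrite /stretch addn1; apply/andP; split; first by rewrite ltnS leq_addr.
have : (m %/ l ^ 2 <= m %/ 2)%N by apply: leq_div2l => //; rewrite -mulnn; nia.
have := leq_divM m 2; set x := (m %/ l ^ 2)%N; lia.
Qed.

Section Links.
Context (h : nat).
Implicit Types (e : 'I_h * 'I_h) (g : seq nat) (c : link h).

Lemma size_links e s g : size (links e s g) = size g.
Proof. by elim: g s => //= m g IH s; rewrite IH. Qed.

Lemma gap_len_links e s g : [seq gap_len c | c <- links e s g] = g.
Proof. by elim: g s => //= m g IH s; rewrite IH /gap_len /= addKn. Qed.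

Lemma linksP e s g c : all (leq 1) g -> c \in links e s g ->
  [/\ c.1 = e, (c.2.1 < c.2.2)%N, c.2.2 \in visit_times s g
    & c.2.1 = s \/ exists2 d, d \in links e s g & c.2.1 = d.2.2].
Proof.
elim: g s => [//|m g IH] s /= /andP[m1 g1]; rewrite inE => /orP[/eqP ->/=|cg].
  by split=> //; [lia|rewrite mem_head|left].
have [-> c12 ct c1] := IH _ g1 cg; split=> //; first by rewrite inE ct orbT.
right; case: c1 => [->|[d dg ->]]; first by exists (e, (s, s + m)%N); rewrite ?mem_head.
by exists d => //; rewrite inE dg orbT.
Qed.

Lemma times_bounds (T b s : nat) g : all (fun m => T <= m < b)%N g ->
  {in visit_times s g, forall t, (s + T <= t <= s + size g * b.-1)%N}.
Proof.
elim: g s => [//|m g IH] s /= /andP[/andP[Tm mb] /IH{}IH] t.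
rewrite inE mulSn => /orP[/eqP ->|/IH]; last by lia.
have : (0 <= size g * b.-1)%N by []. lia.
Qed.

Lemma times_spaced (T s : nat) g : all (leq T) g ->
  {in visit_times s g &, forall t t', [\/ t = t', (t + T <= t')%N | (t' + T <= t)%N]}.
Proof.
have lb s' g' : all (leq T) g' -> {in visit_times s' g', forall t, (s' + T <= t)%N}.
  elim: g' s' => [//|m g' IH] s' /= /andP[Tm /IH{}IH] t.
  by rewrite inE => /orP[/eqP ->|/IH]; lia.
elim: g s => [//|m g IH] s /= /andP[Tm gT] t t'.
have {}lb := lb (s + m)%N g gT.
rewrite !inE => /orP[/eqP ->|tg] /orP[/eqP ->|tg'].
- by constructor 1.
- by constructor 2; exact: lb.
- by constructor 3; exact: lb.
- exact: (IH (s + m)%N gT t t' tg tg').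
Qed.

Lemma separated_far (T : nat) (f : visits h) :
  time_separated T f -> {in f &, forall x y, x != y ->
    {in visit_times 0 x.2 & visit_times 0 y.2, forall t t', (t + T <= t')%N \/ (t' + T <= t)%N}}.
Proof.
move=> sf x y xf yf xy t t' tx ty.
have farP g g' : times_far T g g' -> {in visit_times 0 g & visit_times 0 g', forall t t',
    (t + T <= t')%N \/ (t' + T <= t)%N}.
  by move=> /allP fg r r' rg rg'; apply/orP; have /allP := fg r rg; exact.
elim: f sf xf yf => [//|z f IH] /=; rewrite /time_separated /= => /andP[/allP zf sf].
rewrite !inE => /orP[/eqP xz|xf] /orP[/eqP yz|yf].
- by rewrite xz yz eqxx in xy.
- by rewrite xz in tx; exact: (farP _ _ (zf y yf)).
- by rewrite yz in ty; case: (farP _ _ (zf x xf) _ _ ty tx); [right|left].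
- exact: IH.
Qed.

(** Within one list the visit times are spaced by the gaps, and between two lists
    by the separation of the family. *)
Lemma spaced_constraints (N T a b k : nat) (es : seq ('I_h * 'I_h)) f :
  {in es, forall e, e.1 != e.2} -> (0 < T <= a)%N -> (k * b.-1 <= N)%N ->
  f \in families (gap_lists a b k) es -> time_separated T f ->
  spaced N T (constraints f).
Proof.
move=> es12 /andP[T0 Ta] kN ff sf; have [fes fG] := families_mem ff.
have gb x : x \in f -> all (fun m => T <= m < b)%N x.2.
  move=> xf; have := gap_lists_bounds (fG x xf); apply: sub_all => m.
  by move=> /andP[am ->]; rewrite (leq_trans Ta am).
have gT x : x \in f -> all (leq T) x.2.
  by move=> /gb; apply: sub_all => m /andP[].
have g1 x : x \in f -> all (leq 1) x.2.
  by move=> /gT; apply: sub_all => m; exact: leq_trans.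
have cP c : c \in constraints f -> exists2 x, x \in f & c \in links x.1 0 x.2.
  by move=> /flattenP[s /mapP[x xf ->] cs]; exists x.
split=> [c /cP[x xf cx]|c d /cP[x xf cx] /cP[y yf dy]].
  have [c1 c12 ct c0] := linksP (g1 x xf) cx.
  have /andP[Tc cN] := times_bounds (gb x xf) ct.
  split.
  - by rewrite c1; apply: es12; rewrite -fes map_f.
  - rewrite c12 (leq_trans cN)// add0n (leq_trans _ kN)// leq_mul2r.
    by rewrite (size_gap_lists (fG x xf)) orbT.
  - by rewrite add0n in Tc.
  case: c0 => [->|[d dx ->]]; [by left|right; exists d => //].
  by apply/flattenP; exists (links x.1 0 x.2) => //; apply: map_f.
have [_ _ ct _] := linksP (g1 x xf) cx; have [_ _ dt _] := linksP (g1 y yf) dy.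
have [xy|xy] := eqVneq x y.
  by rewrite -xy in dt; exact: times_spaced (gT x xf) _ _ ct dt.
by case: (separated_far sf xf yf xy ct dt) => ?; [constructor 2|constructor 3].
Qed.

Lemma prod_constraints (R : realType) (F : nat -> R) (f : visits h) :
  \prod_(c <- constraints f) F (gap_len c) = \prod_(x <- f) \prod_(m <- x.2) F m.
Proof.
rewrite /constraints big_flatten big_map; apply: eq_bigr => x _.
by rewrite -{2}(gap_len_links x.1 0 x.2) big_map.
Qed.

Lemma constraintsP (f : visits h) c : c \in constraints f ->
  exists2 x, x \in f & gap_len c \in x.2.
Proof.
move=> /flattenP[s /mapP[x xf ->] cs]; exists x => //.
by rewrite -(gap_len_links x.1 0 x.2) map_f.
Qed.

Lemma size_constraints (f : visits h) (k : nat) :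
  {in f, forall x, (size x.2 <= k)%N} -> (size (constraints f) <= size f * k)%N.
Proof.
elim: f => [//|x f IH] fk; rewrite /constraints /= size_cat size_links mulSn.
rewrite leq_add ?fk ?mem_head//; apply: IH => y yf; apply: fk.
by rewrite inE yf orbT.
Qed.

End Links.

Section CoordinateProbability.
Context (R : realType) (h N l b : nat) (es : seq ('I_h * 'I_h)).
Hypotheses (l16 : (16 <= l)%N) (N3 : (3 <= N)%N) (Nl : logN R N <= l%:R)
  (hl : (h < l)%N) (es_pairs : {in es, forall e, e.1 != e.2})
  (es_size : (size es <= l)%N) (lN : (l * b.-1 <= N)%N).

(* Stretched gaps reach 2 N, and the bound for cherries uses two more powers. *)
Let n := (2 * N).+2.
Let g : R := (1 + (l%:R^-1) ^+ 2) / 2.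
Let T := (l ^ 6)%N.
Let fam := families (gap_lists (l ^ 10) b l) es.

Definition gap_prod (f : visits h) : R :=
  \prod_(x <- f) \prod_(m <- x.2) return_prob R (stretch l m).

Let l0 : (0 < l)%N. Proof. exact: leq_trans l16. Qed.
Let g_ge0 : 0 <= g.
Proof. by rewrite divr_ge0// addr_ge0// exprn_ge0// invr_ge0. Qed.

Let gap_range f c : f \in fam -> c \in constraints f -> (l ^ 10 <= gap_len c < b)%N.
Proof.
move=> ff /constraintsP[x xf cx]; have [_ fG] := families_mem ff.
by have /allP := gap_lists_bounds (fG x xf); apply.
Qed.

Let gap_stretch m : (l ^ 10 <= m < b)%N ->
  [/\ (3 <= stretch l m <= m.*2)%N, (stretch l m <= 2 * N)%N & (m <= N)%N].
Proof.
move=> /andP[lm mb].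
have lm' : (l <= m)%N by apply: leq_trans lm; rewrite -[X in (X <= _)%N]expn1 leq_exp2l//; lia.
have l4 : (4 <= l)%N by lia.
have /andP[s1 s2] := stretch_le l4 lm'.
have mN : (m <= N)%N by apply: leq_trans lN; nia.
split=> //; [apply/andP; split=> //|]; lia.
Qed.

(** A crude polynomial bound: it is only compared with an error term that is
    smaller than every power of [N]. *)
Let return_prob_ge v : (v <= 2 * N)%N -> (N%:R ^+ 2)^-1 <= return_prob R v.
Proof.
move=> vN; rewrite -(@ler_pXn2r _ 2) ?nnegrE ?invr_ge0 ?exprn_ge0 ?(ltW (return_prob_gt0 _ _))//.
apply: le_trans (wallis_return_prob R v).
have N0 : 3 <= N%:R :> R by rewrite (ler_nat _ 3).
have v0 : v%:R <= 2 * N%:R :> R by rewrite -natrM ler_nat.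
have v1 : 0 <= v%:R :> R by [].
have p4 : pi <= 4 :> R by have := pihalf_lt2 R; lra.
have p0 := pi_gt0 R.
rewrite exprVn ler_pdivlMr; last by rewrite mulr_gt0//; lra.
rewrite mulrC ler_pdivrMr; last by rewrite !exprn_gt0//; lra.
apply: (@le_trans _ _ (4 * (4 * N%:R + 1))).
  by apply: ler_pM; lra.
have : N%:R ^+ 2 >= 9 :> R by nra.
set x : R := N%:R ^+ 2; move=> x9; have : 3 * N%:R <= x by rewrite /x; nra.
nra.
Qed.

Let gap_prod_ge f : f \in fam -> expR (- (2 * l%:R ^+ 3)) <= gap_prod f.
Proof.
move=> ff; have [fes fG] := families_mem ff.
rewrite /gap_prod -(prod_constraints (fun m => return_prob R (stretch l m))).
apply: (@le_trans _ _ ((N%:R ^+ 2)^-1 ^+ size (constraints f))); last first.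
  apply: (@le_trans _ _ (\prod_(c <- constraints f) (N%:R ^+ 2)^-1)).
    by rewrite big_const_seq count_predT -Monoid.iteropE.
  rewrite big_seq [leRHS]big_seq; apply: ler_prod => c cf.
  rewrite invr_ge0 exprn_ge0//=; apply: return_prob_ge.
  by have [] := gap_stretch (gap_range ff cf).
have N0 : 0 < N%:R :> R by rewrite ltr0n; exact: leq_trans N3.
have sz : (size (constraints f) <= l ^ 2)%N.
  apply: leq_trans (@size_constraints _ f l _) _ => [x xf|].
    exact: size_gap_lists (fG x xf).
  by rewrite -(size_map fst) fes expnS expn1 leq_mul2r es_size orbT.
have lnN0 : 0 <= logN R N by rewrite ln_ge0// ler1n; exact: leq_trans N3.
have -> : (N%:R ^+ 2)^-1 = expR (- (2 * logN R N)).
  by rewrite expRN expRM_natl lnK.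
rewrite -expRM_natl ler_expR mulrN lerN2.
have : (size (constraints f))%:R <= l%:R ^+ 2 :> R by rewrite -natrX ler_nat.
set s : R := _%:R => sl.
have -> : s * (2 * logN R N) = 2 * (s * logN R N) by ring.
by rewrite exprSr ler_wpM2l//; apply: ler_pM.
Qed.

(** With [T = l^6] and angles of order [1 / l] the error is exp (- l^4 / 4), while
    at most [l^2] gaps, each of probability at least [N^-2], give a main term of
    at least exp (- 2 l^3). *)
Let tail_small f : f \in fam ->
  2 * expR (- ((l%:R^-1) ^+ 2 * T%:R / 4)) <= l%:R^-1 * gap_prod f.
Proof.
move=> ff; have L16 : 16 <= l%:R :> R by rewrite (ler_nat _ 16).
apply: (@le_trans _ _ (l%:R^-1 * expR (- (2 * l%:R ^+ 3)))); last first.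
  by rewrite ler_wpM2l ?invr_ge0//; exact: gap_prod_ge.
rewrite [leRHS]mulrC ler_pdivlMr; last by lra.
have -> : (l%:R^-1) ^+ 2 * T%:R / 4 = l%:R ^+ 4 / 4 :> R.
  by rewrite /T natrX; field; lra.
have : 4 * l%:R ^+ 3 <= l%:R ^+ 4 / 4 :> R.
  have : 0 <= (l%:R - 16) * l%:R ^+ 3 :> R by rewrite mulr_ge0 ?exprn_ge0//; lra.
  by rewrite ler_pdivlMr// (exprS _ 3); lra.
move=> h4; apply: (@le_trans _ _ (2 * expR (- (4 * l%:R ^+ 3)) * l%:R)).
  by rewrite ler_wpM2r// ler_wpM2l// ler_expR lerN2.
have -> : - (4 * l%:R ^+ 3) = - (2 * l%:R ^+ 3) + - (2 * l%:R ^+ 3) :> R by ring.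
rewrite expRD [leLHS](_ : _ = expR (- (2 * l%:R ^+ 3)) * (expR (- (2 * l%:R ^+ 3)) * (2 * l%:R))); last by ring.
rewrite ler_piMr ?expR_ge0// expRN mulrC ler_pdivrMr ?expR_gt0// mul1r.
apply: le_trans (expR_ge1Dx _).
have : l%:R <= l%:R ^+ 3 :> R by rewrite ler_eXnr//; lra.
by lra.
Qed.

Let coord_prob_ge_avgs f : f \in fam -> time_separated T f ->
  avgs (@link_form R h N) n (damp g) (constraints f) (fun=> 0) - l%:R^-1 * gap_prod f
  <= coord_prob R N (constraints f).
Proof.
move=> ff sf; have L16 : 16 <= l%:R :> R by rewrite (ler_nat _ 16).
have spf : spaced N T (constraints f).
  apply: (@spaced_constraints _ N T (l ^ 10) b l es) => //.
  by rewrite expn_gt0 l0/= leq_exp2l//; exact: leq_trans l16.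
have Nn : (N < n.*2.+1)%N by rewrite /n; lia.
rewrite /coord_prob ler_pdivlMr ?exprn_gt0// mulrC.
apply: le_trans (paths_ge_avgs_damp spf Nn (s0 := l%:R^-1) _ _ _).
- by rewrite ler_wpM2l ?exprn_ge0// lerD2l lerN2; exact: tail_small.
- by rewrite invr_gt0; lra.
- by rewrite invf_le1; lra.
- by rewrite ltr_pdivrMr ?mul1r ?ltr_nat//; lra.
Qed.

Let constraint_ok f c : f \in fam -> time_separated T f -> c \in constraints f ->
  [/\ c.1.1 != c.1.2, (c.2.2 <= N)%N,
      g * (2 * (gap_len c)%:R) <= (stretch l (gap_len c))%:R
    & (stretch l (gap_len c) < n.*2.+1)%N].
Proof.
move=> ff sf cf.
have [|/(_ c cf)[c12 /andP[_ cN] _ _] _] := @spaced_constraints _ N T (l ^ 10) b l es f es_pairs _ lN ff sf.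
  by rewrite expn_gt0 l0/= leq_exp2l//; exact: leq_trans l16.
split=> //; first exact: stretch_ge.
by have [_ + _] := gap_stretch (gap_range ff cf); rewrite /n; lia.
Qed.

Lemma coord_prob_ge f : f \in fam -> time_separated T f ->
  (1 - l%:R^-1) * gap_prod f <= coord_prob R N (constraints f).
Proof.
move=> ff sf; apply: le_trans (coord_prob_ge_avgs ff sf).
rewrite mulrBl mul1r lerD2r /gap_prod -(prod_constraints (fun m => return_prob R (stretch l m))).
by apply: avgs_damp_ge_prod => // c cf; exact: (constraint_ok ff sf cf).
Qed.

(** The two links of the cherry are averaged together; all the other links are
    decoupled one by one. *)
Lemma coord_prob_cherry f : f \in fam -> time_separated T f -> cherry f ->
  (1 + 1 / 1024 - l%:R^-1) * gap_prod f <= coord_prob R N (constraints f).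
Proof.
move=> ff sf /hasP[x xf /hasP[y yf /and3P[/eqP xy1 xy2 clos]]].
apply: le_trans (coord_prob_ge_avgs ff sf).
rewrite mulrBl lerD2r /gap_prod -(prod_constraints (fun m => return_prob R (stretch l m))).
(* The default value of the head never occurs: both lists have one gap. *)
wlog : x y xf yf xy1 xy2 clos / (head 0 x.2 <= head 0 y.2)%N.
  move=> H; have [xy|/ltnW yx] := leqP (head 0 x.2) (head 0 y.2); first exact: (H x y).
  by apply: (H y x) => //; [rewrite eq_sym|rewrite comparableC].
have inc z : z \in f -> {subset links z.1 0 z.2 <= constraints f}.
  by move=> zf c cz; apply/flattenP; exists (links z.1 0 z.2) => //; exact: map_f.
have xin := inc x xf; have yin := inc y yf.
case: x {xf inc} xy1 xy2 clos xin => -[i j] /= [//|p [|//]] xy1.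
case: y {yf} yin xy1 => -[i' j'] /= [//|q [|//]] /= yin ei; subst i'.
move=> jj' /andP[pq qp] xin pleq; rewrite !add0n in xin yin.
set c : link h := (i, j, (0, p)%N) in xin; set d : link h := (i, j', (0, q)%N) in yin.
have cin : c \in constraints f by apply: xin; rewrite mem_head.
have din : d \in constraints f by apply: yin; rewrite mem_head.
have cd : d != c by apply: contraNneq jj' => -[-> _].
have din' : d \in rem c (constraints f).
  have := perm_mem (perm_to_rem cin) d; rewrite din inE (negPf cd) /= => <-.
  by [].
set rest := rem d (rem c (constraints f)).
have pcd : perm_eq (constraints f) (c :: d :: rest).
  by apply: perm_trans (perm_to_rem cin) _; rewrite perm_cons perm_to_rem.
rewrite (perm_big _ pcd) /= (avgs_perm _ _ _ pcd).
apply: le_trans (avgs_damp_cons2 _ _ _ _ _ g_ge0).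
rewrite !big_cons [X in _ * X <= _]mulrA mulrA.
have [cij cN gc vc] := constraint_ok ff sf cin.
have [dij dN gd vd] := constraint_ok ff sf din.
have [/andP[c3 c2] cs _] := gap_stretch (gap_range ff cin).
have [/andP[d3 d2] ds _] := gap_stretch (gap_range ff din).
rewrite /gap_len /= !subn0 in cij cN gc vc dij dN gd vd c3 c2 cs d3 d2 ds *.
apply: ler_pM.
- have pos : 0 <= 1 + 1 / 1024 :> R by lra.
  exact: mulr_ge0 pos (mulr_ge0 (ltW (return_prob_gt0 _ _)) (ltW (return_prob_gt0 _ _))).
- by apply: prodr_ge0 => z _; exact/ltW/return_prob_gt0.
- apply: avg_damp_cherry => //.
  + by rewrite pleq.
  + by have := sqr_ge0 (l%:R^-1 : R); rewrite /g; lra.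
  + by rewrite c3.
  + by rewrite d3.
  + by move: cs; clear; rewrite /n; move: (stretch l p) => s; lia.
  + by move: ds; clear; rewrite /n; move: (stretch l q) => s; lia.
apply: avgs_damp_ge_prod => // z zr; apply: constraint_ok ff sf _.
by rewrite (perm_mem pcd) !inE zr !orbT.
Qed.

End CoordinateProbability.

(** * Harmonic sums, logarithms and geometric series *)

Lemma return_prob_sqr_le (R : realType) m : return_prob R m ^+ 2 <= (2 * m%:R + 1)^-1.
Proof.
elim: m => [|m IH]; first by rewrite /return_prob bin0 divr1 expr1n mulr0 add0r invr1.
have m0 : 0 <= m%:R :> R by [].
rewrite return_probS exprMn -natr1.
apply: (@le_trans _ _ ((2 * m%:R + 1)^-1 * ((2 * m%:R + 1) / (2 * m%:R + 2)) ^+ 2)).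
  by rewrite ler_wpM2r// sqr_ge0.
rewrite -[leRHS]mul1r ler_pdivlMr; last by lra.
rewrite [leLHS](_ : _ = ((2 * m%:R + 1) * (2 * m%:R + 3)) / (2 * m%:R + 2) ^+ 2).
  by rewrite ler_pdivrMr; [nra|rewrite exprn_gt0//; lra].
by field; apply/andP; split; apply: lt0r_neq0; lra.
Qed.

Lemma sum_inv_ge (R : realType) (a b : nat) : (0 < a)%N -> (a <= b)%N ->
  ln (b%:R : R) - ln a%:R <= \sum_(a <= m < b) m%:R^-1.
Proof.
move=> a0; elim: b => [|b IH]; first by rewrite leqn0 => /eqP ->; rewrite subrr big_geq.
rewrite leq_eqVlt => /orP[/eqP <-|ab]; first by rewrite subrr big_geq.
have b0 : 0 < b%:R :> R by rewrite ltr0n; lia.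
rewrite big_nat_recr//=; apply: le_trans (lerD (IH ab) (lexx _)).
have -> : b.+1%:R = b%:R * (1 + b%:R^-1) :> R by rewrite mulrDr mulr1 mulfV ?lt0r_neq0// natr1.
have v0 : 0 < b%:R^-1 :> R by rewrite invr_gt0.
rewrite lnM ?posrE//.
have : ln (1 + b%:R^-1) <= b%:R^-1 :> R by apply: le_ln1Dx; lra.
by lra.
Qed.

Lemma sum_inv_le (R : realType) (a b : nat) : (1 < a)%N -> (0 < b)%N ->
  \sum_(a <= m < b.+1) m%:R^-1 <= ln (b%:R : R).
Proof.
move=> a1; elim: b => [//|b IH] _.
have [ba|ab] := leqP b.+2 a; first by rewrite big_geq// ln_ge0// ler1n.
have b00 : (0 < b)%N by lia.
have b0 : 0 < b%:R :> R by rewrite ltr0n.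
rewrite big_nat_recr//=; apply: le_trans (lerD (IH b00) (lexx _)) _.
have b1 : 0 < b.+1%:R :> R by [].
have : ln (b%:R / b.+1%:R) <= - b.+1%:R^-1 :> R.
  have -> : b%:R / b.+1%:R = 1 + - b.+1%:R^-1 :> R.
    by rewrite -natr1; field; rewrite natr1.
  by apply: le_ln1Dx; rewrite ltrN2 invf_lt1// ltr1n.
by rewrite ln_div ?posrE//; move: (b.+1%:R^-1 : R) => x hl; lra.
Qed.

Lemma expR_le_1B (R : realType) (x : R) : 0 <= x <= 1 / 2 -> expR (- (2 * x)) <= 1 - x.
Proof.
move=> /andP[x0 x1]; rewrite expRN invf_ple ?posrE ?expR_gt0//; last by lra.
apply: le_trans (expR_ge1Dx _); rewrite -[_^-1]mul1r ler_pdivrMr; nra.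
Qed.

Lemma ln_le_2sqrt (R : realType) (x : R) : 0 < x -> ln x <= 2 * Num.sqrt x.
Proof.
move=> x0; have s0 : 0 < Num.sqrt x by rewrite sqrtr_gt0.
rewrite -{1}(sqr_sqrtr (ltW x0)) lnXn// mulr2n.
by have := ln_sublinear s0; lra.
Qed.

(** The loss [y] in the ratio and the truncation after [k] terms each cost a
    relative error of their own order, since the ratio is at most 1 / 2. *)
Lemma geometric_ge (R : realType) (be y s : R) (k : nat) :
  (0 < k)%N -> 0 <= be <= 1 / 2 -> 0 <= y <= 1 -> be * (1 - y) <= s ->
  (1 - y - k%:R^-1) / (1 - be) <= \sum_(i < k.+1) s ^+ i.
Proof.
move=> k0 /andP[be0 be1] /andP[y0 y1] hs; set r := be * (1 - y) in hs *.
have r0 : 0 <= r by rewrite mulr_ge0// subr_ge0.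
have r1 : r <= 1 / 2 by rewrite /r; nra.
apply: (@le_trans _ _ (\sum_(i < k.+1) r ^+ i)); last first.
  by apply: ler_sum => i _; rewrite lerXn2r ?nnegrE ?(le_trans r0).
have geo : (1 - r) * \sum_(i < k.+1) r ^+ i = 1 - r ^+ k.+1.
  by have := subrX1 r k.+1; set S := \sum_(i < _) _ => hS; lra.
have small : r ^+ k.+1 <= k%:R^-1.
  apply: (@le_trans _ _ ((1 / 2) ^+ k.+1)); first by rewrite lerXn2r ?nnegrE.
  rewrite div1r exprVn lef_pV2 ?posrE ?exprn_gt0 ?ltr0n// -natrX ler_nat.
  by apply: leq_trans (ltnW (ltn_expl k.+1 (isT : 1 < 2)%N)).
have q0 : 0 <= k%:R^-1 :> R by rewrite invr_ge0.
set S := \sum_(i < k.+1) _ in geo *; set q := k%:R^-1 in small q0 *.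
set t := r ^+ k.+1 in geo small.
have r1' : 0 < 1 - r by lra.
rewrite ler_pdivrMr; last by lra.
rewrite -(ler_pM2l r1') [leRHS]mulrA geo.
have hr : r = be - be * y by rewrite /r; ring.
have h1 : (1 - q) * (1 - be) <= (1 - t) * (1 - be) by rewrite ler_wpM2r; lra.
apply: le_trans h1; rewrite hr.
have by0 : 0 <= be * y by rewrite mulr_ge0.
have h2 : be * y <= (1 - be) * y by rewrite ler_wpM2r//; lra.
have h3 : 0 <= be * y * (y + q) by rewrite mulr_ge0// addr_ge0.
rewrite -subr_ge0 (_ : _ - _ = ((1 - be) * y - be * y) + be * y * (y + q)); last by ring.
by rewrite addr_ge0// subr_ge0.
Qed.

(** * Lower bounds for the moment *)

Lemma size_enum_range (h p q : nat) : (q <= h)%N ->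
  size [seq i : 'I_h <- enum 'I_h | (p <= i < q)%N] = (q - p)%N.
Proof.
move=> qh; rewrite -(card_ord_range p qh) cardE enumT.
by congr size; apply: eq_filter => i; rewrite inE.
Qed.

Lemma nil_gap_lists a b k : [::] \in gap_lists a b k.
Proof. by case: k => [|k]; rewrite /= mem_head. Qed.

Section MomentBound.
Context (R : realType) (N h : nat) (beta : 'I_h * 'I_h -> R).
Let L : R := logN R N.
Hypotheses (N3 : (3 <= N)%N) (L_ge : 100 ^+ 2 <= L) (h_gt0 : (0 < h)%N)
  (hL : h%:R ^+ 2 <= L) (beta_range : forall e, e \in Pairs h -> 0 <= beta e <= 1 / 288).

Let l := (Num.truncn L).+1.
(** At most [l] gaps of length at most [N / l] fit before time [N].  The lower
    cutoff [l^10] makes a visit near a prescribed time rarer than [l^-9], so that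
    the windows of width [l^6] around all the other visits remain negligible. *)
Let a := (l ^ 10)%N.
Let b := (N %/ l).+1.
(** The relative loss allowed for one pair. *)
Let eta : R := ln L / L.
Let lam (e : 'I_h * 'I_h) : R := if e \in Pairs h then pi * beta e / L else 0.
(** The weight of a gap is the square of a return probability because both diagonal
    coordinates have to return. *)
Let w e m : R := lam e * return_prob R (stretch l m) ^+ 2.
Let es0 := enum (Pairs h).

Let L0 : 0 < L. Proof. by apply: lt_le_trans L_ge; rewrite exprn_gt0. Qed.
Let L1 : 10000 <= L. Proof. by apply: le_trans L_ge; lra. Qed.
Let Ll : L < l%:R. Proof. exact: truncnS_gt. Qed.
Let lL : l%:R <= L + 1.
Proof. by rewrite /l -natr1 lerD2r truncn_le ltW. Qed.

Let l16 : (16 <= l)%N.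
Proof. by rewrite -(ler_nat R); apply: le_trans (ltW Ll); have := L1; lra. Qed.

Let hl : (h < l)%N.
Proof.
rewrite -(ltr_nat R); apply: le_lt_trans Ll; apply: le_trans hL.
by rewrite ler_eXnr// ler1n.
Qed.

Let size_es0 : (size es0 <= h ^ 2)%N.
Proof. by rewrite -cardE -mulnn (leq_trans (max_card _))// card_prod !card_ord. Qed.

Let hl2 : (h ^ 2 <= l)%N.
Proof. by rewrite -(ler_nat R) natrX (le_trans hL) ?ltW. Qed.

Let lam_ge0 e : 0 <= lam e.
Proof.
rewrite /lam; case: ifP => // /beta_range/andP[b0 _].
by rewrite divr_ge0 ?mulr_ge0 ?pi_ge0// ltW.
Qed.

Let lam_le e : lam e <= 1 / (2 * L).
Proof.
rewrite /lam; case: ifP => [/beta_range/andP[b0 b1]|_]; last by rewrite divr_ge0// mulr_ge0// ltW.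
have p4 : pi <= 4 :> R by have := pihalf_lt2 R; lra.
have p0 := pi_gt0 R.
have : pi * beta e <= 1 / 2 by nra.
move=> h1; rewrite ler_pdivrMr//; apply: le_trans h1 _.
by rewrite le_eqVlt; apply/orP; left; apply/eqP; field; rewrite lt0r_neq0.
Qed.

Let w_ge0 e m : 0 <= w e m.
Proof. by rewrite mulr_ge0 ?lam_ge0 ?sqr_ge0. Qed.

Let stretch_gt m : (m < stretch l m)%N.
Proof. by rewrite /stretch addn1 ltnS leq_addr. Qed.

Let w_le e m : (0 < m)%N -> w e m <= (2 * L)^-1 * m%:R^-1.
Proof.
move=> m0; have mR : 0 < m%:R :> R by rewrite ltr0n.
apply: ler_pM; rewrite ?lam_ge0 ?sqr_ge0//; first by rewrite -div1r lam_le.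
apply: le_trans (return_prob_sqr_le _ _) _; rewrite lef_pV2 ?posrE//.
have : m%:R <= (stretch l m)%:R :> R by rewrite ler_nat ltnW.
lra.
Qed.

Let a_gt1 : (1 < a)%N.
Proof. by rewrite -[X in (X < _)%N](expn0 l) ltn_exp2l// (leq_trans _ l16). Qed.

Let gap_sum_le e : gap_sum w a b e <= 1 / 2.
Proof.
apply: (@le_trans _ _ (\sum_(a <= m < b) (2 * L)^-1 * m%:R^-1)).
  rewrite /gap_sum big_nat [leRHS]big_nat; apply: ler_sum => m /andP[am _].
  by apply: w_le; exact: leq_trans (ltnW a_gt1) am.
rewrite -mulr_sumr.
have sL : \sum_(a <= m < b) m%:R^-1 <= L :> R.
  have [q0|q0] := posnP (N %/ l)%N; first by rewrite /b q0 big_geq ?(ltW L0)// ltnW.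
  apply: le_trans (sum_inv_le R a_gt1 q0) _.
  rewrite /L /logN ler_ln ?posrE ?ltr0n//; last by exact: leq_trans N3.
  by rewrite ler_nat leq_div.
rewrite mulrC ler_pdivrMr; last by rewrite mulr_gt0.
by apply: le_trans sL _; rewrite le_eqVlt; apply/orP; left; apply/eqP; field.
Qed.

Let w_small e m : (a <= m < b)%N -> w e m <= a%:R^-1.
Proof.
move=> /andP[am _]; have m0 : (0 < m)%N by apply: leq_trans (ltnW a_gt1) am.
apply: le_trans (w_le _ m0) _.
have mR : 0 < m%:R :> R by rewrite ltr0n.
have aR : 0 < a%:R :> R by rewrite ltr0n ltnW.
apply: (@le_trans _ _ (m%:R^-1)).
  by rewrite ler_piMl ?invr_ge0// invf_le1 ?mulr_gt0//; have := L1; lra.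
by rewrite lef_pV2 ?posrE// ler_nat.
Qed.

(** A window of [2 * l^6] times around each of [l] visits, each hit with weight at
    most [4 * l^-10], and at most [l^2] couples of pairs. *)
Let bad_mass es : perm_eq es es0 ->
  \sum_(f <- families (gap_lists a b l) es) fweight w f * (~~ time_separated (l ^ 6) f)%:R
  <= 8 / l%:R * \prod_(e <- es) pair_partition w a b l e.
Proof.
move=> pes; have aR : 0 < a%:R :> R by rewrite ltr0n ltnW.
apply: le_trans (@fweight_not_separated _ _ w a b l w_ge0 (l ^ 6) es (8 / l%:R ^+ 3) _ _) _.
- by rewrite divr_ge0// exprn_ge0.
- move=> e _ g' g'l.
  apply: le_trans (@weight_not_far _ _ w a b l w_ge0 (l ^ 6) e a%:R^-1 g' _ (gap_sum_le e) _) _.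
  + by rewrite invr_ge0.
  + exact: w_small.
  apply: (@le_trans _ _ ((l * l ^ 6)%:R * (8 / a%:R))).
    by rewrite ler_wpM2r ?divr_ge0// ler_nat leq_mul2r g'l orbT.
  rewrite /a natrM !natrX le_eqVlt; apply/orP; left; apply/eqP; field.
  by rewrite lt0r_neq0.
rewrite ler_wpM2r ?prod_pair_partition_ge0//.
have -> : 8 / l%:R = l%:R ^+ 2 * (8 / l%:R ^+ 3) :> R by field; rewrite lt0r_neq0.
rewrite ler_wpM2r ?divr_ge0 ?exprn_ge0// -natrX ler_nat leq_exp2r//.
by rewrite (perm_size pes) (leq_trans size_es0).
Qed.

Let fweightE f : {in f, forall x, x.1 \in Pairs h} ->
  fweight w f = (\prod_(x <- f) (pi * beta x.1 / logN R N) ^+ size x.2)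
                * gap_prod R l f ^+ 2.
Proof.
move=> fP; rewrite /fweight /gap_prod -prodrXl -big_split /= big_seq [RHS]big_seq.
apply: eq_bigr => x xf; rewrite /weight /w big_split /= big_const_seq count_predT.
by rewrite -Monoid.iteropE -prodrXl /lam fP.
Qed.

Let moment_ge_weights es : perm_eq es es0 ->
  (1 - l%:R^-1) ^+ 2 * \sum_(f <- families (gap_lists a b l) es)
    fweight w f * ((time_separated (l ^ 6) f)%:R * (1 + 1 / 1024 * (cherry f)%:R))
  <= moment N beta.
Proof.
move=> pes.
have lN : (l * b.-1 <= N)%N by rewrite /b /= mulnC leq_divM.
have esP : {subset es <= Pairs h} by move=> e; rewrite (perm_mem pes) mem_enum.
have es12 : {in es, forall e, e.1 != e.2}.
  by move=> e /esP; rewrite inE; apply: contraTneq => ->; rewrite ltnn.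
have szes : (size es <= l)%N by rewrite (perm_size pes) (leq_trans size_es0).
have v1 : l%:R^-1 <= 1 :> R by rewrite invf_le1// ler1n.
have v0 : 0 < l%:R^-1 :> R by rewrite invr_gt0.
apply: le_trans (@moment_ge_families R h N a b l beta es pes _ _ _ lN).
- rewrite mulr_sumr big_seq [leRHS]big_seq; apply: ler_sum => f ff.
  have [fes _] := families_mem ff.
  have fP : {in f, forall x, x.1 \in Pairs h}.
    by move=> x xf; apply: esP; rewrite -fes map_f.
  have l0 : 0 <= \prod_(x <- f) (pi * beta x.1 / logN R N) ^+ size x.2.
    rewrite big_seq; apply: prodr_ge0 => x xf; rewrite exprn_ge0//.
    by have := lam_ge0 x.1; rewrite /lam fP.
  rewrite fweightE// mulrCA -[leLHS]mulrA ler_wpM2l//.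
  have [sf|_] := boolP (time_separated _ f); last by rewrite mul0r !mulr0 sqr_ge0.
  have p0 : 0 <= gap_prod R l f.
    apply: prodr_ge0 => x _; apply: prodr_ge0 => m _; exact/ltW/return_prob_gt0.
  rewrite [leLHS]mulrC.
  have [cf|_] := boolP (cherry f); last first.
    rewrite [X in X * _](_ : _ = (1 - l%:R^-1) ^+ 2); last by rewrite /=; ring.
    have H := coord_prob_ge l16 N3 (ltW Ll) hl es12 szes lN ff sf.
    have H0 : 0 <= (1 - l%:R^-1) * gap_prod R l f by rewrite mulr_ge0// subr_ge0.
    by rewrite -exprMn lerXn2r ?nnegrE ?(le_trans H0 H).
  have H := coord_prob_cherry l16 N3 (ltW Ll) hl es12 szes lN ff sf cf.
  apply: (@le_trans _ _ (((1 + 1 / 1024 - l%:R^-1) * gap_prod R l f) ^+ 2)).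
    rewrite exprMn ler_wpM2r ?sqr_ge0//= mul1r mulr1.
    set x := l%:R^-1 in v0 v1 *; nra.
  have pos : 0 <= 1 + 1 / 1024 - l%:R^-1 :> R.
    by move: (l%:R^-1 : R) v1 => x x1; lra.
  have H0 := mulr_ge0 pos p0.
  by rewrite lerXn2r ?nnegrE ?(le_trans H0 H).
- by move=> e /beta_range/andP[].
- exact: leq_trans N3.
- exact: ltnW a_gt1.
Qed.

Let lnL_ge1 : 1 <= ln L.
Proof.
have e2 : expR (1 / 2) <= 2 :> R.
  have := expR_ge1Dx (- (1 / 2) : R); have := expRxMexpNx_1 (1 / 2 : R).
  by have := expR_gt0 (1 / 2 : R); nra.
rewrite -[leLHS]expRK ler_ln ?posrE ?expR_gt0//.
have -> : 1 = 1 / 2 + 1 / 2 :> R by field.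
rewrite expRD; have e0 := expR_gt0 (1 / 2 : R); have := L1; nra.
Qed.

Let eta_small : eta <= 1 / 50.
Proof.
rewrite /eta ler_pdivrMr//; apply: le_trans (ln_le_2sqrt L0) _.
have s100 : 100 <= Num.sqrt L.
  by rewrite -(ger0_norm (ler0n R 100)) -sqrtr_sqr ler_wsqrtr.
rewrite -{2}(sqr_sqrtr (ltW L0)); nra.
Qed.

Let eta_gt0 : 0 < eta.
Proof. by rewrite divr_gt0// (lt_le_trans ltr01). Qed.

Let invl_le : l%:R^-1 <= eta.
Proof.
apply: (@le_trans _ _ L^-1); first by rewrite lef_pV2 ?posrE// ltW.
by rewrite -[leLHS]mul1r ler_wpM2r// invr_ge0 ltW.
Qed.

Let lnl_le : ln l%:R <= 2 * ln L.
Proof.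
rewrite mulr_natl -lnXn// ler_ln ?posrE ?exprn_gt0//.
by apply: le_trans lL _; have := L1; nra.
Qed.

(** Wallis' inequality: the factors pi cancel and the weight is [beta e / L] times
    [1 / m], up to the stretching of the gap. *)
Let w_ge e m : e \in Pairs h -> (a <= m)%N ->
  beta e / L * (1 - 2 / l%:R ^+ 2) * m%:R^-1 <= w e m.
Proof.
move=> eP am; have /andP[b0 b1] := beta_range eP.
have m0 : (0 < m)%N by apply: leq_trans (ltnW a_gt1) am.
have mR : 0 < m%:R :> R by rewrite ltr0n.
rewrite /w /lam eP.
apply: (@le_trans _ _ (pi * beta e / L * (2 / (pi * (2 * (stretch l m)%:R + 1))))); last first.
  by rewrite ler_wpM2l ?wallis_return_prob// divr_ge0 ?mulr_ge0 ?pi_ge0// ltW.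
have p0 := pi_gt0 R; set s := (stretch l m)%:R.
have s0 : 0 <= s :> R by [].
have -> : pi * beta e / L * (2 / (pi * (2 * s + 1))) = beta e / L * (2 / (2 * s + 1)).
  by field; rewrite !lt0r_neq0//; lra.
rewrite -mulrA ler_wpM2l ?divr_ge0 ?(ltW L0)//.
have l20 : 0 < l%:R ^+ 2 :> R by rewrite exprn_gt0.
pose v : R := (l%:R ^+ 2)^-1.
have v0 : 0 < v by rewrite invr_gt0.
have sle : s <= m%:R * (1 + v) + 1.
  rewrite /s /stretch !natrD lerD2r mulrDr mulr1 lerD2l /v ler_pdivlMr//.
  by rewrite -natrX -natrM ler_nat leq_divM.
have mv : 2 <= m%:R * v.
  rewrite /v ler_pdivlMr//; apply: (@le_trans _ _ (l%:R ^+ 3)).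
    by rewrite (exprS _ 2) ler_wpM2r ?exprn_ge0// (ler_nat _ 2) (leq_trans _ l16).
  rewrite -natrX ler_nat (leq_trans _ am)// /a leq_exp2l// (leq_trans _ l16)//.
rewrite -/v ler_pdivlMr; last by lra.
rewrite mulrAC ler_pdivrMr//.
have h1 : 2 * s + 1 <= 2 * m%:R * (1 + 2 * v) by lra.
have [v2|v2] := leP (1 - 2 * v) 0.
  by apply: (@le_trans _ _ 0); [rewrite mulr_le0_ge0//; lra|lra].
apply: le_trans (ler_wpM2l (ltW v2) h1) _.
rewrite -subr_ge0 (_ : _ - _ = 8 * m%:R * v ^+ 2); last by ring.
by rewrite mulr_ge0 ?sqr_ge0// mulr_ge0.
Qed.

(** The cutoffs shorten the harmonic sum by [11 * ln l <= 22 * ln L]; the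
    stretching of the gaps accounts for the last unit of 23. *)
Let gap_sum_ge e : e \in Pairs h -> beta e * (1 - 23 * eta) <= gap_sum w a b e.
Proof.
move=> eP; have /andP[b0 b1] := beta_range eP.
have aR : 0 < a%:R :> R by rewrite ltr0n ltnW.
have NR : 0 < N%:R :> R by rewrite ltr0n (leq_trans _ N3).
have l20 : 0 < l%:R ^+ 2 :> R by rewrite exprn_gt0.
have lna : ln a%:R = 10 * ln l%:R :> R by rewrite /a natrX lnXn// mulr_natl.
have lnb : L - ln l%:R <= ln b%:R.
  rewrite lerBlDr -lnM ?posrE// /L /logN ler_ln ?posrE ?mulr_gt0// -natrM ler_nat.
  by rewrite ltnW// /b ltn_ceil.
have sum_ge : L - 11 * ln l%:R <= \sum_(a <= m < b) m%:R^-1.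
  have [ab|/ltnW ba] := leqP a b.
    by apply: le_trans (sum_inv_ge R (ltnW a_gt1) ab); lra.
  rewrite big_geq//; have : ln b%:R <= ln a%:R :> R by rewrite ler_ln ?posrE// ler_nat.
  by lra.
apply: (@le_trans _ _ (beta e / L * (1 - 2 / l%:R ^+ 2) * \sum_(a <= m < b) m%:R^-1)); last first.
  rewrite mulr_sumr /gap_sum big_nat [leRHS]big_nat; apply: ler_sum => m /andP[am _].
  exact: w_ge.
set S := \sum_(_ <= _ < _) _ in sum_ge *.
have q1 : 2 / l%:R ^+ 2 <= eta.
  apply: le_trans invl_le; rewrite ler_pdivrMr// expr2 mulrA mulVf ?lt0r_neq0// mul1r.
  by rewrite (ler_nat _ 2) (leq_trans _ l16).
have q0 : 0 <= 2 / l%:R ^+ 2 :> R by rewrite divr_ge0 ?ltW.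
set q := 2 / _ in q1 q0 *.
have SL : 1 - 22 * eta <= S / L.
  rewrite ler_pdivlMr// mulrBl mul1r -mulrA /eta divfK ?lt0r_neq0//.
  by apply: le_trans sum_ge; have := lnl_le; lra.
rewrite (_ : beta e / L * (1 - q) * S = beta e * ((1 - q) * (S / L))); last by ring.
rewrite ler_wpM2l//.
have e50 := eta_small; have e0 := eta_gt0.
have q2 : 0 <= 1 - q by lra.
apply: le_trans (ler_wpM2l q2 SL); nra.
Qed.

Let part_ge e : e \in Pairs h ->
  1 / (1 - beta e) * expR (- (48 * eta)) <= pair_partition w a b l e.
Proof.
move=> eP; have /andP[b0 b1] := beta_range eP.
have e50 := eta_small; have e0 := eta_gt0.
rewrite /pair_partition sum_weight_geometric.
apply: le_trans (@geometric_ge R (beta e) (23 * eta) _ l _ _ _ (gap_sum_ge eP)) => //; last 2 first.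
- by apply/andP; split; lra.
- by apply/andP; split; lra.
rewrite mulrC mulrA mulr1 ler_wpM2r ?invr_ge0 //; first by lra.
apply: (@le_trans _ _ (1 - 24 * eta)); last by have := invl_le; lra.
rewrite (_ : 48 * eta = 2 * (24 * eta)); last by ring.
by apply: expR_le_1B; apply/andP; split; lra.
Qed.

Let prod_part_ge es : perm_eq es es0 ->
  (\prod_(e in Pairs h) (1 / (1 - beta e))) * expR (- (48 * (h%:R ^+ 2 * eta)))
  <= \prod_(e <- es) pair_partition w a b l e.
Proof.
move=> pes; rewrite -big_enum (perm_big _ pes) /= -/es0.
apply: (@le_trans _ _ (\prod_(e <- es0) (1 / (1 - beta e) * expR (- (48 * eta))))).
  rewrite [leRHS]big_split /= ler_wpM2l//.
    rewrite big_seq; apply: prodr_ge0 => e; rewrite mem_enum => /beta_range/andP[_ b1].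
    by rewrite divr_ge0//; lra.
  rewrite big_const_seq count_predT iter_mulr_1 -expRM_natl ler_expR.
  rewrite mulrN lerN2 [leLHS]mulrCA ler_wpM2l// ler_wpM2r ?(ltW eta_gt0)//.
  by rewrite -natrX ler_nat.
rewrite big_seq [leRHS]big_seq; apply: ler_prod => e; rewrite mem_enum => eP.
rewrite part_ge// andbT mulr_ge0 ?expR_ge0//.
by have /andP[_ b1] := beta_range eP; rewrite divr_ge0//; lra.
Qed.

Let h2_ge1 : 1 <= h%:R ^+ 2 :> R.
Proof. by rewrite expr_ge1// ler1n. Qed.

Let loss_ge (k : R) : 0 <= k <= 32 ->
  expR (- (2 * (k + 2) * (h%:R ^+ 2 * eta)))
  <= (1 - l%:R^-1) ^+ 2 * (1 - k * l%:R^-1).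
Proof.
move=> /andP[k0 k32]; have v0 : 0 < l%:R^-1 :> R by rewrite invr_gt0.
have v1 : l%:R^-1 <= 1 / 100 :> R.
  by rewrite -[leRHS]invrK lef_pV2 ?posrE//; have := ltW Ll; have := L1; rewrite div1r invrK; lra.
have veta : l%:R^-1 <= h%:R ^+ 2 * eta.
  by apply: le_trans invl_le _; rewrite ler_peMl// ltW.
move: (l%:R^-1 : R) v0 v1 veta => v v0 v1 veta.
apply: (@le_trans _ _ (expR (- (2 * v)) ^+ 2 * expR (- (2 * (k * v))))).
  rewrite -expRM_natl -expRD ler_expR.
  rewrite [leRHS](_ : _ = - (2 * (k + 2) * v)); last by ring.
  by rewrite lerN2 ler_wpM2l//; lra.
have kv : k * v <= 1 / 2 by nra.
apply: ler_pM; rewrite ?exprn_ge0 ?expR_ge0//.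
  rewrite lerXn2r ?nnegrE ?expR_ge0//; first by lra.
  by apply: expR_le_1B; apply/andP; split; lra.
by apply: expR_le_1B; rewrite mulr_ge0// ltW.
Qed.

Let prod_box_ge0 : 0 <= \prod_(e in Pairs h) (1 / (1 - beta e)).
Proof.
by apply: prodr_ge0 => e /beta_range/andP[_ b1]; rewrite divr_ge0//; lra.
Qed.

(** The constant 68 is 48 for the partition functions of the pairs plus 20 for the
    error terms of order [1 / l]. *)
Lemma moment_ge_prod :
  (\prod_(e in Pairs h) (1 / (1 - beta e))) * expR (- (68 * (h%:R ^+ 2 * eta)))
  <= moment N beta.
Proof.
have pes : perm_eq es0 es0 by [].
apply: le_trans (moment_ge_weights pes).
set P := \prod_(e <- es0) pair_partition w a b l e.
have P0 : 0 <= P by exact: prod_pair_partition_ge0.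
have Sge : (1 - 8 * l%:R^-1) * P <= \sum_(f <- families (gap_lists a b l) es0)
    fweight w f * ((time_separated (l ^ 6) f)%:R * (1 + 1 / 1024 * (cherry f)%:R)).
  apply: (@le_trans _ _ (P - \sum_(f <- families (gap_lists a b l) es0)
     fweight w f * (~~ time_separated (l ^ 6) f)%:R)).
    by rewrite mulrBl mul1r lerD2l lerN2; exact: bad_mass.
  rewrite /P -sum_fweight -sumrB; apply: ler_sum => f _.
  rewrite -[X in X - _]mulr1 -mulrBr ler_wpM2l ?fweight_ge0//.
  by case: time_separated; case: cherry => /=; lra.
apply: le_trans (ler_wpM2l (sqr_ge0 _) Sge).
have k8 : 0 <= (8 : R) <= 32 by apply/andP; split; lra.
rewrite [leRHS]mulrA; apply: le_trans (ler_pM _ _ (loss_ge k8) (prod_part_ge pes)).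
- by rewrite [leRHS]mulrCA -expRD le_eqVlt; apply/orP; left; apply/eqP; congr (_ * expR _); ring.
- exact: expR_ge0.
- by rewrite mulr_ge0 ?expR_ge0.
Qed.

Let ln2_ge : 1 / 2 <= ln (2 : R).
Proof.
rewrite -[leLHS]expRK ler_ln ?posrE ?expR_gt0//.
have := expR_ge1Dx (- (1 / 2) : R); have := expRxMexpNx_1 (1 / 2 : R).
by have := expR_gt0 (1 / 2 : R); nra.
Qed.

Let ln2_le : ln (2 : R) <= 1.
Proof. by have := @le_ln1Dx R 1; rewrite (_ : 1 + 1 = 2 :> R)//; apply; lra. Qed.

Section Cherries.
Variable bmin : R.
Hypotheses (bmin_gt0 : 0 < bmin) (bmin_le : forall e, e \in Pairs h -> bmin <= beta e)
  (L_ge200 : 200 ^+ 2 <= L).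

Let m := (h %/ 3)%N.
Let range (p q : nat) := [seq i : 'I_h <- enum 'I_h | (p <= i < q)%N].
(** The centres of the stars are in the first third of the walks and their leaves
    in the other two, so that the centre comes first in every pair. *)
Let I := range 0 m.
Let J1 := range m (2 * m).
Let J2 := range (2 * m) (3 * m).
(** Lower bound for the relative weight of a single visit at a given scale: a
    dyadic block of the harmonic sum, divided by a partition function at most 2. *)
Let al : R := bmin / (8 * L).
Let B := index_iota (up_log 2 a) (trunc_log 2 b).
Let stars := flatten [seq star i (J1 ++ J2) | i <- I].

Let m3 : (3 * m <= h)%N. Proof. by rewrite /m mulnC leq_divM. Qed.

Let starsP e : e \in stars -> e \in Pairs h.
Proof.
rewrite /stars => /allpairsP[[i j] [/= iI jJ ->]]; rewrite inE /=.
move: iI jJ; rewrite mem_cat !mem_filter => /andP[/andP[_ im] _].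
move=> /orP[/andP[/andP[mj _] _]|/andP[/andP[mj _] _]]; apply: leq_trans im _ => //.
by apply: leq_trans mj; rewrite leq_pmull.
Qed.

Let range_uniq p q : uniq (range p q).
Proof. exact: filter_uniq (enum_uniq _). Qed.

Let stars_uniq : uniq stars.
Proof.
rewrite /stars; apply: allpairs_uniq; first exact: range_uniq.
- rewrite cat_uniq !range_uniq andbT /=; apply/hasPn => j.
  rewrite !mem_filter => /andP[/andP[j1 _] _].
  by rewrite negb_and [(j < _)%N]ltnNge j1 andbF.
- by move=> [i j] [i' j'] _ _ /= [-> ->].
Qed.

Let al_gt0 : 0 < al.
Proof. by rewrite divr_gt0// mulr_gt0. Qed.

Let bin_weight_ge e : e \in stars ->
  {in B, forall c, al * pair_partition w a b l e <= bin_weight w a b l e c}.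
Proof.
move=> /starsP eP c; rewrite mem_index_iota => /andP[ac cb].
have ac' : (a <= 2 ^ c)%N.
  by have /andP[_ h1] := up_log_bounds (isT : 1 < 2)%N a_gt1; rewrite (leq_trans h1)// leq_exp2l.
have cb' : (2 ^ c.+1 <= b)%N.
  by have /andP[h1 _] := trunc_log_bounds (isT : 1 < 2)%N (isT : 0 < b)%N; rewrite (leq_trans _ h1)// leq_exp2l.
apply: (@le_trans _ _ (\sum_(2 ^ c <= k < 2 ^ c.+1) w e k)); last first.
  rewrite /bin_weight.
  have -> : l = l.-1.+1 by [].
  rewrite big_gap_lists /= mulr0 add0r.
  have cc : (2 ^ c <= 2 ^ c.+1)%N by rewrite leq_exp2l.
  rewrite (big_cat_nat (n := (2 ^ c)%N) ac' (leq_trans cc cb')) /=.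
  rewrite [X in _ <= _ + X](big_cat_nat (n := (2 ^ c.+1)%N) cc cb') /=.
  rewrite addrCA ler_wpDr//.
    by apply: addr_ge0; apply: sumr_ge0 => k _; apply: sumr_ge0 => g _;
      rewrite mulr_ge0 ?weight_ge0.
  rewrite big_nat [leRHS]big_nat; apply: ler_sum => k /andP[ck kc].
  pose F g := weight w e (k :: g) * (dyadic_bin (k :: g) == Some c)%:R.
  have -> : w e k = F [::].
    by rewrite /F /weight big_seq1 /= (@trunc_log_eq 2 c k) ?ck ?kc// eqxx mulr1.
  apply: (@ler_term_sum _ _ _ F) => [g|]; first by rewrite mulr_ge0 ?weight_ge0.
  exact: nil_gap_lists.
apply: (@le_trans _ _ (\sum_(2 ^ c <= k < 2 ^ c.+1) (bmin / (4 * L) / (2 ^ c)%:R))).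
  rewrite sumr_const_nat expnS mul2n -addnn addnK -[leRHS]mulr_natr.
  have c0 : (2 ^ c)%:R != 0 :> R by rewrite pnatr_eq0 -lt0n expn_gt0.
  rewrite divfK// /al.
  have p2 : pair_partition w a b l e <= 2 by exact: sum_weight_le2.
  apply: (@le_trans _ _ (bmin / (8 * L) * 2)); first by rewrite ler_wpM2l// ltW.
  by rewrite le_eqVlt; apply/orP; left; apply/eqP; field; rewrite lt0r_neq0.
rewrite big_nat [leRHS]big_nat; apply: ler_sum => k /andP[ck kc].
apply: le_trans (w_ge eP (leq_trans ac' ck)).
have /andP[b0 b1] := beta_range eP; have bm := bmin_le eP.
have q2 : 1 / 2 <= 1 - 2 / l%:R ^+ 2 :> R.
  have : 2 / l%:R ^+ 2 <= l%:R^-1 :> R.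
    rewrite ler_pdivrMr ?exprn_gt0// expr2 mulrA mulVf ?lt0r_neq0// mul1r.
    by rewrite (ler_nat _ 2) (leq_trans _ l16).
  by have := invl_le; have := eta_small; move: (2 / _) (l%:R^-1) => x y; lra.
have k0 : 0 < k%:R :> R by rewrite ltr0n (leq_trans _ ck)// expn_gt0.
have c0 : 0 < (2 ^ c)%:R :> R by rewrite ltr0n expn_gt0.
have kc' : k%:R <= 2 * (2 ^ c)%:R :> R by rewrite -natrM ler_nat -expnS ltnW.
have iv : (2 * (2 ^ c)%:R)^-1 <= k%:R^-1 :> R by rewrite lef_pV2 ?posrE// mulr_gt0.
apply: (@le_trans _ _ (bmin / L * (1 / 2) * (2 * (2 ^ c)%:R)^-1)).
  by rewrite le_eqVlt; apply/orP; left; apply/eqP; field; rewrite !lt0r_neq0.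
have bl : 0 <= bmin / L by rewrite divr_ge0 ?ltW.
have half0 : 0 <= 1 / 2 :> R by lra.
have bL : bmin / L <= beta e / L by rewrite ler_wpM2r// invr_ge0 ltW.
have i0 : 0 <= (2 * (2 ^ c)%:R)^-1 :> R by rewrite invr_ge0 mulr_ge0.
exact: ler_pM (mulr_ge0 bl half0) i0 (ler_pM bl half0 bL q2) iv.
Qed.

Let sizeB_ge : L / 2 <= (size B)%:R.
Proof.
have b0 : 0 < b%:R :> R by [].
have NR : 0 < N%:R :> R by rewrite ltr0n (leq_trans _ N3).
have lnb : L - ln l%:R <= ln b%:R.
  rewrite lerBlDr -lnM ?posrE// /L /logN ler_ln ?posrE ?mulr_gt0// -natrM ler_nat.
  by rewrite ltnW// /b ltn_ceil.
have lnl := lnl_le.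
have /andP[_ hb] := trunc_log_bounds (isT : 1 < 2)%N (isT : 0 < b)%N.
have B1 : ln b%:R <= (trunc_log 2 b)%:R + 1 :> R.
  apply: (@le_trans _ _ (ln (2 ^ (trunc_log 2 b).+1)%:R)).
    by rewrite ler_ln ?posrE ?ltr0n ?expn_gt0// ler_nat ltnW.
  by rewrite natrX lnXn// -[leLHS]mulr_natl -natr1 ler_piMr.
have /andP[ha _] := up_log_bounds (isT : 1 < 2)%N a_gt1.
have B0 : (up_log 2 a)%:R <= 40 * ln L + 1.
  apply: (@le_trans _ _ ((up_log 2 a).-1%:R + 1)).
    by rewrite natr1 ler_nat leqSpred.
  rewrite lerD2r.
  have : ln (2 ^ (up_log 2 a).-1)%:R <= ln a%:R :> R.
    by rewrite ler_ln ?posrE ?ltr0n ?expn_gt0// ?ler_nat ltnW.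
  rewrite natrX lnXn// -[X in X <= _]mulr_natl /a natrX lnXn// -[X in _ <= X]mulr_natl.
  move=> hh.
  have u0 : 0 <= (up_log 2 a).-1%:R :> R by [].
  have := ln2_ge; nra.
have lnL2 := ln_le_2sqrt L0.
have s200 : 200 <= Num.sqrt L.
  by rewrite -(ger0_norm (ler0n R 200)) -sqrtr_sqr ler_wsqrtr.
have Ls : L = Num.sqrt L ^+ 2 by rewrite sqr_sqrtr// ltW.
have key : 42 * ln L + 2 <= L / 2 by rewrite Ls in lnL2 *; rewrite -Ls in lnL2 *; nra.
have Bn : (trunc_log 2 b)%:R - (up_log 2 a)%:R <= (size B)%:R :> R.
  by rewrite size_iota lerBlDr -natrD ler_nat addnC -maxnE leq_maxr.
apply: le_trans Bn; lra.
Qed.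

Let sizeB_le : (size B)%:R <= 2 * L.
Proof.
have NR : 0 < N%:R :> R by rewrite ltr0n (leq_trans _ N3).
apply: (@le_trans _ _ (trunc_log 2 b)%:R); first by rewrite size_iota ler_nat leq_subr.
have /andP[hb _] := trunc_log_bounds (isT : 1 < 2)%N (isT : 0 < b)%N.
have bN : (b <= N)%N.
  have := leq_divM N l; have := l16; have := N3; rewrite /b; move: (N %/ l)%N l => q r; clear; nia.
have : ln (2 ^ trunc_log 2 b)%:R <= L.
  by rewrite /L /logN ler_ln ?posrE ?ltr0n ?expn_gt0// ?(leq_trans _ N3)// ler_nat (leq_trans hb).
rewrite natrX lnXn// -[X in X <= _]mulr_natl.
have u0 : 0 <= (trunc_log 2 b)%:R :> R by [].
have := ln2_ge; nra.
Qed.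

(** All but a fraction exp (- ka) of the total weight is on families with a cherry,
    and those among them that are separated gain the factor 1 + 1/1024. *)
Lemma moment_ge_prod_cherry (ka : R) : 0 <= ka -> ka <= bmin ^+ 2 / 512 * (m%:R ^+ 3 / L) ->
  (1 + 1 / 1024 * (1 - expR (- ka))) *
  ((\prod_(e in Pairs h) (1 / (1 - beta e))) * expR (- (84 * (h%:R ^+ 2 * eta))))
  <= moment N beta.
Proof.
move=> ka0 kale; pose es := stars ++ [seq e <- es0 | e \notin stars].
have pes : perm_eq es es0.
  apply: uniq_perm; rewrite ?enum_uniq//.
    rewrite cat_uniq stars_uniq filter_uniq ?enum_uniq// andbT/=.
    by apply/hasPn => e; rewrite mem_filter => /andP[].
  move=> e; rewrite mem_cat mem_filter; case: (boolP (e \in stars)) => //= es'.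
  by rewrite mem_enum starsP.
apply: le_trans (moment_ge_weights pes).
set P := \prod_(e <- es) pair_partition w a b l e.
have P0 : 0 <= P by exact: prod_pair_partition_ge0.
have sI : size I = m by rewrite size_enum_range ?subn0// (leq_trans _ m3)// leq_pmull.
have sJ1 : size J1 = m.
  by rewrite size_enum_range ?(leq_trans _ m3) ?leq_mul2r ?orbT// mul2n -addnn addnK.
have sJ2 : size J2 = m by rewrite size_enum_range ?m3// mulSn addnK.
have J12 : {in J1, forall j, j \notin J2}.
  move=> j; rewrite !mem_filter => /andP[/andP[j1 j2] _].
  by rewrite negb_and [(_ <= j)%N]leqNgt j2.
have m0 : 0 <= m%:R :> R by [].
have mh : m%:R ^+ 2 <= L.
  apply: le_trans hL; by rewrite lerXn2r ?nnegrE// ler_nat leq_div.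
have mm : m%:R <= m%:R ^+ 2 :> R by rewrite -natrX ler_nat; case: (m) => // k; rewrite -mulnn leq_pmulr.
have bm1 : bmin <= 1 \/ m = 0%N.
  have [->|mp] := posnP m; [by right|left].
  have : (0 < size stars)%N.
    by rewrite size_allpairs size_cat sI sJ1 sJ2 muln_gt0 mp addn_gt0 mp.
  case: (stars) starsP => // e s sP _.
  have eP := sP e (mem_head _ _); have := bmin_le eP; have /andP[_] := beta_range eP; lra.
have c1 : m%:R ^+ 2 * al <= 1.
  case: bm1 => [bm1|->]; last by rewrite expr0n mul0r.
  rewrite /al mulrA ler_pdivrMr ?mulr_gt0//; nra.
have c2 : m%:R * al <= 1 by apply: le_trans c1; rewrite ler_wpM2r// ltW.
have noch : \sum_(f <- families (gap_lists a b l) es) fweight w f * (~~ cherry f)%:R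
   <= expR (- ka) * P.
  have H := @cherry_weight R h w a b l w_ge0 (ltnW a_gt1) I J1 J2
     [seq e <- es0 | e \notin stars] B al J12 (iota_uniq _ _) (ltW al_gt0) bin_weight_ge.
  rewrite sJ1 sJ2 sI in H; apply: le_trans (H c2 _) _.
    by rewrite mulrA -expr2.
  rewrite ler_wpM2r//; set p := m%:R * m%:R * (size B)%:R * al ^+ 2 / 4.
  have p_ge : bmin ^+ 2 / 512 * (m%:R ^+ 2 / L) <= p.
    rewrite /p; apply: (@le_trans _ _ (m%:R * m%:R * (L / 2) * al ^+ 2 / 4)).
      by rewrite le_eqVlt; apply/orP; left; apply/eqP; rewrite /al; field; rewrite lt0r_neq0.
    by rewrite !ler_wpM2r// ?sqr_ge0// ler_wpM2l// mulr_ge0.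
  have p_le1 : p <= 1.
    have -> : p = (m%:R ^+ 2 * al) * ((size B)%:R * al) / 4 by rewrite /p; ring.
    case: bm1 => [bm1|->]; last by rewrite expr0n !mul0r.
    have s1 : (size B)%:R * al <= 1.
      rewrite /al mulrA ler_pdivrMr ?mulr_gt0//.
      have sb : (size B)%:R * bmin <= (size B)%:R by rewrite ler_piMr.
      by have := sizeB_le; have := L0; lra.
    have a0 := ltW al_gt0.
    have x0 : 0 <= m%:R ^+ 2 * al by rewrite mulr_ge0 ?exprn_ge0.
    have y0 : 0 <= (size B)%:R * al by rewrite mulr_ge0.
    by rewrite ler_pdivrMr//; nra.
  apply: (@le_trans _ _ (expR (- p) ^+ m)).
    by rewrite lerXn2r ?nnegrE ?expR_ge0 ?subr_ge0//; exact: expR_ge1Dx.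
  rewrite -expRM_natl ler_expR mulrN lerN2; apply: le_trans kale _.
  apply: le_trans (ler_wpM2l m0 p_ge); rewrite le_eqVlt; apply/orP; left; apply/eqP.
  by ring.
set E := expR (- ka) in noch *.
have E0 : 0 <= E by exact: expR_ge0.
pose c : R := 1 / 1024; have c0 : 0 <= c by rewrite /c; lra.
have c11 : c <= 1 by rewrite /c; lra.
rewrite -/c.
have Sge : ((1 + c) * (1 - 8 * l%:R^-1) - c * E) * P <=
  \sum_(f <- families (gap_lists a b l) es)
    fweight w f * ((time_separated (l ^ 6) f)%:R * (1 + c * (cherry f)%:R)).
  apply: (@le_trans _ _ ((1 + c) * (P - \sum_(f <- families (gap_lists a b l) es)
      fweight w f * (~~ time_separated (l ^ 6) f)%:R)
      - c * \sum_(f <- families (gap_lists a b l) es) fweight w f * (~~ cherry f)%:R)).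
    have := bad_mass pes; rewrite -/P; set X := \sum_(f <- _) _ => hX.
    set Y := \sum_(f <- _) _ in noch *.
    have h1 : c * Y <= c * (E * P) by rewrite ler_wpM2l.
    have h2 : (1 + c) * X <= (1 + c) * (8 / l%:R * P) by rewrite ler_wpM2l// addr_ge0.
    by move: (l%:R^-1 : R) h1 h2 => v h1 h2; lra.
  rewrite /P -sum_fweight -sumrB mulr_sumr mulr_sumr -sumrB; apply: ler_sum => f _.
  have f0 := fweight_ge0 w_ge0 f.
  by case: time_separated; case: cherry => /=; nra.
apply: le_trans (ler_wpM2l (sqr_ge0 _) Sge).
have E1 : E <= 1 by rewrite expR_le1 oppr_le0.
have k16 : 0 <= (16 : R) <= 32 by apply/andP; split; lra.
have G0 : 0 <= 1 + c * (1 - E) by rewrite addr_ge0// mulr_ge0// subr_ge0.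
apply: (@le_trans _ _ ((1 + c * (1 - E)) * (((1 - l%:R^-1) ^+ 2 * (1 - 16 * l%:R^-1)) * P))).
  rewrite ler_wpM2l//.
  apply: le_trans (ler_pM _ _ (loss_ge k16) (prod_part_ge pes)).
  - by rewrite [leRHS]mulrCA -expRD le_eqVlt; apply/orP; left; apply/eqP; congr (_ * expR _); ring.
  - exact: expR_ge0.
  - by rewrite mulr_ge0 ?expR_ge0.
rewrite [leLHS](_ : _ = (1 - l%:R^-1) ^+ 2 * (((1 + c * (1 - E)) * (1 - 16 * l%:R^-1)) * P)); last by ring.
rewrite ler_wpM2l ?sqr_ge0// ler_wpM2r//.
have v0 : 0 < l%:R^-1 :> R by rewrite invr_gt0.
move: (l%:R^-1 : R) v0 => v v0.
have cE : c * E <= c by rewrite ler_piMr.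
have : 0 <= v * (8 + 8 * c - 16 * (c * E)) by rewrite mulr_ge0 ?(ltW v0)//; lra.
by lra.
Qed.

End Cherries.
End MomentBound.

(** * Conclusion *)

Lemma ln3_gt1 (R : realType) : 1 < ln (3 : R).
Proof.
rewrite -[ltLHS]expRK ltr_ln ?posrE ?expR_gt0//.
have e6 : expR (1 / 6) <= 6 / 5 :> R.
  have := expR_ge1Dx (- (1 / 6) : R); have := expRxMexpNx_1 (1 / 6 : R).
  by have := expR_gt0 (1 / 6 : R); nra.
have -> : 1 = 6%:R * (1 / 6) :> R by field.
rewrite expRM_natl; apply: (@le_lt_trans _ _ ((6 / 5) ^+ 6)).
  by rewrite lerXn2r ?nnegrE ?expR_ge0//; lra.
by lra.
Qed.

Local Open Scope classical_set_scope.
Local Open Scope ring_scope.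

Lemma ge_limn_einf (R : realType) (u : nat -> \bar R) (v : R) :
  (forall e : R, 0 < e -> \forall N \near \oo, ((v - e)%:E <= u N)%E) ->
  (v%:E <= limn_einf u)%E.
Proof.
move=> uv; apply/lee_subgt0Pr => e e0; rewrite -EFinB limn_einf_lim.
have [M _ uM] := uv e e0.
apply: lime_ge; first exact: is_cvg_einfs.
exists M => // n /= Mn; apply: le_ereal_inf_tmp => _ [k /= nk <-].
by apply: uM; exact: leq_trans nk.
Qed.

Lemma near_logN_ge (R : realType) (A : R) : \forall N \near \oo, A <= logN R N.
Proof.
exists (Num.truncn (expR A)).+1 => // N /= AN.
have NA : expR A <= N%:R.
  by apply: (le_trans (ltW (truncnS_gt _))); rewrite ler_nat.
by rewrite /logN -[leLHS]expRK ler_ln ?posrE ?expR_gt0// (lt_le_trans _ NA) ?expR_gt0.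
Qed.

Lemma near_ge (M : nat) : \forall N \near \oo, (M <= N)%N.
Proof. by exists M. Qed.

(** With at most one walk there are no pairs. *)
Lemma moment_le1 (R : realType) (N h : nat) (beta : 'I_h * 'I_h -> R) : (h <= 1)%N ->
  moment N beta = 1 /\ forall F : 'I_h * 'I_h -> R, \prod_(e in Pairs h) F e = 1.
Proof.
move=> h1; have P0 : Pairs h = finset.set0.
  apply/finset.setP => -[[i ih] [j jh]]; rewrite !inE /=; apply/negbTE; lia.
split=> [|F]; last by rewrite P0 finset.big_set0.
rewrite /moment /expect.
under eq_bigr => S _ do rewrite P0 finset.big_set0 expR0.
rewrite sumr_const mulfV// pnatr_eq0 -lt0n; apply/card_gt0P.
by exists [ffun=> [ffun=> (true, true)]].
Qed.

Section Threshold.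
Context (R : realType).
Let c0 : R := ln (ln 3) / 100 ^+ 2.

Lemma threshold_gt0 : 0 < c0.
Proof. by rewrite divr_gt0 ?exprn_gt0// ln_gt0// ln3_gt1. Qed.

(** The constant is chosen so that the loglog in the denominator is absorbed for
    every [N >= 3]; in particular [h >= 2] forces [log N >= 200^2]. *)
Lemma threshold_sqr (N h : nat) : (3 <= N)%N ->
  h%:R <= Num.sqrt (c0 * logN R N / ln (logN R N)) ->
  h%:R ^+ 2 <= logN R N / 100 ^+ 2.
Proof.
move=> N3 hs; have l3 := ln3_gt1 R.
have L3 : ln 3 <= logN R N.
  by rewrite /logN ler_ln ?posrE ?ltr0n ?(leq_trans _ N3)// (ler_nat R 3).
have k0 : 0 < ln (ln 3 : R) by rewrite ln_gt0.
have kL : ln (ln 3) <= ln (logN R N) by rewrite ler_ln ?posrE; lra.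
have L0 : 0 < logN R N by lra.
have x0 : 0 <= c0 * logN R N / ln (logN R N).
  by rewrite divr_ge0 ?mulr_ge0 ?(ltW threshold_gt0)//; lra.
have : h%:R ^+ 2 <= c0 * logN R N / ln (logN R N).
  by rewrite -[leRHS]sqr_sqrtr// lerXn2r ?nnegrE ?sqrtr_ge0.
move=> /le_trans; apply; rewrite ler_pdivrMr; last by lra.
rewrite /c0; set H := 100 ^+ 2; set L := logN R N in L0 *.
have -> : ln (ln 3) / H * L = L / H * ln (ln 3) by ring.
by rewrite ler_wpM2l// divr_ge0 ?exprn_ge0// ltW.
Qed.

End Threshold.

Lemma limn_einf_moment_ge1 (R : realType) (h : nat -> nat)
    (beta : forall N, 'I_(h N) * 'I_(h N) -> R) (x : nat -> R) :
  (forall N e, e \in Pairs (h N) -> beta N e < 1) ->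
  (\forall N \near \oo,
     (\prod_(e in Pairs (h N)) (1 / (1 - beta N e))) * expR (- x N) <= moment N (beta N)) ->
  (x @ \oo --> (0 : R))%classic ->
  (1 <= limn_einf (fun N =>
    (moment N (beta N) * \prod_(e in Pairs (h N)) (1 - beta N e))%:E))%E.
Proof.
move=> b1 mom x0; apply: ge_limn_einf => e e0.
have xe : \forall N \near \oo, `|x N| < e by exact: ((cvgr0Pnorm_lt _).1 x0 e e0).
near=> N.
have mN : (\prod_(e in Pairs (h N)) (1 / (1 - beta N e))) * expR (- x N)
  <= moment N (beta N) by near: N.
have xN : `|x N| < e by near: N.
rewrite lee_fin; apply: (@le_trans _ _ (expR (- x N))).
  apply: le_trans (expR_ge1Dx _); rewrite lerD2l lerN2.
  by apply: le_trans (ler_norm _) _; exact: ltW.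
set P := \prod_(e in _) (1 - _).
have P0 : 0 < P by apply: prodr_gt0 => d dP; rewrite subr_gt0 b1.
have PV : \prod_(e in Pairs (h N)) (1 / (1 - beta N e)) = P^-1.
  by rewrite /P -prodfV; apply: eq_bigr => d _; rewrite div1r.
by rewrite -ler_pdivrMr// mulrC -PV.
Unshelve. all: by end_near. Qed.

Lemma le_third_cube (R : realType) (h : nat) (C L : R) :
  0 < C -> 0 < L -> 27 / C ^+ 3 <= L -> C * L `^ (1 / 3) <= h%:R ->
  (3 <= h)%N /\ C ^+ 3 / 216 <= (h %/ 3)%:R ^+ 3 / L.
Proof.
move=> C0 L0 CL hC.
have C3 : 0 < C ^+ 3 by exact: exprn_gt0.
have h3 : C ^+ 3 * L <= h%:R ^+ 3.
  have -> : C ^+ 3 * L = (C * L `^ (1 / 3)) ^+ 3.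
    have L3 : (L `^ (1 / 3)) ^+ 3 = L.
      rewrite -powR_mulrn ?powR_ge0// -powRrM (_ : 1 / 3 * 3 = 1 :> R); last by field.
      by rewrite powRr1 ?ltW.
    by rewrite exprMn L3.
  by rewrite lerXn2r ?nnegrE// mulr_ge0 ?powR_ge0 ?ltW.
have h27 : 27 <= h%:R ^+ 3 :> R.
  by apply: le_trans h3; rewrite mulrC -ler_pdivrMr.
have h_ge3 : (3 <= h)%N.
  rewrite leqNgt; apply/negP => h_lt3; have : h%:R <= 2 :> R by rewrite (ler_nat R h 2).
  have h0 : 0 <= h%:R :> R by [].
  move=> h2; suff : h%:R ^+ 3 <= 2 ^+ 3 :> R by lra.
  by rewrite lerXn2r ?nnegrE.
split=> //.
have h6 : h%:R <= 6 * (h %/ 3)%:R :> R.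
  by rewrite -(natrM R 6) ler_nat; move: h_ge3; clear; lia.
rewrite ler_pdivlMr// mulrAC (ler_pdivrMr _ _ (ltr0Sn R 215)); apply: le_trans h3 _.
apply: (@le_trans _ _ ((6 * (h %/ 3)%:R) ^+ 3)); first by rewrite lerXn2r ?nnegrE ?mulr_ge0.
by rewrite le_eqVlt; apply/orP; left; apply/eqP; ring.
Qed.

Theorem theorem1p4 (R : realType) (bbar : R)
    (hbbar : 0 < bbar < 1 / 72) (hCZ : cosco_zeitouni bbar)
    (bmin bmax : R) (hmin : 0 < bmin) (hle : bmin <= bmax)
    (hmax : bmax < 1 / 4 * bbar) :
  exists c0 C : R, [/\ 0 < c0, 0 < C,
    (* (i), quantitative bound *)
    forall N h : nat, (3 <= N)%N ->
      h%:R <= Num.sqrt (c0 * logN R N / ln (logN R N)) ->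
      exists r : R, [/\ 0 <= r,
        r <= C * (h%:R ^+ 2 * ln (logN R N) / logN R N) &
        forall beta : 'I_h * 'I_h -> R, in_box bmin bmax beta ->
          (\prod_(e in Pairs h) (1 / (1 - beta e))) * expR (- r)
            <= moment N beta],
    (* (i), consequence; uniformity in beta: beta may vary with N *)
    forall (h : nat -> nat) (beta : forall N, 'I_(h N) * 'I_(h N) -> R),
      (\forall N \near \oo,
         (h N)%:R <= Num.sqrt (c0 * logN R N / ln (logN R N))) ->
      (forall N, in_box bmin bmax (beta N)) ->
      (fun N => (h N)%:R ^+ 2 * ln (logN R N) / logN R N) @ \oo --> (0 : R) ->
      (1 <= limn_einf (fun N =>
         (moment N (beta N) * \prod_(e in Pairs (h N)) (1 - beta N e))%:E))%E &
    (* (ii) *)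
    forall C' : R, 0 < C' -> exists2 delta : R, 0 < delta &
      forall h : nat -> nat,
        (\forall N \near \oo,
           (h N)%:R <= Num.sqrt (c0 * logN R N / ln (logN R N))) ->
        (fun N => (h N)%:R / Num.sqrt (logN R N / ln (logN R N)))
          @ \oo --> (0 : R) ->
        (\forall N \near \oo, C' * logN R N `^ (1 / 3) <= (h N)%:R) ->
        \forall N \near \oo,
          forall beta : 'I_(h N) * 'I_(h N) -> R, in_box bmin bmax beta ->
            expR delta * \prod_(e in Pairs (h N)) (1 / (1 - beta e))
              <= moment N beta].
Proof.
pose c0 : R := ln (ln 3) / 100 ^+ 2.
have box_le (h : nat) (beta : 'I_h * 'I_h -> R) : in_box bmin bmax beta ->
    (forall e, e \in Pairs h -> 0 <= beta e <= 1 / 288) /\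
    (forall e, e \in Pairs h -> bmin <= beta e).
  move=> bx; split=> e /bx/andP[b1 b2] //; apply/andP; split; first by lra.
  by case/andP: hbbar; lra.
have r_ge0 (N h : nat) : (3 <= N)%N ->
    0 <= 68 * (h%:R ^+ 2 * ln (logN R N) / logN R N).
  move=> N3; have L1 : 1 <= logN R N.
    apply: le_trans (ltW (ln3_gt1 R)) _.
    by rewrite /logN ler_ln ?posrE ?ltr0n ?(leq_trans _ N3)// (ler_nat R 3).
  have i0 : 0 <= (logN R N)^-1 by rewrite invr_ge0 (le_trans ler01).
  exact: mulr_ge0 (ler0n _ 68) (mulr_ge0 (mulr_ge0 (sqr_ge0 _) (ln_ge0 L1)) i0).
have quant (N h : nat) (beta : 'I_h * 'I_h -> R) : (3 <= N)%N ->
    h%:R <= Num.sqrt (c0 * logN R N / ln (logN R N)) -> in_box bmin bmax beta ->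
    (\prod_(e in Pairs h) (1 / (1 - beta e)))
      * expR (- (68 * (h%:R ^+ 2 * ln (logN R N) / logN R N))) <= moment N beta.
  move=> N3 hN bx; have h2 := threshold_sqr N3 hN.
  have [h1|h1] := leqP h 1.
    have [-> ->] := moment_le1 N beta h1; rewrite mul1r expR_le1 oppr_le0.
    exact: r_ge0.
  rewrite -mulrA.
  have h2R : 2 <= h%:R :> R by rewrite (ler_nat R 2).
  have L4 : 200 ^+ 2 <= logN R N.
    have : 4 <= logN R N / 100 ^+ 2 by apply: le_trans h2; nra.
    by rewrite ler_pdivlMr ?exprn_gt0//; lra.
  apply: moment_ge_prod => //; last by case: (box_le _ _ bx).
  - by lra.
  - exact: ltnW.
  - by lra.
exists c0, 68; split.
- exact: threshold_gt0.
- by [].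
- move=> N h N3 hN; exists (68 * (h%:R ^+ 2 * ln (logN R N) / logN R N)).
  by split=> [||beta bx]; [exact: r_ge0|exact: lexx|exact: quant].
- move=> h beta hN bx x0.
  apply: (@limn_einf_moment_ge1 R h beta
    (fun N => 68 * ((h N)%:R ^+ 2 * ln (logN R N) / logN R N))).
  + move=> N e eP; have [/(_ e eP)/andP[_ b1] _] := box_le _ _ (bx N).
    by apply: le_lt_trans b1 _; lra.
  + near=> N; apply: quant; [|by near: N|exact: bx].
    by near: N; exact: near_ge.
  + have := cvgM (cvg_cst (68 : R)) x0; rewrite mulr0; exact.
move=> C' C'0.
pose ka : R := bmin ^+ 2 / 512 * (C' ^+ 3 / 216).
have ka0 : 0 < ka.
  exact: mulr_gt0 (divr_gt0 (exprn_gt0 2 hmin) (ltr0Sn R 511))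
                  (divr_gt0 (exprn_gt0 3 C'0) (ltr0Sn R 215)).
pose G : R := 1 + 1 / 1024 * (1 - expR (- ka)).
have G1 : 1 < G.
  have e1 : expR (- ka) < 1 by rewrite expR_lt1 oppr_lt0.
  by rewrite /G; lra.
have lnG : 0 < ln G by exact: ln_gt0.
exists (ln G / 2); first by lra.
move=> h hN small large.
pose s := Num.sqrt (ln G / 168).
have s0 : 0 < s by rewrite sqrtr_gt0; lra.
have small_s : \forall N \near \oo,
    `|(h N)%:R / Num.sqrt (logN R N / ln (logN R N))| < s.
  exact: ((cvgr0Pnorm_lt _).1 small s s0).
near=> N => beta bx.
have N3 : (3 <= N)%N by near: N; exact: near_ge.
have L_ge : 200 ^+ 2 <= logN R N by near: N; exact: near_logN_ge.
have L_geC : 27 / C' ^+ 3 <= logN R N by near: N; exact: near_logN_ge.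
have hNN : (h N)%:R <= Num.sqrt (c0 * logN R N / ln (logN R N)) by near: N.
have sN : `|(h N)%:R / Num.sqrt (logN R N / ln (logN R N))| < s by near: N.
have lN : C' * logN R N `^ (1 / 3) <= (h N)%:R by near: N.
have L0 : 0 < logN R N by lra.
have L1 : 0 < ln (logN R N) by apply: ln_gt0; lra.
have h2 := threshold_sqr N3 hNN.
have [h3 m3] := le_third_cube C'0 L0 L_geC lN.
have [b1 b2] := box_le _ _ bx.
have x_le : 84 * ((h N)%:R ^+ 2 * (ln (logN R N) / logN R N)) <= ln G / 2.
  have -> : (h N)%:R ^+ 2 * (ln (logN R N) / logN R N)
     = ((h N)%:R / Num.sqrt (logN R N / ln (logN R N))) ^+ 2.
    rewrite exprMn exprVn sqr_sqrtr; last by rewrite divr_ge0 ?ltW.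
    by rewrite invf_div.
  set t := (h N)%:R / _ in sN *.
  have : t ^+ 2 <= s ^+ 2.
    by rewrite -(ger0_norm (sqr_ge0 t)) normrX lerXn2r ?nnegrE ?(ltW s0)// ltW.
  rewrite sqr_sqrtr; lra.
have ka_le : ka <= bmin ^+ 2 / 512 * ((h N %/ 3)%:R ^+ 3 / logN R N).
  exact: ler_wpM2l (divr_ge0 (sqr_ge0 bmin) (ler0n R 512)) _ _ m3.
have L_ge1 : 100 ^+ 2 <= logN R N by lra.
have hL : (h N)%:R ^+ 2 <= logN R N by lra.
have := moment_ge_prod_cherry N3 L_ge1 (leq_trans (isT : 0 < 3)%N h3) hL b1 hmin b2 L_ge (ltW ka0) ka_le.
apply: le_trans; rewrite -/G.
set P := \prod_(e in _) _; set x := 84 * _ in x_le *.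
have P0 : 0 <= P.
  by apply: prodr_ge0 => e /b1/andP[_ be]; rewrite divr_ge0//; lra.
rewrite [leRHS]mulrCA [leLHS]mulrC ler_wpM2l//.
rewrite -{2}(@lnK R G) ?posrE ?(lt_trans ltr01)// -expRD ler_expR; lra.
Unshelve. all: by end_near. Qed.
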